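(* Suppose Assumptions 1, 2, 3 of the context hold and let $\{x_k\}$ be generated by the ZS-BMD method described in the context for $\min_{x\in X}\{\Phi(x)=f(x)+\chi(x)\}$. Let $\hat L=\max_{s\in\mathcal B}L_s$, and suppose $\alpha_k=1/\hat L$ for all $k$, $p_1=\dots=p_b=1/b$, $T_k=T'$ for all $k$, and $$P_R(k)=\mathrm{Prob}\{R=k\}=\frac{\alpha_k\min_{s\in\mathcal B}\{p_s(1-\frac{L_s}{2}\alpha_k)\}}{\sum_{k=1}^T\alpha_k\min_{s\in\mathcal B}\{p_s(1-\frac{L_s}{2}\alpha_k)\}},\quad k=1,\dots,T.$$ Then $$\mathbb E[\|\mathcal P(x_R,\nabla f(x_R),\alpha_R)\|^2]\le\frac{8b\hat L^2D_\Phi^2+8\mu^2L_f^2nb}{T}+\frac{16\tilde\sigma^2b}{T'}+\frac{\mu^2}{2}L_f^2(n+3)^3,$$ where $D_\Phi=[(\Phi(x_1)-\Phi^* )/\hat L]^{1/2}$, $\tilde\sigma^2=4(n+4)[2M^2+\sigma^2+\mu^2L_f^2(n+4)^2]$, and the expectation is over all the randomness of the method.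
   Context: Notation: $n=n_1+\dots+n_b$, $\mathcal B=\{1,\dots,b\}$, $U_s\in\mathbb R^{n\times n_s}$ with $(U_1,\dots,U_b)=I_n$; $x^{(s)}=U_s^Tx$, $\nabla_sf=U_s^T\nabla f$; $\|\cdot\|$, $\|\cdot\|_s$ are Euclidean norms on $\mathbb R^n$, $\mathbb R^{n_s}$. $X=X_1\times\cdots\times X_b$, each $X_s\subseteq\mathbb R^{n_s}$ closed convex. Problem: $\Phi=f+\chi$ with $f(x)=\mathbb E_\xi[F(x,\xi)]$ (possibly nonconvex), $\xi$ a random variable, $F$ Borel measurable and defined for all $x\in\mathbb R^n$; $\chi(x)=\sum_{s=1}^b\chi_s(x^{(s)})$ with $\chi_s:\mathbb R^{n_s}\to\mathbb R$ closed convex. $\Phi^*=\min_{x\in X}\Phi(x)$. Assumption 1: $\mathbb E[F(x,\xi)]=f(x)$ and $\mathbb E[\nabla F(x,\xi)]=\nabla f(x)$ for all $x$, and $\mathbb E[\|\nabla F(x,\xi)-\nabla f(x)\|^2]\le\sigma^2$ for all $x\in X$. Assumption 2: almost surely in $\xi$, $\|\nabla F(x,\xi)-\nabla F(y,\xi)\|\le L_f\|x-y\|$ for all $x,y$, and for each $s\in\mathcal B$, $\|\nabla_sF(x+U_sh,\xi)-\nabla_sF(x,\xi)\|_s\le L_s\|h\|_s$ for all $x$ and all $h\in\mathbb R^{n_s}$ ($L_f,L_s>0$). Assumption 3: $\|\nabla f(x)\|\le M$ for all $x\in X$. Generalized gradient: $\phi_s:\mathbb R^{n_s}\to\mathbb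 R$ is differentiable and 1-strongly convex, $D_{\phi_s}(x,y)=\phi_s(x)-\phi_s(y)-\langle\nabla\phi_s(y),x-y\rangle$. For $\alpha>0$, $P_s(x^{(s)},g^{(s)},\alpha)=\arg\min_{y\in X_s}\{\langle g^{(s)},y\rangle+\frac1\alpha D_{\phi_s}(y,x^{(s)})+\chi_s(y)\}$, $\mathcal P_s(x,g,\alpha)=\frac1\alpha[x^{(s)}-P_s(x^{(s)},g^{(s)},\alpha)]$, and $\mathcal P(x,g,\alpha)=(\mathcal P_1(x,g,\alpha),\dots,\mathcal P_b(x,g,\alpha))$. Zeroth-order gradient: for $\mu>0$, $G_\mu(x,\xi,u)=\frac{F(x+\mu u,\xi)-F(x,\xi)}{\mu}u$. ZS-BMD method: given $x_1\in X$, $\mu>0$, iteration count $T$, stepsizes $\alpha_k>0$, batch sizes $T_k\ge1$, probabilities $p_s\in[0,1]$ with $\sum_sp_s=1$. Draw i.i.d. block indices $i_k$ with $\mathrm{Prob}\{i_k=s\}=p_s$ and $R\in\{1,\dots,T\}$ with probability mass function $P_R$. At step $k$ draw $u_{k,t}\sim N(0,I_n)$ and oracle samples $\xi_{k,t}$ distributed as $\xi$, $t=1,\dots,T_k$, set $G_{\mu,k}^{(i_k)}=\frac1{T_k}\sum_{t=1}^{T_k}U_{i_k}^TG_\mu(x_k,\xi_{k,t},u_{k,t})$, and update $x_{k+1}^{(i_k)}=P_{i_k}(x_k^{(i_k)},G_{\mu,k}^{(i_k)},\alpha_k)$, $x_{k+1}^{(s)}=x_k^{(s)}$ for $s\neq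 i_k$. Output $x_R$. All random quantities $i_k,\xi_{k,t},u_{k,t},R$ are mutually independent. *)

(* Defs.v *)
From HB Require Import structures.
From mathcomp Require Import all_boot all_order all_algebra finmap.
From mathcomp Require Import all_classical all_reals all_analysis.
Set Implicit Arguments.
Unset Strict Implicit.
Unset Printing Implicit Defensive.
Import Order.TTheory GRing.Theory Num.Theory.
Import numFieldNormedType.Exports.
Local Open Scope classical_set_scope.
Local Open Scope ring_scope.

(* The library norm on matrices is the sup norm, so the Euclidean structure is
   introduced here; the topology is the same. *)
Definition dot (R : realType) (m : nat) (x y : 'cV[R]_m) : R :=
  \sum_(i < m) x i 0 * y i 0.

Definition enorm (R : realType) (m : nat) (x : 'cV[R]_m) : R :=
  Num.sqrt (dot x x).

Definition grad (R : realType) (m : nat) (h : 'cV[R]_m -> R) (x : 'cV[R]_m) :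
    'cV[R]_m :=
  \col_(i < m) 'D_(delta_mx i 0) h x.

Definition borel_cV (R : realType) (m : nat) :=
  g_sigma_algebraType (@open 'cV[R]_m).

(* Maximum and minimum of a finite nonempty family, where sup and inf are
   attained. *)
Definition fmax (R : realType) (b : nat) (a : 'I_b -> R) : R := sup (range a).
Definition fmin (R : realType) (b : nat) (a : 'I_b -> R) : R := inf (range a).

Definition is_minimum (R : realType) (T : Type) (A : set T) (J : T -> R)
    (v : R) : Prop :=
  (exists2 x, A x & J x = v) /\ forall x, A x -> v <= J x.

Notation totdim nb := (\sum_s nb s)%N.

(* The column blocks of the identity matrix: (U_1, ..., U_b) = I_n. *)
Definition U (R : realType) (b : nat) (nb : 'I_b -> nat) (s : 'I_b) :
    'M[R]_(totdim nb, nb s) :=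
  submxrow 1%:M s.
Arguments U {R b} nb s.

Definition blk (R : realType) (b : nat) (nb : 'I_b -> nat) (s : 'I_b)
    (x : 'cV[R]_(totdim nb)) : 'cV[R]_(nb s) :=
  (U nb s)^T *m x.
Arguments blk {R b} nb s x.

Definition block_product (R : realType) (b : nat) (nb : 'I_b -> nat)
    (Xs : forall s, set 'cV[R]_(nb s)) : set 'cV[R]_(totdim nb) :=
  [set x | forall s, Xs s (blk nb s x)].

Definition block_sum (R : realType) (b : nat) (nb : 'I_b -> nat)
    (chi : forall s, 'cV[R]_(nb s) -> R) (x : 'cV[R]_(totdim nb)) : R :=
  \sum_(s < b) chi s (blk nb s x).

Definition closed_convex_set (R : realType) (m : nat) (A : set 'cV[R]_m) :
    Prop :=
  closed A /\ convex_set A.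

Definition closed_convex_fun (R : realType) (m : nat) (h : 'cV[R]_m -> R) :
    Prop :=
  closed [set z : 'cV[R]_m * R | h z.1 <= z.2] /\
  convex_function [set: convex_lmodType 'cV[R]_m] h.

Definition strongly_convex1 (R : realType) (m : nat) (h : 'cV[R]_m -> R) :
    Prop :=
  forall (x y : 'cV[R]_m) (t : R), 0 <= t <= 1 ->
    h (t *: x + (1 - t) *: y) <=
    t * h x + (1 - t) * h y - t * (1 - t) / 2 * enorm (x - y) ^+ 2.

Definition bregman (R : realType) (m : nat) (phi : 'cV[R]_m -> R)
    (x y : 'cV[R]_m) : R :=
  phi x - phi y - dot (grad phi y) (x - y).

Definition argmin (R : realType) (T : Type) (A : set T) (J : T -> R) : set T :=
  [set y | A y /\ forall z, A z -> J y <= J z].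

(* [get] selects the element of the argmin set, which is a singleton under the
   standing assumptions (closed convex data, strongly convex objective). *)
Definition prox (R : realType) (m : nat) (A : set 'cV[R]_m)
    (phi chi : 'cV[R]_m -> R) (x g : 'cV[R]_m) (alpha : R) : 'cV[R]_m :=
  get (argmin A (fun y => dot g y + alpha^-1 * bregman phi y x + chi y)).

Definition gen_grad_block (R : realType) (m : nat) (A : set 'cV[R]_m)
    (phi chi : 'cV[R]_m -> R) (x g : 'cV[R]_m) (alpha : R) : 'cV[R]_m :=
  alpha^-1 *: (x - prox A phi chi x g alpha).

Definition gen_grad (R : realType) (b : nat) (nb : 'I_b -> nat)
    (Xs : forall s, set 'cV[R]_(nb s))
    (phi chi : forall s, 'cV[R]_(nb s) -> R)
    (x g : 'cV[R]_(totdim nb)) (alpha : R) : 'cV[R]_(totdim nb) :=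
  \mxcol_(s < b) gen_grad_block (Xs s) (phi s) (chi s)
                   (blk nb s x) (blk nb s g) alpha.

(* An expectation equal to a finite number entails integrability, because
   +oo - oo = -oo in \bar R. *)
Definition assumption1 (R : realType) (m : nat) (dXi : measure_display)
    (Xi : measurableType dXi) (Pxi : probability Xi R)
    (F : 'cV[R]_m -> Xi -> R) (f : 'cV[R]_m -> R) (X : set 'cV[R]_m)
    (sigma : R) : Prop :=
  [/\ forall x, ('E_Pxi[F x] = (f x)%:E)%E,
      forall x, differentiable f x,
      forall x i, ('E_Pxi[fun z => grad (F^~ z) x i 0%R] = (grad f x i 0%R)%:E)%E
    & forall x, X x ->
        ('E_Pxi[fun z => (enorm (grad (F^~ z) x - grad f x) ^+ 2)%R]
           <= (sigma ^+ 2)%R%:E)%E].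

(* The first conjunct makes explicit that F(., xi) has a gradient. *)
Definition assumption2 (R : realType) (b : nat) (nb : 'I_b -> nat)
    (dXi : measure_display) (Xi : measurableType dXi) (Pxi : probability Xi R)
    (F : 'cV[R]_(totdim nb) -> Xi -> R) (Lf : R) (L : 'I_b -> R) : Prop :=
  [/\ 0 < Lf, forall s, 0 < L s
    & {ae Pxi, forall z,
        [/\ forall x, differentiable (F^~ z) x,
            forall x y, enorm (grad (F^~ z) x - grad (F^~ z) y)
                          <= Lf * enorm (x - y)
          & forall (s : 'I_b) (x : 'cV[R]_(totdim nb)) (h : 'cV[R]_(nb s)),
              enorm (blk nb s (grad (F^~ z) (x + U nb s *m h))
                     - blk nb s (grad (F^~ z) x))
                <= L s * enorm h]}].

Definition assumption3 (R : realType) (m : nat) (f : 'cV[R]_m -> R)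
    (X : set 'cV[R]_m) (M : R) : Prop :=
  forall x, X x -> enorm (grad f x) <= M.

(* G j is the system of events determined by the j-th random quantity. *)
Definition mutually_independent (d : measure_display) (Omega : measurableType d)
    (R : realType) (P : probability Omega R) (J : choiceType) (A : set J)
    (G : J -> set_system Omega) : Prop :=
  forall K : {fset J}, [set` K] `<=` A ->
  forall E : J -> set Omega, (forall j, j \in K -> G j (E j)) ->
    P (\bigcap_(j in [set` K]) E j) = (\prod_(j <- K) P (E j))%E.

Definition std_gaussian (d : measure_display) (Omega : measurableType d)
    (R : realType) (P : probability Omega R) (m : nat)
    (u : Omega -> 'cV[R]_m) : Prop :=
  [/\ measurable_fun [set: Omega] (u : Omega -> borel_cV R m),
      forall (i : 'I_m) (B : set R), measurable B ->
        P ((fun w => u w i 0) @^-1` B) = normal_prob 0 1 B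
    & mutually_independent P [set: 'I_m]
        (fun i => preimage_set_system [set: Omega] (fun w => u w i 0)
                    measurable)].

(* Labels of the random draws of the method: i_k, xi_{k,t}, u_{k,t} and R. *)
Inductive draw : Type :=
  | Block of nat
  | Oracle of nat & nat
  | Direction of nat & nat
  | Stop.

Definition draw_encode (j : draw) :
    (nat + nat * nat) + (nat * nat + unit) :=
  match j with
  | Block k => inl (inl k)
  | Oracle k t => inl (inr (k, t))
  | Direction k t => inr (inl (k, t))
  | Stop => inr (inr tt)
  end.

Definition draw_decode (c : (nat + nat * nat) + (nat * nat + unit)) : draw :=
  match c with
  | inl (inl k) => Block k
  | inl (inr (k, t)) => Oracle k t
  | inr (inl (k, t)) => Direction k t
  | inr (inr tt) => Stop
  end.

Lemma draw_encodeK : cancel draw_encode draw_decode.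
Proof. by case. Qed.

HB.instance Definition _ := Countable.copy draw (can_type draw_encodeK).

Definition draws_made (T : nat) (batch : nat -> nat) : set draw :=
  [set j | match j with
           | Block k => (1 <= k <= T)%N
           | Oracle k t | Direction k t =>
               (1 <= k <= T)%N /\ (1 <= t <= batch k)%N
           | Stop => True
           end].

(* 'I_b carries the discrete sigma-algebra, hence [setT] for i_k. *)
Definition draw_events (d : measure_display) (Omega : measurableType d)
    (R : realType) (m b : nat) (dXi : measure_display)
    (Xi : measurableType dXi) (ik : nat -> Omega -> 'I_b)
    (xi : nat -> nat -> Omega -> Xi) (u : nat -> nat -> Omega -> 'cV[R]_m)
    (stop : Omega -> nat) (j : draw) : set_system Omega :=
  match j with
  | Block k => preimage_set_system [set: Omega] (ik k) setT
  | Oracle k t => preimage_set_system [set: Omega] (xi k t) measurable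
  | Direction k t =>
      preimage_set_system [set: Omega] (u k t : Omega -> borel_cV R m)
        measurable
  | Stop => preimage_set_system [set: Omega] stop measurable
  end.

(* [stop] is the output index R of the method, [batch k] is T_k. *)
Definition zsbmd_sampling (d : measure_display) (Omega : measurableType d)
    (R : realType) (P : probability Omega R) (m b : nat)
    (dXi : measure_display) (Xi : measurableType dXi) (Pxi : probability Xi R)
    (T : nat) (batch : nat -> nat) (p : 'I_b -> R) (PR : nat -> R)
    (ik : nat -> Omega -> 'I_b) (xi : nat -> nat -> Omega -> Xi)
    (u : nat -> nat -> Omega -> 'cV[R]_m) (stop : Omega -> nat) : Prop :=
  [/\ forall k s, (1 <= k <= T)%N ->
        measurable (ik k @^-1` [set s]) /\
        P (ik k @^-1` [set s]) = (p s)%:E,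
      forall k t, (1 <= k <= T)%N -> (1 <= t <= batch k)%N ->
        measurable_fun [set: Omega] (xi k t) /\
        forall B, measurable B -> P (xi k t @^-1` B) = Pxi B,
      forall k t, (1 <= k <= T)%N -> (1 <= t <= batch k)%N ->
        std_gaussian P (u k t),
      [/\ measurable_fun [set: Omega] stop,
          forall w, (1 <= stop w <= T)%N
        & forall k, (1 <= k <= T)%N -> P (stop @^-1` [set k]) = (PR k)%:E]
    & mutually_independent P (draws_made T batch) (draw_events ik xi u stop)].

Definition zo_grad (R : realType) (m : nat) (Xi : Type)
    (F : 'cV[R]_m -> Xi -> R) (mu : R) (x : 'cV[R]_m) (z : Xi)
    (u : 'cV[R]_m) : 'cV[R]_m :=
  ((F (x + mu *: u) z - F x z) / mu) *: u.

Definition zo_block_grad (R : realType) (b : nat) (nb : 'I_b -> nat)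
    (Xi : Type) (F : 'cV[R]_(totdim nb) -> Xi -> R) (mu : R) (N : nat)
    (x : 'cV[R]_(totdim nb)) (z : nat -> Xi)
    (u : nat -> 'cV[R]_(totdim nb)) (s : 'I_b) : 'cV[R]_(nb s) :=
  N%:R^-1 *: \sum_(1 <= t < N.+1) (U nb s)^T *m zo_grad F mu x (z t) (u t).
Arguments zo_block_grad {R b} nb {Xi} F mu N x z u s.

Definition zsbmd_iterates (R : realType) (b : nat) (nb : 'I_b -> nat)
    (Omega Xi : Type) (Xs : forall s, set 'cV[R]_(nb s))
    (phi chi : forall s, 'cV[R]_(nb s) -> R)
    (F : 'cV[R]_(totdim nb) -> Xi -> R) (mu : R) (T : nat)
    (alpha : nat -> R) (batch : nat -> nat)
    (ik : nat -> Omega -> 'I_b) (xi : nat -> nat -> Omega -> Xi)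
    (u : nat -> nat -> Omega -> 'cV[R]_(totdim nb))
    (x1 : 'cV[R]_(totdim nb)) (x : nat -> Omega -> 'cV[R]_(totdim nb)) :
    Prop :=
  (forall w, x 1 w = x1) /\
  forall k w s, (1 <= k <= T)%N ->
    blk nb s (x k.+1 w) =
      if s == ik k w then
        prox (Xs s) (phi s) (chi s) (blk nb s (x k w))
          (zo_block_grad nb F mu (batch k) (x k w)
             (fun t => xi k t w) (fun t => u k t w) s)
          (alpha k)
      else blk nb s (x k w).

(* Main.v *)
(* Write [Phi = f + chi] and let [P] be the generalized gradient at the true
   gradient. If [L_s alpha <= 1], a prox step on block [s] with direction [g]
   decreases [Phi] by at least [alpha (|P_s|^2 / 2 - <g_s - grad_s f, P_s>)],
   [P_s] taken at [g]. Averaging over a uniformly drawn block sums this over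
   [s], and monotonicity of [prox] replaces [P(x, g)] by [P(x, grad f)] at the
   price of [|g - grad f|^2]. Hence
     E Phi(x_(k+1)) <= E Phi(x_k) - alpha / (8 b) E |P(x_k)|^2 + noise,
   which is telescoped; the stepsizes being constant, the output index is
   uniform on [1, T], so the average of [E |P(x_k)|^2] is the left-hand side.

   The descent inequality is used for [f] itself, not for its Gaussian
   smoothing: the noise is then the squared bias of the zeroth-order gradient,
   at most [mu^2 Lf^2 n (n + 2) / 4], plus its second moment divided by the batch
   size, both computed from Gaussian moments of order at most 6.

   Conditioning on the past is replaced by decoupling: for a function [h] of the
   draws before step [k] and of those of step [k], the integral of [h w w] is the
   iterated integral of [h w w']. *)
Require Import Defs.
From HB Require Import structures.
From mathcomp Require Import all_boot all_order all_algebra finmap.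
From mathcomp Require Import all_classical all_reals all_analysis.
From mathcomp Require Import measurable_realfun.
From mathcomp Require Import ring lra zify.
Set Implicit Arguments.
Unset Strict Implicit.
Unset Printing Implicit Defensive.
Import Order.TTheory GRing.Theory Num.Theory.
Import numFieldNormedType.Exports.
Local Open Scope classical_set_scope.
Local Open Scope ring_scope.

(** * Euclidean space *)

(** Nothing is known beforehand about the integrability of [Phi] or of the generalized gradient
    along the iterates. Both come out of the descent inequality itself: [Phi - Phi_star] is
    nonnegative on [X], so each quantity is dominated by a bound already known to be summable, and
    summability travels through the induction together with the estimate. In the descent inequality
    the term linear in the error [delta = g - grad f] is paired with [P(x, grad f)], which does not
    depend on the current draws; its mean then sees the bias alone. Of the factor [1/2] of a prox
    step, one half pays for replacing [g] by [grad f] inside [P], and half of the remaining [1/4]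
    absorbs the pairing with the bias, whence [1/8]. Decoupling asks for joint measurability in past
    and present draws, while [prox] is defined by choice: measurability is obtained from its
    Lipschitz dependence on the data. Gradients of [F(., xi)] are controlled only off a null set, on
    which they are replaced by [0]. *)

Lemma continuous_sumR (R : realType) (T : topologicalType) (I : Type)
    (r : seq I) (h : I -> T -> R) :
  (forall i, continuous (h i)) -> continuous (fun x => \sum_(i <- r) h i x).
Proof.
by move=> hc x; apply: cvg_big => [|i _]; [exact: add_continuous|exact: hc].
Qed.

Section EuclideanSpace.
Variables (R : realType) (m : nat).
Implicit Types (x y z : 'cV[R]_m) (a : R).

Lemma dotC x y : dot x y = dot y x.
Proof. by apply: eq_bigr => i _; rewrite mulrC. Qed.

Lemma dotDl x y z : dot (x + y) z = dot x z + dot y z.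
Proof. by rewrite -big_split; apply: eq_bigr => i _; rewrite mxE mulrDl. Qed.

Lemma dotDr x y z : dot z (x + y) = dot z x + dot z y.
Proof. by rewrite dotC dotDl !(dotC z). Qed.

Lemma dotZl a x y : dot (a *: x) y = a * dot x y.
Proof. by rewrite /dot mulr_sumr; apply: eq_bigr => i _; rewrite mxE mulrA. Qed.

Lemma dotZr a x y : dot x (a *: y) = a * dot x y.
Proof. by rewrite dotC dotZl dotC. Qed.

Lemma dot_suml (I : Type) (r : seq I) (h : I -> 'cV[R]_m) y :
  dot (\sum_(i <- r) h i) y = \sum_(i <- r) dot (h i) y.
Proof.
elim/big_ind2 : _ => [|x1 y1 x2 y2 <- <-|//]; last exact: dotDl.
by apply: big1 => i _; rewrite mxE mul0r.
Qed.

Lemma dotNl x y : dot (- x) y = - dot x y.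
Proof. by rewrite -scaleN1r dotZl mulN1r. Qed.

Lemma dotNr x y : dot x (- y) = - dot x y.
Proof. by rewrite dotC dotNl dotC. Qed.

Lemma dotBl x y z : dot (x - y) z = dot x z - dot y z.
Proof. by rewrite dotDl dotNl. Qed.

Lemma dotBr x y z : dot z (x - y) = dot z x - dot z y.
Proof. by rewrite dotDr dotNr. Qed.

Lemma dot0l x : dot 0 x = 0.
Proof. by rewrite -(scale0r (0 : 'cV_m)) dotZl mul0r. Qed.

Lemma dot0r x : dot x 0 = 0.
Proof. by rewrite dotC dot0l. Qed.

Lemma dot_ge0 x : 0 <= dot x x.
Proof. by apply: sumr_ge0 => i _; rewrite -expr2 sqr_ge0. Qed.

Lemma enorm_ge0 x : 0 <= enorm x.
Proof. exact: sqrtr_ge0. Qed.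

Lemma sqr_enorm x : enorm x ^+ 2 = dot x x.
Proof. by rewrite sqr_sqrtr ?dot_ge0. Qed.

Lemma enormZ a x : enorm (a *: x) = `|a| * enorm x.
Proof.
by rewrite /enorm dotZl dotZr mulrA -expr2 sqrtrM ?sqr_ge0// sqrtr_sqr.
Qed.

Lemma sqr_coord_le_dot x (i : 'I_m) : x i 0 ^+ 2 <= dot x x.
Proof.
rewrite /dot (bigD1 i) //= expr2 lerDl.
by apply: sumr_ge0 => j _; rewrite -expr2 sqr_ge0.
Qed.

Lemma dot_enorm x : dot x x = 0 -> x = 0.
Proof.
move=> x0; apply/matrixP => i j; rewrite ord1 mxE.
apply/eqP; rewrite -sqrf_eq0 eq_le sqr_ge0 andbT -x0.
exact: sqr_coord_le_dot.
Qed.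

(** Expand the square norm of [enorm y *: x - enorm x *: y] and divide by [2 |x| |y|]; this division
    is why null vectors are treated apart. *)
Lemma cauchy_schwarz x y : dot x y <= enorm x * enorm y.
Proof.
have [x0|x0] := eqVneq (dot x x) 0.
  by rewrite (dot_enorm x0) dot0l mulr_ge0 ?enorm_ge0.
have [y0|y0] := eqVneq (dot y y) 0.
  by rewrite (dot_enorm y0) dot0r mulr_ge0 ?enorm_ge0.
have pos z : dot z z != 0 -> 0 < enorm z.
  by move=> z0; rewrite sqrtr_gt0 lt_neqAle eq_sym z0 dot_ge0.
have := dot_ge0 (enorm y *: x - enorm x *: y).
rewrite !(dotBl, dotBr, dotZl, dotZr) -!sqr_enorm (dotC y x).
have : 0 < enorm x * enorm y by rewrite mulr_gt0 ?pos.
move: (enorm x) (enorm y) (dot x y) => p q r pq h.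
rewrite -(ler_pM2l pq); nra.
Qed.

Lemma dot2_le x y : 2 * dot x y <= dot x x + dot y y.
Proof.
have := dot_ge0 (x - y); rewrite !(dotBl, dotBr) (dotC y x); lra.
Qed.

Lemma continuous_dot x : continuous (dot x).
Proof.
apply: (@continuous_sumR _ _ _ _ (fun i y => x i 0 * y i 0)) => i y.
by apply: continuousM; [exact: cst_continuous|exact: coord_continuous].
Qed.

Lemma continuous_enorm2 : continuous (fun x => dot x x).
Proof.
apply: (@continuous_sumR _ _ _ _ (fun i y => y i 0 * y i 0)) => i y.
by apply: continuousM; exact: coord_continuous.
Qed.

(** [grad] collects partial derivatives; linearity of the differential extends them to every
    direction. *)
Lemma derive_grad (h : 'cV[R]_m -> R) x v :
  differentiable h x -> 'D_v h x = dot (grad h x) v.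
Proof.
move=> dh; rewrite deriveE //.
have -> : v = \sum_(i < m) v i 0 *: delta_mx i 0.
  by rewrite {1}(matrix_sum_delta v); apply: eq_bigr => i _; rewrite big_ord1.
rewrite linear_sum; apply: eq_bigr => i _.
rewrite linearZ /= [in RHS]summxE /grad mxE deriveE// [RHS]mulrC.
congr (_ * _).
rewrite (bigD1 i)//= big1 ?addr0; first by rewrite !mxE !eqxx mulr1.
by move=> j ji; rewrite !mxE eq_sym (negbTE ji)/= mulr0.
Qed.

(** The difference quotient of the restriction to the line at [t] is, as a function, that of the
    directional derivative at [x + t *: v], so existence and value both transfer. *)
Lemma is_derive_line (h : 'cV[R]_m -> R) x v (t : R) :
  differentiable h (x + t *: v) ->
  is_derive t 1 (fun s : R => h (x + s *: v)) (dot (grad h (x + t *: v)) v).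
Proof.
move=> dh.
have E : (fun s : R => s^-1 *: ((h \o shift (x + t *: v)) (s *: v) - h (x + t *: v)))
  = (fun s : R => s^-1 *: (((fun s : R => h (x + s *: v)) \o shift t) (s *: 1) - h (x + t *: v))).
  apply/funext => s /=; congr (_ *: (h _ - _)).
  by rewrite [s *: 1]mulr1 scalerDl addrCA.
split.
  by have := @diff_derivable _ _ _ _ _ v dh; rewrite /derivable E.
by rewrite -derive_grad // /derive E.
Qed.

(* Compare [t |-> h (x + t v)] with the parabola it would follow if its slope
   grew at rate [C]. *)
Lemma descent_le (h : 'cV[R]_m -> R) x v (C : R) :
  (forall y, differentiable h y) ->
  (forall t : R, 0 <= t ->
     dot (grad h (x + t *: v) - grad h x) v <= t * C) ->
  h (x + v) <= h x + dot (grad h x) v + C / 2.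
Proof.
move=> dh hC.
pose k := fun t : R => h (x + t *: v) - (dot (grad h x) v * t + C / 2 * t ^+ 2).
have dk (t : R) : is_derive t 1 k (dot (grad h (x + t *: v)) v - (dot (grad h x) v + C * t)).
  have := is_derive_line (dh (x + t *: v)) => dt.
  apply: is_derive_eq.
  by rewrite /GRing.scale /=; field.
have : k 1 <= k 0.
  apply: (@ler0_derive1_nincr _ k 0 1) => //.
  - move=> t; rewrite in_itv/= => /andP[t0 _].
    rewrite derive1E; have [_ ->] := dk t.
    by have := hC t (ltW t0); rewrite dotBl; lra.
  - apply: continuous_subspaceT => t.
    apply/differentiable_continuous/derivable1_diffP.
    by have [] := dk t.
by rewrite /k scale0r scale1r addr0; lra.
Qed.

(* Divide the strong convexity inequality along the segment by its length and
   let the length tend to [0]. *)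
Lemma strongly_convex_bregman (h : 'cV[R]_m -> R) x y :
  differentiable h x -> strongly_convex1 h ->
  dot (y - x) (y - x) / 2 <= bregman h y x.
Proof.
move=> dh sch; set v := y - x.
have [d0 d0E] : is_derive (0 : R) 1 (fun s : R => h (x + s *: v))
    (dot (grad h x) v).
  by have := @is_derive_line h x v 0; rewrite scale0r addr0; exact.
suff : dot (grad h x) v <= h y - h x - dot v v / 2 by rewrite /bregman; lra.
rewrite -d0E.
have G : (h y - h x - (1 - t) / 2 * dot v v) @[t --> (0:R)^'+] -->
    h y - h x - dot v v / 2.
  rewrite (_ : dot v v / 2 = (1 - 0) / 2 * dot v v); last by rewrite subr0; field.
  apply: cvg_at_right_filter.
  apply: cvgB; first exact: cvg_cst.
  apply: cvgMl; apply: cvgMl; apply: cvgB; [exact: cvg_cst|exact: cvg_id].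
apply: ler_cvg_to (cvg_dnbhs_at_right d0) G _.
near=> t.
have t0 : 0 < t by [].
have t1 : t <= 1 by near: t; exact: nbhs_right_le.
rewrite /= addr0 [t *: 1]mulr1 scale0r addr0 /GRing.scale/= mulrC ler_pdivrMr//.
have := sch y x t; rewrite t1 ltW// => /(_ isT).
rewrite (_ : t *: y + (1 - t) *: x = x + t *: v); last first.
  by rewrite scalerBl scale1r /v scalerBr addrCA.
rewrite sqr_enorm -/v; nra.
Unshelve. all: by end_near. Qed.
End EuclideanSpace.

(** * Strongly convex minimisation and prox *)

Lemma continuous_mx (R : realType) (T : topologicalType) (m n : nat)
    (h : T -> 'M[R]_(m, n)) :
  (forall i j, continuous (fun t => h t i j)) -> continuous h.
Proof.
move=> hc t A [P nP PA]; apply: filterS (fun s => PA (h s)) _.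
by apply: filter_forall => i; apply: filter_forall => j; exact: hc.
Qed.

Section StronglyConvexMinimisation.
Variables (R : realType) (m : nat) (A : set 'cV[R]_m) (J : 'cV[R]_m -> R).
Variable kappa : R.

(** Heine-Borel, transported from row vectors by transposition; the bound on [dot y y] controls
    every coordinate, hence the sup norm. *)
Lemma bounded_closed_compact_cV (B : set 'cV[R]_m) (c : R) :
  closed B -> (forall y, B y -> dot y y <= c) -> compact B.
Proof.
move=> clB Bc.
have tr_cont p q : continuous (@trmx R p q).
  apply: continuous_mx => i j.
  rewrite (_ : (fun t => _) = (fun M : 'M[R]_(p, q) => M j i)).
    exact: coord_continuous.
  by apply/funext => M; rewrite mxE.
have -> : B = trmx @` [set y : 'rV[R]_m | B y^T].
  apply/seteqP; split => [y By|_ [y By <-]]//.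
  by exists y^T; rewrite ?trmxK /= ?trmxK.
apply: continuous_compact; first by apply: continuous_subspaceT; exact: tr_cont.
apply: bounded_closed_compact; last first.
  by apply: (@preimage_closed _ _ trmx) => // y _; exact: tr_cont.
exists (Num.sqrt c); split; first exact: num_real.
move=> M cM y By /=; rewrite [leLHS]/Num.Def.normr/= mx_normrE.
apply/bigmax_leP; split; first by rewrite (le_trans _ (ltW cM))// sqrtr_ge0.
move=> [i j] _ /=; rewrite ord1; apply: le_trans (ltW cM).
rewrite -sqrtr_sqr ler_sqrt; last by rewrite (le_trans (dot_ge0 _) (Bc _ By)).
apply: le_trans (Bc _ By).
by have := sqr_coord_le_dot y^T j; rewrite mxE.
Qed.

(* The nonempty sublevel sets of [J] in [B] generate a proper filter; any of
   its cluster points lies in every one of them. *)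
Lemma compact_argmin (B : set 'cV[R]_m) :
  compact B -> B !=set0 -> (forall c, closed [set y | J y <= c]) ->
  argmin B J !=set0.
Proof.
move=> cB [y0 By0] clJ.
pose G : set_system 'cV[R]_m :=
  [set S | exists2 y, B y & B `&` [set z | J z <= J y] `<=` S].
have GF : ProperFilter G.
  apply: Build_ProperFilter_ex => [S [y By yS]|].
    by exists y; apply: yS; split => /=.
  split.
  - by exists y0.
  - move=> S1 S2 [y1 B1 S1y] [y2 B2 S2y].
    have [le12|/ltW le21] := leP (J y1) (J y2).
      exists y1 => // z [Bz zy]; split; [exact: S1y|apply: S2y; split => //].
      exact: le_trans zy le12.
    exists y2 => // z [Bz zy]; split; [apply: S1y; split => //|exact: S2y].
    exact: le_trans zy le21.
  - by move=> S1 S2 S12 [y By yS]; exists y => //; apply: subset_trans S12.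
have [|p [Bp clp]] := cB G GF; first by exists y0 => // z [].
exists p; split => // z Bz.
apply: (clJ (J z)) => N Np.
have [|q [[Bq qz] Nq]] := clp (B `&` [set y | J y <= J z]) N _ Np.
  by exists z.
by exists q.
Qed.

Hypotheses (kappa0 : 0 < kappa) (clA : closed A).
Hypothesis cvxA : forall y z t, 0 <= t <= 1 -> A y -> A z ->
  A (t *: y + (1 - t) *: z).
Hypothesis clJ : forall c, closed [set y | J y <= c].
Hypothesis cvxJ : forall y z t, 0 <= t <= 1 ->
  J (t *: y + (1 - t) *: z) <=
  t * J y + (1 - t) * J z - kappa * (t * (1 - t) / 2 * dot (y - z) (y - z)).

(** Comparing [y] with the points of the segment towards [z] and dividing by [t] gives
    [(1 - t) * D <= J z - J y] for [0 < t <= 1]. Instead of a limit [t -> 0], one value of [t]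
    yields a contradiction. *)
Lemma strongly_convex_argmin_growth y z :
  argmin A J y -> A z -> J y + kappa / 2 * dot (z - y) (z - y) <= J z.
Proof.
move=> [Ay miny] Az; set D := kappa / 2 * _.
have le_t t : 0 < t -> t <= 1 -> (1 - t) * D <= J z - J y.
  move=> t0 t1; have t01 : 0 <= t <= 1 by rewrite ltW.
  rewrite -(ler_pM2l t0).
  have := le_trans (miny _ (cvxA t01 Az Ay)) (cvxJ z y t01).
  by rewrite /D; nra.
rewrite addrC -lerBrDr leNgt; apply/negP => ED.
have E0 : 0 <= J z - J y by rewrite subr_ge0; exact: miny.
have D0 : 0 < D by exact: le_lt_trans E0 ED.
clearbody D.
(* With this [t], [(1 - t) * D] is the average of [D] and [J z - J y], hence strictly above
   [J z - J y]. *)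
set t := (D - (J z - J y)) / (2 * D).
have tD : t * D = (D - (J z - J y)) / 2 by rewrite /t; field; rewrite gt_eqF.
have t0 : 0 < t by rewrite divr_gt0 ?subr_gt0 ?mulr_gt0.
have t1 : t <= 1 by rewrite ler_pdivrMr ?mulr_gt0//; lra.
by have := le_t t t0 t1; rewrite mulrBl mul1r tD; lra.
Qed.

(* Outside a large ball around [x0], strong convexity and the minimum of [J] on
   the unit ball around [x0] force [J] above [J x0]. *)
Lemma strongly_convex_argmin : A !=set0 -> argmin A J !=set0.
Proof.
move=> [x0 Ax0].
pose B r := A `&` [set y | dot (y - x0) (y - x0) <= r].
have Bmin r : 0 <= r -> argmin (B r) J !=set0.
  move=> r0; apply: compact_argmin => //; last first.
    by exists x0; split => //=; rewrite subrr dot0l.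
  apply: (@bounded_closed_compact_cV _ (2 * r + 2 * dot x0 x0)).
    apply: closedI => //.
    apply: (@preimage_closed 'cV[R]_m R (fun y => dot (y - x0) (y - x0)) [set s | s <= r]).
      move=> y _; apply: (@continuous_comp 'cV[R]_m 'cV[R]_m R
        (fun y => y - x0) (fun y => dot y y)); last exact: continuous_enorm2.
      by apply: continuousB; [exact: cvg_id|exact: cst_continuous].
    exact: closed_le.
  move=> y [_ /= yr].
  (* Parallelogram identity: [y] and [y - 2 x0] are the sum and the difference of [y - x0] and
     [x0]. *)
  have := dot_ge0 (y - x0 - x0); move: yr.
  by rewrite !(dotBl, dotBr) !(dotC _ y); lra.
have [y1 [[Ay1 _] min1]] := Bmin 1 ler01.
(* [rho] solves [kappa * (rho - 1) / 2 = J x0 - J y1]. For [z] at distance [r > rho], pulling [z]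
   back to the unit sphere around [x0] gives [J z - J x0 >= r * (kappa * (r - 1) / 2 - (J x0 - J
   y1)) > 0]. *)
pose rho := 1 + 2 * (J x0 - J y1) / kappa.
have y10 : J y1 <= J x0.
  by apply: min1; split => //=; rewrite subrr dot0l.
have rho1 : 1 <= rho.
  by rewrite lerDl divr_ge0 ?(ltW kappa0)// mulr_ge0// subr_ge0.
have [y [[Ay _] miny]] := Bmin (rho ^+ 2) (sqr_ge0 _).
exists y; split => // z Az.
have [zr|zr] := leP (dot (z - x0) (z - x0)) (rho ^+ 2); first by apply: miny.
have Jyx0 : J y <= J x0.
  by apply: miny; split => //=; rewrite subrr dot0l sqr_ge0.
apply: le_trans Jyx0 _.
pose r := enorm (z - x0).
have r2 : dot (z - x0) (z - x0) = r ^+ 2 by rewrite sqr_enorm.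
have rr : rho < r.
  by rewrite -(ltr_pXn2r (_ : 0 < 2)%N) ?nnegrE ?enorm_ge0 -?r2// (le_trans _ rho1).
have r0 : 0 < r by rewrite (lt_trans _ rr)// (lt_le_trans _ rho1).
have r1 : 0 <= r^-1 <= 1.
  by rewrite invr_ge0 ltW//= invf_le1// ltW// (le_lt_trans rho1).
have /min1 : B 1 (r^-1 *: z + (1 - r^-1) *: x0).
  split; first exact: cvxA.
  rewrite /= (_ : _ - x0 = r^-1 *: (z - x0)); last first.
    by rewrite scalerBl scale1r scalerBr addrA addrAC addrK.
  by rewrite dotZl dotZr r2 expr2 mulKf ?mulVf ?gt_eqF.
move/le_trans/(_ (cvxJ z x0 r1)); rewrite r2.
have : kappa * (rho - 1) = 2 * (J x0 - J y1) by rewrite /rho; field; rewrite gt_eqF.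
have : r * r^-1 = 1 by rewrite divff// gt_eqF.
move: r^-1 => s rs.
have : kappa * rho < kappa * r by rewrite ltr_pM2l.
rewrite -(ler_pM2l r0) => rhor rhoE.
rewrite (_ : r * (_ - _) = (r * s) * J z + (r - r * s) * J x0 -
  kappa * ((r * s) * (r - r * s) / 2 * r)); last by ring.
rewrite rs; nra.
Qed.

End StronglyConvexMinimisation.

Section Prox.
Variables (R : realType) (m : nat) (A : set 'cV[R]_m).
Variables (phi chi : 'cV[R]_m -> R) (alpha : R).
Hypotheses (alpha0 : 0 < alpha) (ccA : closed_convex_set A) (A0 : A !=set0).
Hypotheses (ccchi : closed_convex_fun chi).
Hypotheses (dphi : forall y, differentiable phi y) (scphi : strongly_convex1 phi).
Implicit Types x y z g : 'cV[R]_m.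

Let obj x g := fun y => dot g y + alpha^-1 * bregman phi y x + chi y.

Let cvxA y z t : 0 <= t <= 1 -> A y -> A z -> A (t *: y + (1 - t) *: z).
Proof.
move=> /andP[t0 t1] Ay Az; have [_ cA] := ccA.
by have /set_mem := cA y z (Itv01 t0 t1) (mem_set Ay) (mem_set Az).
Qed.

Let cvx_chi y z t : 0 <= t <= 1 ->
  chi (t *: y + (1 - t) *: z) <= t * chi y + (1 - t) * chi z.
Proof.
move=> /andP[t0 t1]; have [_ cchi] := ccchi.
exact: (cchi (Itv01 t0 t1) y z (mem_set I) (mem_set I)).
Qed.

(** As a function of its first argument, the Bregman distance differs from [phi] by an affine
    function, so it keeps the modulus of [phi], here scaled by [alpha^-1]. *)
Let cvx_obj x g y z t : 0 <= t <= 1 ->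
  obj x g (t *: y + (1 - t) *: z) <= t * obj x g y + (1 - t) * obj x g z
    - alpha^-1 * (t * (1 - t) / 2 * dot (y - z) (y - z)).
Proof.
move=> t01; have h1 := cvx_chi y z t01; have := scphi y z t01.
rewrite sqr_enorm -(ler_pM2l (_ : 0 < alpha^-1)) ?invr_gt0// => h2.
move: h1 h2; move: (dot (y - z) (y - z)) => D.
by rewrite /obj /bregman !(dotBr, dotDr, dotZr); lra.
Qed.

Let continuous_phi : continuous phi.
Proof. by move=> y; exact: differentiable_continuous. Qed.

(** The sublevel set is the preimage of the closed epigraph of [chi] under the continuous map
    [y -> (y, c - psi y)]. *)
Let clobj x g c : closed [set y | obj x g y <= c].
Proof.
pose psi y := dot g y + alpha^-1 * bregman phi y x.
have cpsi : continuous psi.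
  move=> y; apply: continuousD; first exact: continuous_dot.
  apply: continuousM; first exact: cst_continuous.
  apply: continuousB.
    by apply: continuousB; [exact: continuous_phi|exact: cst_continuous].
  apply: (@continuous_comp 'cV[R]_m 'cV[R]_m R (fun y => y - x)
      (fun y => dot (grad phi x) y)); last exact: continuous_dot.
  by apply: continuousB; [exact: cvg_id|exact: cst_continuous].
rewrite (_ : [set _ | _] = (fun y => (y, c - psi y)) @^-1`
    [set z : 'cV[R]_m * R | chi z.1 <= z.2]); last first.
  by apply/seteqP; split => y /=; rewrite /obj -/(psi y) lerBrDl.
apply: preimage_closed; last exact: ccchi.1.
move=> y _; have cB : continuous (fun y => c - psi y).
  by move=> z; apply: continuousB; [exact: cst_continuous|exact: cpsi].
exact: (cvg_pair (@cvg_id _ (nbhs y)) (cB y)).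
Qed.

Let P x g := prox A phi chi x g alpha.

(** Ensures that the choice made by [get] in [prox] is a genuine minimiser. *)
Lemma prox_argmin x g : argmin A (obj x g) (P x g).
Proof.
apply: getPex; apply: (@strongly_convex_argmin _ _ _ _ alpha^-1) => //.
- by rewrite invr_gt0.
- by case: ccA.
- exact: clobj.
- exact: cvx_obj.
Qed.

Lemma prox_in x g : A (P x g).
Proof. by case: (prox_argmin x g). Qed.

Let growth x g z : A z ->
  obj x g (P x g) + alpha^-1 / 2 * dot (z - P x g) (z - P x g) <= obj x g z.
Proof.
by apply: strongly_convex_argmin_growth; [exact: cvxA|exact: cvx_obj|
  exact: prox_argmin].
Qed.

(** Half of the quadratic term is the growth of the objective from its minimiser to [x]; the other
    half is the strong convexity bound on the Bregman distance from [x] to the minimiser. *)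
Lemma prox_descent x g : A x ->
  chi (P x g) + alpha^-1 * dot (x - P x g) (x - P x g)
    <= chi x + dot g (x - P x g).
Proof.
move=> Ax; have := growth x g Ax.
have ai0 : 0 <= alpha^-1 by rewrite invr_ge0 ltW.
have h := ler_wpM2l ai0 (strongly_convex_bregman (P x g) (dphi x) scphi).
have bxx : bregman phi x x = 0 by rewrite /bregman !subrr dot0r subr0.
move: h; rewrite /obj bxx mulr0 addr0.
rewrite (_ : dot (P x g - x) _ = dot (x - P x g) (x - P x g)); last first.
  by rewrite -opprB dotNl dotNr opprK.
by move: (dot (x - P x g) (x - P x g)) => D; rewrite dotBr; lra.
Qed.

(** Add the growth inequalities of the two problems, each tested at the minimiser of the other: all
    values of [phi] and [chi] cancel. *)
Lemma prox_monotone x1 x2 g1 g2 :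
  alpha^-1 * dot (P x1 g1 - P x2 g2) (P x1 g1 - P x2 g2) <=
  dot ((g1 - alpha^-1 *: grad phi x1) - (g2 - alpha^-1 *: grad phi x2))
      (P x2 g2 - P x1 g1).
Proof.
have := growth x1 g1 (prox_in x2 g2).
have := growth x2 g2 (prox_in x1 g1).
rewrite /obj /bregman (_ : dot (P x2 g2 - P x1 g1) _ =
  dot (P x1 g1 - P x2 g2) (P x1 g1 - P x2 g2)); last first.
  by rewrite -opprB dotNl dotNr opprK.
move: (dot (P x1 g1 - P x2 g2) (P x1 g1 - P x2 g2)) => D.
rewrite !(dotBl, dotBr, dotZl); lra.
Qed.

(** With a common centre the gradients of [phi] cancel in [prox_monotone]. What remains is firm
    nonexpansiveness of the generalized gradient in [g]. *)
Lemma gen_grad_block_monotone x g1 g2 d :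
  d = gen_grad_block A phi chi x g1 alpha
      - gen_grad_block A phi chi x g2 alpha ->
  dot d d <= dot d (g1 - g2).
Proof.
move=> dE; have := prox_monotone x x g1 g2.
have PE : P x g2 - P x g1 = alpha *: d.
  rewrite dE /gen_grad_block -scalerBr scalerA divff ?gt_eqF// scale1r.
  by rewrite -/(P x g1) -/(P x g2) opprB [RHS]addrC addrA subrK.
rewrite -opprB PE opprB addrA subrK dotNl dotNr opprK !dotZl !dotZr.
by rewrite mulKf ?gt_eqF// ler_pM2l// [dot (_ - _) _]dotC.
Qed.

End Prox.

(** * Borel measurability on column vectors *)

Section BorelColumn.
Variables (R : realType) (m : nat).
Implicit Types (d : measure_display).

Lemma measurable_fun_closed_sublevel (h : 'cV[R]_m -> R) :
  (forall c, closed [set y | h y <= c]) ->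
  measurable_fun [set: borel_cV R m] (h : borel_cV R m -> R).
Proof.
move=> clh; apply: (measurability _ (RGenOInfty.measurableE R)).
move=> _ [_ [c ->] <-]; rewrite setTI.
apply: sub_sigma_algebra.
rewrite (_ : _ @^-1` _ = ~` [set y | h y <= c]).
  exact: closed_openC.
by apply/seteqP; split => y /=; rewrite in_itv/= andbT ltNge => /negP.
Qed.

Lemma measurable_fun_continuous_cV (h : 'cV[R]_m -> R) :
  continuous h ->
  measurable_fun [set: borel_cV R m] (h : borel_cV R m -> R).
Proof.
move=> ch; apply: measurable_fun_closed_sublevel => c.
apply: (@preimage_closed 'cV[R]_m R h [set s | s <= c]).
  by move=> y _; exact: ch.
exact: closed_le.
Qed.

Lemma measurable_coord (i : 'I_m) :
  measurable_fun [set: borel_cV R m] (fun x : borel_cV R m => x i 0 : R).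
Proof. by apply: measurable_fun_continuous_cV; exact: coord_continuous. Qed.

(* Every open set is a countable union of boxes with rational centre and
   radius. *)
Lemma measurable_fun_cV d (T : measurableType d) (h : T -> 'cV[R]_m) :
  (forall i, measurable_fun [set: T] (fun t => h t i 0)) ->
  measurable_fun [set: T] (h : T -> borel_cV R m).
Proof.
move=> mh; apply: (@measurability _ _ _ (borel_cV R m) setT h (@open 'cV[R]_m)) => //.
move=> _ [W openW <-]; rewrite setTI.
pose Q (q : 'cV[rat]_m * rat) : set 'cV[R]_m :=
  [set y | forall i, `|y i 0 - ratr (q.1 i 0)| < ratr q.2].
rewrite (_ : h @^-1` W = \bigcup_(q in [set q | Q q `<=` W]) h @^-1` Q q); last first.
  apply/seteqP; split => [t Wt|t [q /= qW]]; last exact: qW.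
  have /nbhs_ballP[e /= e0 eW] : nbhs (h t) W by exact: open_nbhs_nbhs.
  have [r /itvP re] : exists r : rat, ratr r \in `]0, (e / 2)[.
    by apply: rat_in_itvoo; rewrite divr_gt0.
  have r0 : (0 : R) < ratr r by rewrite re.
  have hq i : exists q : rat, ratr q \in `](h t i 0 - ratr r), (h t i 0 + ratr r)[.
    by apply: rat_in_itvoo; rewrite ltrD2l; lra.
  pose q : 'cV[rat]_m := \col_i sval (cid (hq i)).
  have qP i : `|h t i 0 - ratr (q i 0)| < ratr r.
    rewrite mxE; case: cid => s /= /itvP sr.
    by rewrite distrC ltr_distl !sr.
  exists (q, r) => //= y yq; apply: eW; split => // i j; rewrite ord1.
  have := yq i; have := qP i; have : ratr r < e / 2 by rewrite re.
  rewrite /ball/= !ltr_norml => r2 /andP[? ?] /andP[? ?].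
  by apply/andP; split; lra.
rewrite bigcup_mkcond; apply: countable_bigcupT_measurable => // q.
case: ifPn => // _.
rewrite (_ : _ @^-1` _ = \bigcap_(i in [set: 'I_m])
    (fun t => h t i 0) @^-1` (ball (ratr (q.1 i 0) : R) (ratr q.2))).
  apply: fin_bigcap_measurable => // i _.
  rewrite -[X in measurable X]setTI; apply: mh => //.
  exact: measurable_ball.
apply/seteqP; split => t /= ht i; first by move=> _; rewrite /ball/= distrC; exact: ht.
by rewrite distrC; exact: (ht i I).
Qed.

Lemma measurable_coord_comp d (T : measurableType d) (h : T -> 'cV[R]_m) i :
  measurable_fun [set: T] (h : T -> borel_cV R m) ->
  measurable_fun [set: T] (fun t => h t i 0).
Proof. by move=> mh; exact: (measurableT_comp (measurable_coord i) mh). Qed.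

End BorelColumn.

Section MeasurableColumnOperations.
Variables (R : realType) (d : measure_display) (T : measurableType d).

Lemma measurable_mulmx p q (A : 'M[R]_(p, q)) (h : T -> 'cV[R]_q) :
  measurable_fun [set: T] (h : T -> borel_cV R q) ->
  measurable_fun [set: T] ((fun t => A *m h t) : T -> borel_cV R p).
Proof.
move=> mh; apply: measurable_fun_cV => i; under eq_fun do rewrite mxE.
apply: measurable_sum => j; apply: measurable_funM => //.
exact: measurable_coord_comp.
Qed.

Lemma measurable_cVZ q (a : T -> R) (h : T -> 'cV[R]_q) :
  measurable_fun [set: T] a ->
  measurable_fun [set: T] (h : T -> borel_cV R q) ->
  measurable_fun [set: T] ((fun t => a t *: h t) : T -> borel_cV R q).
Proof.
move=> ma mh; apply: measurable_fun_cV => i; under eq_fun do rewrite mxE.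
by apply: measurable_funM => //; exact: measurable_coord_comp.
Qed.

Lemma measurable_cVD q (h k : T -> 'cV[R]_q) :
  measurable_fun [set: T] (h : T -> borel_cV R q) ->
  measurable_fun [set: T] (k : T -> borel_cV R q) ->
  measurable_fun [set: T] ((fun t => h t + k t) : T -> borel_cV R q).
Proof.
move=> mh mk; apply: measurable_fun_cV => i; under eq_fun do rewrite mxE.
by apply: measurable_funD; exact: measurable_coord_comp.
Qed.

Lemma measurable_cVB q (h k : T -> 'cV[R]_q) :
  measurable_fun [set: T] (h : T -> borel_cV R q) ->
  measurable_fun [set: T] (k : T -> borel_cV R q) ->
  measurable_fun [set: T] ((fun t => h t - k t) : T -> borel_cV R q).
Proof.
move=> mh mk; apply: measurable_fun_cV => i; under eq_fun do rewrite !mxE.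
by apply: measurable_funB; exact: measurable_coord_comp.
Qed.

Lemma measurable_cV_sum q (I : Type) (r : seq I) (h : I -> T -> 'cV[R]_q) :
  (forall i, measurable_fun [set: T] (h i : T -> borel_cV R q)) ->
  measurable_fun [set: T] ((fun t => \sum_(i <- r) h i t) : T -> borel_cV R q).
Proof.
move=> mh; apply: measurable_fun_cV => i; under eq_fun do rewrite summxE.
by apply: measurable_sum => j; exact: measurable_coord_comp.
Qed.

Lemma measurable_dot q (h k : T -> 'cV[R]_q) :
  measurable_fun [set: T] (h : T -> borel_cV R q) ->
  measurable_fun [set: T] (k : T -> borel_cV R q) ->
  measurable_fun [set: T] (fun t => dot (h t) (k t)).
Proof.
move=> mh mk; apply: measurable_sum => i.
by apply: measurable_funM; exact: measurable_coord_comp.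
Qed.

End MeasurableColumnOperations.

(** A directional derivative as the limit of a sequence: pointwise limits of sequences preserve
    measurability, which is how gradients are shown measurable. *)
Lemma cvg_diff_quotient (R : realType) m (h : 'cV[R]_m -> R) x v :
  differentiable h x ->
  n.+1%:R * (h (x + n.+1%:R^-1 *: v) - h x) @[n --> \oo] --> dot (grad h x) v.
Proof.
move=> dh.
have [d0 d0E] : is_derive (0 : R) 1 (fun s : R => h (x + s *: v))
    (dot (grad h x) v).
  by have := @is_derive_line _ _ h x v 0; rewrite scale0r addr0; exact.
have /cvg_at_rightP := cvg_dnbhs_at_right d0.
move=> /(_ harmonic) h0; rewrite -d0E.
apply: cvg_trans (h0 _) => //; last first.
  by split; [move=> n; rewrite /= invr_gt0|exact: cvg_harmonic].
apply: near_eq_cvg; near=> n.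
by rewrite /= addr0 scale0r addr0 [_ *: 1]mulr1 invrK.
Unshelve. all: by end_near. Qed.

Lemma measurable_grad (R : realType) m (h : 'cV[R]_m -> R) :
  (forall x, differentiable h x) ->
  measurable_fun [set: borel_cV R m] (grad h : borel_cV R m -> borel_cV R m).
Proof.
move=> dh; apply: measurable_fun_cV => i.
have mh : measurable_fun [set: borel_cV R m] (h : borel_cV R m -> R).
  apply: measurable_fun_continuous_cV => x.
  exact: differentiable_continuous.
have mid : measurable_fun [set: borel_cV R m] (id : borel_cV R m -> borel_cV R m).
  exact: measurable_id.
apply: (@measurable_fun_cvg _ (borel_cV R m) R setT
  (fun n x => n.+1%:R * (h (x + n.+1%:R^-1 *: delta_mx i 0) - h x))); last first.
  move=> x _; rewrite [X in _ --> X](_ : _ = dot (grad h x) (delta_mx i 0)).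
    exact: cvg_diff_quotient.
  by rewrite -derive_grad// mxE.
move=> n; apply: measurable_funM => //; apply: measurable_funB => //.
apply: (measurableT_comp mh); apply: (@measurable_cVD R _ (borel_cV R m) m id
  (fun=> n.+1%:R^-1 *: delta_mx i 0)) => //.
Qed.

Lemma enorm_lipschitz_continuous (R : realType) m (h : 'cV[R]_m -> R) (K : R) :
  (forall x y, `|h x - h y| <= K * enorm (x - y)) -> continuous h.
Proof.
move=> hK x.
have cN : {for x, continuous (fun y : 'cV[R]_m => K * enorm (x - y))}.
  apply: continuousM; first exact: cst_continuous.
  apply: (@continuous_comp 'cV[R]_m R R (fun y => dot (x - y) (x - y)) Num.sqrt).
    apply: (@continuous_comp 'cV[R]_m 'cV[R]_m R (fun y => x - y) (fun y => dot y y)).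
      by apply: continuousB; [exact: cst_continuous|exact: cvg_id].
    exact: continuous_enorm2.
  exact: sqrt_continuous.
have FF : Filter (nbhs (x : 'cV[R]_m)) by exact: nbhs_filter.
apply/cvgrPdist_lt => e e0; near=> y; rewrite (le_lt_trans (hK _ _))//.
near: y.
have /cvgrPdist_lt/(_ e e0) := cN; apply: filterS => y /=.
by rewrite {1}subrr {1}/enorm dot0l sqrtr0 mulr0 sub0r normrN;
  exact/le_lt_trans/ler_norm.
Unshelve. all: by end_near. Qed.

Section MeasurableProx.
Variables (R : realType) (m : nat) (A : set 'cV[R]_m).
Variables (phi chi : 'cV[R]_m -> R) (alpha : R).
Hypotheses (alpha0 : 0 < alpha) (ccA : closed_convex_set A) (A0 : A !=set0).
Hypotheses (ccchi : closed_convex_fun chi).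
Hypotheses (dphi : forall y, differentiable phi y) (scphi : strongly_convex1 phi).

Let P := prox A phi chi.

(* [prox] depends on [(x, g)] only through [g - grad phi x / alpha], and does so
   in a Lipschitz manner. *)
Lemma measurable_prox d (T : measurableType d) (x g : T -> 'cV[R]_m) :
  measurable_fun [set: T] (x : T -> borel_cV R m) ->
  measurable_fun [set: T] (g : T -> borel_cV R m) ->
  measurable_fun [set: T] ((fun t => P (x t) (g t) alpha) : T -> borel_cV R m).
Proof.
move=> mx mg.
have dE (p q : 'cV[R]_m) : dot (p - q) (p - q) = enorm (p - q) ^+ 2 by rewrite sqr_enorm.
have aux (a b c : 'cV[R]_m) : a - b - (a - (b - c) - c) = 0.
  by rewrite -[X in a - b - X]addrA -opprD subrK subrr.
have mono := prox_monotone alpha0 ccA A0 ccchi dphi scphi.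
(* Moving the centre to [0] is compensated in the gradient: the two shifted gradients agree, so
   [prox_monotone] puts the two prox points at distance [0]. *)
have PE t : P (x t) (g t) alpha = P 0 (g t - alpha^-1 *: (grad phi (x t) - grad phi 0)) alpha.
  apply/eqP; rewrite -subr_eq0; apply/eqP/dot_enorm/eqP.
  rewrite eq_le dot_ge0 andbT.
  have := mono (x t) 0 (g t) (g t - alpha^-1 *: (grad phi (x t) - grad phi 0)).
  rewrite [X in _ <= dot X _](_ : _ = 0) ?dot0l; last first.
    by rewrite scalerBr aux.
  by rewrite pmulr_rle0 ?invr_gt0.
have lip i : continuous (fun g => P 0 g alpha i 0).
  apply: (@enorm_lipschitz_continuous _ _ _ alpha) => g1 g2.
  have := mono 0 0 g1 g2; rewrite opprB addrA subrK.
  move/le_trans/(_ (cauchy_schwarz _ _)).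
  rewrite -/P dE.
  have -> : enorm (P 0 g2 alpha - P 0 g1 alpha) = enorm (P 0 g1 alpha - P 0 g2 alpha).
    by rewrite /enorm -opprB dotNl dotNr opprK.
  have := sqr_coord_le_dot (P 0 g1 alpha - P 0 g2 alpha) i.
  rewrite !mxE dE -[X in X <= _]real_normK ?num_real//.
  rewrite ler_sqr ?nnegrE ?enorm_ge0// => le1.
  rewrite mulrC ler_pdivrMr// => le2; apply: le_trans le1 _.
  have [->|p0] := eqVneq (enorm (P 0 g1 alpha - P 0 g2 alpha)) 0.
    by rewrite mulr_ge0 ?enorm_ge0// ltW.
  have pp : 0 < enorm (P 0 g1 alpha - P 0 g2 alpha).
    by rewrite lt_neqAle eq_sym p0 enorm_ge0.
  rewrite -(ler_pM2r pp) -expr2 (le_trans le2)//.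
  by rewrite mulrC mulrA.
under eq_fun do rewrite PE.
have mP0 : measurable_fun [set: borel_cV R m]
    ((fun g => P 0 g alpha) : borel_cV R m -> borel_cV R m).
  apply: measurable_fun_cV => i; apply: measurable_fun_continuous_cV; exact: lip.
apply: (measurableT_comp mP0).
have mgx : measurable_fun [set: T] ((fun t => grad phi (x t)) : T -> borel_cV R m).
  by apply: (measurableT_comp (measurable_grad dphi)).
apply: (@measurable_cVB R _ T m) => //.
apply: (@measurable_cVZ R _ T m (fun=> alpha^-1)) => //.
by apply: (@measurable_cVB R _ T m) => //; exact: measurable_cst.
Qed.

End MeasurableProx.

(** * Independence and expectation *)

Section Independence.
Variables (d : measure_display) (Omega : measurableType d) (R : realType).
Variable P : probability Omega R.
Implicit Types (G H : set_system Omega).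

Definition indep_systems G H :=
  forall A B, G A -> H B -> P (A `&` B) = (P A * P B)%E.

Lemma indep_systemsC G H : indep_systems G H -> indep_systems H G.
Proof. by move=> GH A B HA GB; rewrite setIC GH// muleC. Qed.

Lemma indep_systemsS G' H' G H : G `<=` G' -> H `<=` H' ->
  indep_systems G' H' -> indep_systems G H.
Proof. by move=> GG' HH' GH A B GA HB; exact: GH (GG' _ GA) (HH' _ HB). Qed.

(** For a fixed [B] in [H], the finite measures [A -> P (A]&[B)] and [A -> P A * P B] agree on the
    pi-system [G], hence on the sigma-algebra it generates. *)
Lemma indep_systems_sigma_l G H :
  G `<=` measurable -> H `<=` measurable -> setI_closed G -> G setT ->
  indep_systems G H -> indep_systems <<s G >> H.
Proof.
move=> mG mH GI GT GH A B GA HB; have mB := mH _ HB.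
have PB0 : 0 <= fine (P B) by rewrite fine_ge0.
have := @g_sigma_algebra_measure_unique _ R _ G mG (fun=> setT) (fun=> GT) _
  (mrestr P mB) (mscale (NngNum PB0) P) GI.
rewrite bigcup_const// => /(_ erefl) uniq.
have msE C : measurable C -> mscale (NngNum PB0) P C = (P C * P B)%E.
  move=> mC; transitivity ((fine (P B))%:E * P C)%E => //.
  by rewrite fineK ?fin_num_measure// muleC.
have -> : P (A `&` B) = mrestr P mB A by [].
rewrite uniq//.
- apply: msE; apply: smallest_sub GA => //; exact: sigma_algebra_measurable.
- move=> C GC; apply: etrans (esym (msE _ (mG _ GC))); exact: GH.
- move=> _; apply: (@le_lt_trans _ _ (P B)); last by rewrite ltey_eq fin_num_measure.
  by apply: le_measure; rewrite ?inE//; exact: measurableI.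
Qed.

Lemma indep_systems_sigma G H :
  G `<=` measurable -> H `<=` measurable -> setI_closed G -> setI_closed H ->
  G setT -> H setT -> indep_systems G H -> indep_systems <<s G >> <<s H >>.
Proof.
move=> mG mH GI HI GT HT GH.
have sG : <<s G >> `<=` measurable by apply: smallest_sub => //; exact: sigma_algebra_measurable.
apply: indep_systemsC; apply: indep_systems_sigma_l => //.
by apply: indep_systemsC; exact: indep_systems_sigma_l.
Qed.

Section Grouping.
Variables (J : choiceType) (D : set J) (E : J -> set_system Omega).
Hypotheses (indE : mutually_independent P D E).
Hypotheses (mE : forall j, D j -> E j `<=` measurable).
Hypotheses (EI : forall j, setI_closed (E j)) (ET : forall j, E j setT).

(** Finite intersections of events attached to indices of [K]: a pi-system containing every [E j]
    with [j] in [K]. Families are [setT] off [F], so that two of them intersect index by index. *)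
Let cylinder (K : set J) : set_system Omega := [set S | exists F : {fset J},
  exists C : J -> set Omega, [/\ [set` F] `<=` K, forall j, E j (C j),
    forall j, j \notin F -> C j = setT & S = \bigcap_(j in [set` F]) C j]].

Let cylinder_bigcap (F F' : {fset J}) (C : J -> set Omega) :
  (forall j, j \notin F -> C j = setT) -> [set` F] `<=` [set` F'] ->
  \bigcap_(j in [set` F]) C j = \bigcap_(j in [set` F']) C j.
Proof.
move=> CT FF'; apply/seteqP; split => w Cw j jF; last exact/Cw/FF'.
by have [/Cw//|/CT ->//] := boolP (j \in F).
Qed.

Let cylinderI K : setI_closed (cylinder K).
Proof.
move=> _ _ [F1 [C1 [F1K E1 T1 ->]]] [F2 [C2 [F2K E2 T2 ->]]].
exists (F1 `|` F2)%fset, (fun j => C1 j `&` C2 j); split.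
- by move=> j /=; rewrite in_fsetU => /orP[/F1K|/F2K].
- by move=> j; exact: EI.
- by move=> j; rewrite in_fsetU negb_or => /andP[/T1 -> /T2 ->]; rewrite setTI.
- rewrite bigcapI (@cylinder_bigcap F1 (F1 `|` F2)%fset)//; last first.
    by move=> j /= jF; rewrite in_fsetU jF.
  rewrite (@cylinder_bigcap F2 (F1 `|` F2)%fset)//.
  by move=> j /= jF; rewrite in_fsetU jF orbT.
Qed.

Let cylinderT K : cylinder K setT.
Proof.
exists fset0, (fun=> setT); split => //.
by apply/seteqP; split.
Qed.

Let measurable_cylinder K : K `<=` D -> cylinder K `<=` measurable.
Proof.
move=> KD _ [F [C [FK EC _ ->]]]; apply: fin_bigcap_measurable => // j jF.
exact: (mE (KD _ (FK _ jF)) (EC j)).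
Qed.

(** Glued into one family over the disjoint union of [F1] and [F2], the two cylinders fall under
    mutual independence, and the product over the union splits. *)
Let cylinder_indep K1 K2 : K1 `<=` D -> K2 `<=` D -> K1 `&` K2 = set0 ->
  indep_systems (cylinder K1) (cylinder K2).
Proof.
move=> K1D K2D K12 _ _ [F1 [C1 [F1K E1 T1 ->]]] [F2 [C2 [F2K E2 T2 ->]]].
have F12 j : j \in F1 -> j \in F2 -> False.
  by move=> /F1K j1 /F2K j2; have : (K1 `&` K2) j by []; rewrite K12.
pose C j := if j \in F1 then C1 j else C2 j.
have EC j : E j (C j) by rewrite /C; case: ifP.
have PF (F : {fset J}) : [set` F] `<=` D ->
    P (\bigcap_(j in [set` F]) C j) = (\prod_(j <- F) P (C j))%E.
  by move=> FD; have := indE FD (fun j _ => EC j).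
have -> : \bigcap_(j in [set` F1]) C1 j = \bigcap_(j in [set` F1]) C j.
  by apply: eq_bigcapr => j jF; rewrite /C ifT.
have -> : \bigcap_(j in [set` F2]) C2 j = \bigcap_(j in [set` F2]) C j.
  apply: eq_bigcapr => j jF; rewrite /C ifN//.
  by apply/negP => /F12; exact.
rewrite -bigcap_setU (_ : _ `|` _ = [set` (F1 `|` F2)%fset]); last first.
  by apply/seteqP; split => j /=; rewrite in_fsetU => /orP.
rewrite !PF; [|by move=> j /F2K/K2D|by move=> j /F1K/K1D|]; last first.
  by move=> j /=; rewrite in_fsetU => /orP[/F1K/K1D|/F2K/K2D].
rewrite (big_fsetID _ (mem F1))/=; congr (_ * _)%E; apply: eq_fbigl => j.
  by rewrite !inE; case: (j \in F1) => //=; rewrite andbF.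
rewrite !inE; have := @F12 j; case: (j \in F1); case: (j \in F2) => //=.
by move=> /(_ erefl erefl).
Qed.

Lemma grouping K1 K2 : K1 `<=` D -> K2 `<=` D -> K1 `&` K2 = set0 ->
  indep_systems <<s \bigcup_(j in K1) E j >> <<s \bigcup_(j in K2) E j >>.
Proof.
move=> K1D K2D K12.
have sub K : \bigcup_(j in K) E j `<=` cylinder K.
  move=> A [j Kj EjA]; exists [fset j]%fset, (fun i => if i == j then A else setT).
  split.
  - by move=> i /=; rewrite in_fset1 => /eqP ->.
  - by move=> i; case: eqP => [->|_]; [exact: EjA|exact: ET].
  - by move=> i; rewrite in_fset1 => /negbTE ->.
  - rewrite set_fset1 bigcap_set1 eqxx//.
apply: (@indep_systemsS <<s cylinder K1 >> <<s cylinder K2 >>).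
- by apply: sub_sigma_algebra2; exact: sub.
- by apply: sub_sigma_algebra2; exact: sub.
apply: indep_systems_sigma => //; [exact: measurable_cylinder|
  exact: measurable_cylinder|exact: cylinder_indep].
Qed.

End Grouping.

End Independence.

(** * Decoupling of independent quantities *)

Section Decoupling.
Variables (d : measure_display) (Omega : measurableType d) (R : realType).
Variable P : probability Omega R.
Variables (d1 d2 : measure_display).
Variables (T1 : measurableType d1) (T2 : measurableType d2).
Variables (X : Omega -> T1) (Y : Omega -> T2).
Hypotheses (mX : measurable_fun setT X) (mY : measurable_fun setT Y).
Hypothesis XY : indep_systems P (preimage_set_system setT X measurable)
  (preimage_set_system setT Y measurable).

Let X' : {mfun Omega >-> T1} := HB.pack X (isMeasurableFun.Build _ _ _ _ X mX).
Let Y' : {mfun Omega >-> T2} := HB.pack Y (isMeasurableFun.Build _ _ _ _ Y mY).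
Let mZ : measurable_fun setT (fun w => (X w, Y w)) := measurable_fun_pair mX mY.
Let Z' : {mfun Omega >-> (T1 * T2)%type} := HB.pack (fun w => (X w, Y w))
  (isMeasurableFun.Build _ _ _ _ (fun w => (X w, Y w)) mZ).

Let joint_law (A : set (T1 * T2)) : measurable A ->
  distribution P Z' A = (distribution P X' \x distribution P Y')%E A.
Proof.
move=> mA; apply/esym/(@product_measure_unique _ _ _ _ _ _ _ (distribution P Z')) => //.
move=> A1 A2 mA1 mA2.
have := XY; apply.
- by exists A1 => //; rewrite setTI.
- by exists A2 => //; rewrite setTI.
Qed.

(** The law of the pair is the product of the laws, since rectangles determine it; Tonelli applies
    there and each marginal is pulled back to [Omega]. *)
Lemma decoupling (h : T1 * T2 -> \bar R) :
  measurable_fun setT h -> (forall z, (0 <= h z)%E) ->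
  (\int[P]_w h (X w, Y w) = \int[P]_w \int[P]_w' h (X w, Y w'))%E.
Proof.
move=> mh h0.
have -> : (\int[P]_w h (X w, Y w) = \int[distribution P Z']_z h z)%E.
  by rewrite ge0_integral_distribution.
rewrite (eq_measure_integral (distribution P X' \x distribution P Y')%E); last first.
  by move=> A mA _; exact: joint_law.
rewrite fubini_tonelli1// ge0_integral_distribution//.
- apply: eq_integral => w _ /=.
  rewrite /fubini_F ge0_integral_distribution//.
  exact: measurableT_comp.
- exact: measurable_fun_fubini_tonelli_F.
- by move=> x; apply: integral_ge0.
Qed.

End Decoupling.

(** * Real-valued expectation *)

Section RealExpectation.
Variables (d : measure_display) (Omega : measurableType d) (R : realType).
Variable P : probability Omega R.
Implicit Types f g : Omega -> R.

Definition summable_rv f := P.-integrable setT (EFin \o f).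
(** Real-valued, so that linear arithmetic applies. An infinite integral counts as [0], which is why
    upper bounds on [mean] come paired with [summable_rv]. *)
Definition mean f : R := \int[P]_w f w.

Lemma EFin_mean f : summable_rv f -> ((mean f)%:E = \int[P]_w (f w)%:E)%E.
Proof. by move=> fi; rewrite fineK//; exact: integrable_fin_num. Qed.

Lemma summable_rv_measurable f : summable_rv f -> measurable_fun setT f.
Proof. by move=> /measurable_int/measurable_EFinP. Qed.

Lemma summable_rv_cst (c : R) : summable_rv (fun=> c).
Proof. exact: finite_measure_integrable_cst. Qed.

Lemma summable_rvD f g :
  summable_rv f -> summable_rv g -> summable_rv (fun w => f w + g w).
Proof. by move=> fi gi; exact: (integrableD measurableT fi gi). Qed.

Lemma summable_rvB f g :
  summable_rv f -> summable_rv g -> summable_rv (fun w => f w - g w).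
Proof. by move=> fi gi; exact: (integrableB measurableT fi gi). Qed.

Lemma summable_rvZ (c : R) f : summable_rv f -> summable_rv (fun w => c * f w).
Proof. by move=> fi; exact: (integrableZl measurableT c fi). Qed.

Lemma summable_rv_sum (I : Type) (r : seq I) (h : I -> Omega -> R) :
  (forall i, summable_rv (h i)) -> summable_rv (fun w => \sum_(i <- r) h i w).
Proof.
move=> hi; elim: r => [|i r ih].
  by under eq_fun do rewrite big_nil; exact: summable_rv_cst.
by under eq_fun do rewrite big_cons; exact: summable_rvD.
Qed.

Lemma summable_rv_le f g : measurable_fun setT f ->
  (forall w, `|f w| <= g w) -> summable_rv g -> summable_rv f.
Proof.
move=> mf fg gi; apply: le_integrable gi => //; first exact/measurable_EFinP.
move=> w _ /=; rewrite lee_fin (le_trans (fg w))//.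
by rewrite ler_norm.
Qed.

Lemma mean_cst (c : R) : mean (fun=> c) = c.
Proof.
by rewrite /mean Rintegral_cst// [X in fine X]probability_setT mulr1.
Qed.

Lemma meanD f g : summable_rv f -> summable_rv g ->
  mean (fun w => f w + g w) = mean f + mean g.
Proof. exact: RintegralD. Qed.

Lemma meanB f g : summable_rv f -> summable_rv g ->
  mean (fun w => f w - g w) = mean f - mean g.
Proof. exact: RintegralB. Qed.

Lemma meanZ (c : R) f : summable_rv f -> mean (fun w => c * f w) = c * mean f.
Proof. by move=> fi; exact: RintegralZl. Qed.

Lemma mean_sum (I : Type) (r : seq I) (h : I -> Omega -> R) :
  (forall i, summable_rv (h i)) ->
  mean (fun w => \sum_(i <- r) h i w) = \sum_(i <- r) mean (h i).
Proof.
move=> hi; elim: r => [|i r ih].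
  by under [in LHS]eq_fun do rewrite big_nil; rewrite mean_cst big_nil.
rewrite big_cons -ih -meanD//; last exact: summable_rv_sum.
by congr mean; apply/funext => w; rewrite big_cons.
Qed.

Lemma le_mean f g : summable_rv f -> summable_rv g ->
  (forall w, f w <= g w) -> mean f <= mean g.
Proof. by move=> fi gi fg; apply: le_Rintegral. Qed.

Lemma mean_ge0 f : (forall w, 0 <= f w) -> 0 <= mean f.
Proof. by move=> f0; apply: Rintegral_ge0. Qed.

Lemma ae_summable_rv f g : {ae P, forall w, f w = g w} ->
  measurable_fun setT g -> summable_rv f -> summable_rv g.
Proof.
move=> fg mg fi; have mf := summable_rv_measurable fi.
apply/integrableP; split; first exact/measurable_EFinP.
have /integrableP[_] := fi; rewrite (ge0_ae_eq_integral (g := abse \o (EFin \o g)))//.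
- by apply: measurableT_comp => //; exact/measurable_EFinP.
- by apply: measurableT_comp => //; exact/measurable_EFinP.
- by move=> w _; exact: abse_ge0.
- by apply: filterS fg => w fgw _ /=; rewrite fgw.
Qed.

Lemma ae_mean f g : {ae P, forall w, f w = g w} ->
  measurable_fun setT f -> measurable_fun setT g -> mean f = mean g.
Proof.
move=> fg mf mg; congr fine; apply: ae_eq_integral => //; try exact/measurable_EFinP.
by apply: filterS fg => w /= -> .
Qed.

(** [Num.min (f w) (g w)] equals [f] almost surely and lies below [g] everywhere, which reduces the
    claim to [le_mean]. *)
Lemma ae_le_mean f g : summable_rv f -> summable_rv g ->
  {ae P, forall w, f w <= g w} -> mean f <= mean g.
Proof.
move=> fi gi fg.
have mm : measurable_fun setT (fun w => Num.min (f w) (g w)).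
  by apply: measurable_minr; exact: summable_rv_measurable.
have E : {ae P, forall w, f w = Num.min (f w) (g w)}.
  by apply: filterS fg => w fgw; rewrite min_l.
rewrite (ae_mean E)//; last exact: summable_rv_measurable.
apply: le_mean => //; first exact: ae_summable_rv E mm fi.
by move=> w; rewrite ge_min lexx orbT.
Qed.

Definition square_summable_rv f :=
  measurable_fun setT f /\ summable_rv (fun w => f w ^+ 2).

Lemma square_summable_rvM f g :
  square_summable_rv f -> square_summable_rv g ->
  summable_rv (fun w => f w * g w).
Proof.
move=> [mf f2] [mg g2].
apply: summable_rv_le (summable_rvD f2 g2); first exact: measurable_funM.
move=> w; rewrite normrM -(real_normK (num_real (f w))) -(real_normK (num_real (g w))).
have := sqr_ge0 (`|f w| - `|g w|); have := mulr_ge0 (normr_ge0 (f w)) (normr_ge0 (g w)).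
by nra.
Qed.

Lemma square_summable_rv_cst (c : R) : square_summable_rv (fun=> c).
Proof. by split=> //; exact: summable_rv_cst. Qed.

Lemma square_summable_rvW f : square_summable_rv f -> summable_rv f.
Proof.
move=> f2; have := square_summable_rvM f2 (square_summable_rv_cst 1).
by under eq_fun do rewrite mulr1.
Qed.

Lemma square_summable_rvZ (c : R) f :
  square_summable_rv f -> square_summable_rv (fun w => c * f w).
Proof.
move=> [mf f2]; split; first exact: measurable_funM.
by under eq_fun do rewrite exprMn; exact: summable_rvZ.
Qed.

Lemma square_summable_rvD f g : square_summable_rv f -> square_summable_rv g ->
  square_summable_rv (fun w => f w + g w).
Proof.
move=> f2 g2; split; first by apply: measurable_funD; [case: f2|case: g2].
under eq_fun do rewrite sqrrD.
apply: summable_rvD; last by case: g2.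
apply: summable_rvD; first by case: f2.
under eq_fun do rewrite -mulr_natl.
by apply: summable_rvZ; exact: square_summable_rvM.
Qed.

Lemma square_summable_rvB f g : square_summable_rv f -> square_summable_rv g ->
  square_summable_rv (fun w => f w - g w).
Proof.
move=> f2 g2; under eq_fun do rewrite -[X in _ + X]mulN1r.
by apply: square_summable_rvD => //; exact: square_summable_rvZ.
Qed.

Lemma preimage_system_comp d' (T : measurableType d') (X : Omega -> T)
    d'' (T' : measurableType d'') (k : T -> T') :
  measurable_fun setT k ->
  preimage_set_system setT (k \o X) measurable `<=`
  preimage_set_system setT X measurable.
Proof.
move=> mk _ [B mB <-]; exists (k @^-1` B) => //.
by rewrite -[X in measurable X]setTI; exact: mk.
Qed.

Let ge0_indep_summable_rvM f g : summable_rv f -> summable_rv g ->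
  (forall w, 0 <= f w) -> (forall w, 0 <= g w) ->
  indep_systems P (preimage_set_system setT f measurable)
    (preimage_set_system setT g measurable) ->
  summable_rv (fun w => f w * g w) /\
  mean (fun w => f w * g w) = mean f * mean g.
Proof.
move=> fi gi f0 g0 fg.
have mf := summable_rv_measurable fi; have mg := summable_rv_measurable gi.
(* [decoupling] asks for nonnegativity on all of [R * R], whence the absolute value. *)
have mm : measurable_fun setT (fun z : R * R => `|z.1 * z.2|%:E).
  by apply/measurable_EFinP; apply: measurableT_comp => //; exact: measurable_funM.
have h0 (z : R * R) : (0 <= `|z.1 * z.2|%:E)%E by rewrite lee_fin.
have E : (\int[P]_w (f w * g w)%:E = (mean f * mean g)%:E)%E.
  under eq_integral do rewrite -[_ * _]ger0_norm ?mulr_ge0//.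
  have -> := decoupling mf mg fg mm h0.
  under eq_integral => w _.
    rewrite (_ : (\int[P]_w' _ = (f w * mean g)%:E)%E); last first.
      under eq_integral do rewrite /= ger0_norm ?mulr_ge0// EFinM.
      by rewrite integralZl// -EFin_mean.
    rewrite mulrC EFinM; over.
  by rewrite integralZl// -EFin_mean// -EFinM mulrC.
split; last by rewrite /mean /Rintegral E.
apply/integrableP; split; first by apply/measurable_EFinP; exact: measurable_funM.
under eq_integral do rewrite /= ger0_norm ?mulr_ge0//.
by rewrite E ltry.
Qed.

(** Split both factors into positive and negative parts. Each part is a function of its factor, so
    independence survives, and the nonnegative case applies to the four products. *)
Lemma indep_summable_rvM f g : summable_rv f -> summable_rv g ->
  indep_systems P (preimage_set_system setT f measurable)
    (preimage_set_system setT g measurable) ->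
  summable_rv (fun w => f w * g w) /\
  mean (fun w => f w * g w) = mean f * mean g.
Proof.
move=> fi gi fg.
pose pos (x : R) := Num.max x 0; pose neg (x : R) := Num.max (- x) 0.
have mpos : measurable_fun setT pos by apply: measurable_maxr.
have mneg : measurable_fun setT neg.
  by apply: measurable_maxr => //; exact: measurable_funN.
have pn x : x = pos x - neg x.
  by rewrite /pos /neg; case: (leP x 0) => x0;
    rewrite [Num.max (- x) 0]maxEle oppr_le0; case: ifPn; lra.
have pos0 x : 0 <= pos x by rewrite le_max lexx orbT.
have neg0 x : 0 <= neg x by rewrite le_max lexx orbT.
have ple x : `|pos x| <= `|x|.
  by rewrite ger0_norm// ge_max normr_ge0 ler_norm.
have nle x : `|neg x| <= `|x|.
  by rewrite ger0_norm// ge_max normr_ge0 -normrN ler_norm.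
have int (k : R -> R) h : measurable_fun setT k -> (forall x, `|k x| <= `|x|) ->
    summable_rv h -> summable_rv (k \o h).
  move=> mk kx hi; apply: summable_rv_le (integrable_norm hi).
    by apply: measurableT_comp => //; exact: summable_rv_measurable.
  by move=> w; exact: kx.
have prod (k k' : R -> R) : measurable_fun setT k -> measurable_fun setT k' ->
    (forall x, `|k x| <= `|x|) -> (forall x, `|k' x| <= `|x|) ->
    (forall x, 0 <= k x) -> (forall x, 0 <= k' x) ->
    summable_rv (fun w => k (f w) * k' (g w)) /\
    mean (fun w => k (f w) * k' (g w)) = mean (k \o f) * mean (k' \o g).
  move=> mk mk' kx k'x k0 k'0.
  apply: (@ge0_indep_summable_rvM (k \o f) (k' \o g)) => //; try exact: int.
  - by move=> w; exact: k0.
  - by move=> w; exact: k'0.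
  by apply: indep_systemsS fg; exact: preimage_system_comp.
have [pp ppE] := prod pos pos mpos mpos ple ple pos0 pos0.
have [pq pqE] := prod pos neg mpos mneg ple nle pos0 neg0.
have [qp qpE] := prod neg pos mneg mpos nle ple neg0 pos0.
have [qq qqE] := prod neg neg mneg mneg nle nle neg0 neg0.
have fgE : (fun w => f w * g w) = (fun w => (pos (f w) * pos (g w) -
    pos (f w) * neg (g w)) - (neg (f w) * pos (g w) - neg (f w) * neg (g w))).
  by apply/funext => w; rewrite {1}(pn (f w)) {1}(pn (g w)); ring.
split; first by rewrite fgE; apply: summable_rvB; exact: summable_rvB.
rewrite fgE meanB ?meanB//; try exact: summable_rvB.
rewrite ppE pqE qpE qqE.
have mE h : summable_rv h -> mean h = mean (pos \o h) - mean (neg \o h).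
  move=> hi; rewrite -meanB; [|exact: int|exact: int].
  by congr mean; apply/funext => w; exact: pn.
by rewrite (mE f)// (mE g)//; ring.
Qed.

End RealExpectation.

(** * Gaussian moments *)

Section GaussianMoments.
Variable R : realType.
Let leb := @lebesgue_measure R.
Let p : R -> R := normal_pdf 0 1.

Let p_def x : p x = normal_peak 1 * expR (- (x ^+ 2 / 2)).
Proof.
by rewrite /p normal_pdfE ?oner_neq0// /normal_fun subr0 expr1n mulNr mulr2n.
Qed.

Let p_ge0 x : 0 <= p x. Proof. exact: normal_pdf_ge0. Qed.

Let p_cont : continuous p.
Proof. by apply: continuous_normal_pdf; rewrite oner_neq0. Qed.

Let p_even x : p (- x) = p x. Proof. by rewrite !p_def sqrrN. Qed.

Let dp (x : R) : is_derive x 1 p (- x * p x).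
Proof.
rewrite p_def (_ : p = fun x => normal_peak 1 * expR (- (x ^+ 2 / 2))); last first.
  by apply/funext => y; exact: p_def.
have de : is_derive x 1 (fun y : R => expR (- (y ^+ 2 / 2))) (- x * expR (- (x ^+ 2 / 2))).
  have dq : is_derive x 1 (fun y : R => - (y ^+ 2 / 2)) (- x).
    by apply: is_derive_eq; rewrite /GRing.scale /=; field.
  rewrite mulrC; apply: (@is_derive1_comp _ expR _ x _ _ _ dq).
apply: is_derive_eq; rewrite /GRing.scale /=; ring.
Qed.

(** Integrated over the half line, this becomes the recurrence between the moments of orders [k + 2]
    and [k]. *)
Let d_mono k (x : R) : is_derive x 1 (fun y : R => - (y ^+ k.+1 * p y))
  (x ^+ k.+2 * p x - k.+1%:R * (x ^+ k * p x)).
Proof.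
have -> : (fun y : R => - (y ^+ k.+1 * p y)) = - (id ^+ k.+1 * p).
  by apply/funext => y; rewrite !fctE.
have h := is_deriveN (is_deriveM (is_deriveX k.+1 (is_derive_id x 1)) (dp x)).
apply: (@is_derive_eq _ _ _ _ _ _ _ _ h); rewrite /GRing.scale/= !fctE !exprS; ring.
Qed.

Let mono_cont k : continuous (fun y : R => y ^+ k * p y).
Proof.
by move=> x; apply: cvgM; [exact: exprn_continuous|exact: p_cont].
Qed.

Let mono_cvg0 k : n%:R ^+ k.+1 * p n%:R @[n --> \oo] --> (0 : R).
Proof.
(* From [exp y >= y^(k+2) / (k+2)!] at [y = n^2 / 2]: the product is at most [c / n^(k+3)], hence at
   most [c / n]. *)
pose c : R := normal_peak 1 * (2 ^+ k.+2 * (k.+2)`!%:R).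
have bound n : 0 <= n.+1%:R ^+ k.+1 * p n.+1%:R <= c * harmonic n.
  apply/andP; split; first by rewrite mulr_ge0// exprn_ge0.
  rewrite p_def mulrCA /c -[leRHS]mulrA; apply: ler_wpM2l.
    exact: normal_peak_ge0.
  have n0 : 0 < n.+1%:R :> R by [].
  rewrite expRN ler_pdivrMr ?expR_gt0//.
  have y0 : 0 <= n.+1%:R ^+ 2 / 2 :> R by rewrite divr_ge0 ?sqr_ge0.
  have := expR_ge1Dxn k.+1 y0 => /(le_trans _) h.
  have {}h := h _ (ler_wpDl ler01 (lexx _)).
  have K0 : 0 < 2 ^+ k.+2 * (k.+2)`!%:R :> R.
    by rewrite mulr_gt0 ?exprn_gt0 ?ltr0n ?fact_gt0.
  have {}h : n.+1%:R ^+ (2 * k.+2) <=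
      2 ^+ k.+2 * (k.+2)`!%:R * expR (n.+1%:R ^+ 2 / 2) :> R.
    rewrite mulrC -ler_pdivrMr//; apply: le_trans h.
    by rewrite exprMn exprVn -exprM invfM mulrA.
  apply: (@le_trans _ _ (n.+1%:R ^+ (2 * k.+2) / n.+1%:R)); last first.
    by rewrite [leRHS]mulrAC ler_pM2r ?invr_gt0.
  rewrite (_ : (2 * k.+2 = (k.+2 + k.+1).+1)%N); last by lia.
  rewrite [X in _ <= X / _]exprSr mulfK ?gt_eqF// exprD ler_peMl ?exprn_ge0//.
  by rewrite exprn_ege1// ler1n.
rewrite -cvg_shiftS.
have c0 : (fun=> 0 : R) n @[n --> \oo] --> (0 : R) by exact: cvg_cst.
have c1 : c * harmonic n @[n --> \oo] --> (0 : R).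
  by rewrite -(mulr0 c); apply: cvgM; [exact: cvg_cst|exact: cvg_harmonic].
by apply: (squeeze_cvgr _ c0 c1); near=> n; exact: bound.
Unshelve. all: by end_near. Qed.

(** On the half line the integrand is nonnegative for every [k], odd ones included, so the integral
    is the limit of those over [[0, n]]. *)
Let half k := (\int[leb]_(x in `[0%R, +oo[) (x ^+ k * p x)%:E)%E.

Let mono_ge0 k (x : R) : 0 <= x -> 0 <= x ^+ k * p x.
Proof. by move=> x0; rewrite mulr_ge0 ?exprn_ge0. Qed.

Let mono_meas k : measurable_fun setT (fun x : R => x ^+ k * p x).
Proof. by apply: continuous_measurable_fun; exact: mono_cont. Qed.

Let half_cvg k :
  (\int[leb]_(x in `[0%R, n%:R]) (x ^+ k * p x)%:E)%E @[n --> \oo] --> half k.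
Proof.
(* Agrees with the integrand on the half line and is nonnegative on the whole line, as monotone
   convergence requires. *)
pose g x := Num.max (x ^+ k * p x) 0.
have gE (D : set R) : D `<=` [set x | 0 <= x] ->
    (\int[leb]_(x in D) (x ^+ k * p x)%:E = \int[leb]_(x in D) (g x)%:E)%E.
  move=> D0; apply: eq_integral => x /[!inE] /D0 /= x0.
  by rewrite /g max_l// mono_ge0.
rewrite /half gE; last by rewrite set_itvcy.
have -> : (fun n : nat => (\int[leb]_(x in `[0%R, n%:R]) (x ^+ k * p x)%:E)%E) =
    (fun n : nat => (\int[leb]_(x in `[0%R, n%:R]) (g x)%:E)%E).
  by apply/funext => n; apply: gE => x /=; rewrite in_itv/= => /andP[].
apply: ge0_cvgn_integral; first by move=> x; rewrite le_max lexx orbT.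
by apply: measurable_maxr => //; exact: mono_meas.
Qed.

Let half_rec k : half k \is a fin_num -> half k.+2 = (k.+1%:R%:E * half k)%E.
Proof.
move=> hk; rewrite -[LHS](cvg_lim (@ereal_hausdorff R) (@half_cvg k.+2)).
apply: (cvg_lim (@ereal_hausdorff R)).
(* The fundamental theorem of calculus for [d_mono]; the endpoint [n.+1] keeps the interval
   nondegenerate, and the boundary term vanishes in the limit by [mono_cvg0]. *)
have E n : (\int[leb]_(x in `[0%R, n.+1%:R]) (x ^+ k.+2 * p x)%:E =
    k.+1%:R%:E * (\int[leb]_(x in `[0%R, n.+1%:R]) (x ^+ k * p x)%:E)
    + (- (n.+1%:R ^+ k.+1 * p n.+1%:R))%:E)%E.
  have int j : leb.-integrable `[0%R, n.+1%:R]%classic (EFin \o (fun x : R => x ^+ j * p x)).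
    apply: continuous_compact_integrable; first exact: segment_compact.
    by apply: continuous_subspaceT; exact: mono_cont.
  have ftc : (\int[leb]_(x in `[0%R, n.+1%:R])
      (x ^+ k.+2 * p x - k.+1%:R * (x ^+ k * p x))%:E =
      (- (n.+1%:R ^+ k.+1 * p n.+1%:R))%:E)%E.
    rewrite (@continuous_FTC2 _ _ (fun y : R => - (y ^+ k.+1 * p y))).
    - by rewrite expr0n/= mul0r oppr0 sube0.
    - by rewrite ltr0n.
    - apply: continuous_subspaceT => x; apply: cvgB; first exact: mono_cont.
      by apply: cvgM; [exact: cvg_cst|exact: mono_cont].
    - have dc x : {for x, continuous (fun y : R => - (y ^+ k.+1 * p y))}.
        apply/differentiable_continuous/derivable1_diffP.
        by have [] := d_mono k x.
      split.
      + by move=> x _; have [] := d_mono k x.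
      + exact/cvg_at_right_filter/dc.
      + exact/cvg_at_left_filter/dc.
    - by move=> x _; rewrite derive1E; have [_ ->] := d_mono k x.
  transitivity (\int[leb]_(x in `[0%R, n.+1%:R])
      ((x ^+ k.+2 * p x - k.+1%:R * (x ^+ k * p x)) + k.+1%:R * (x ^+ k * p x))%:E)%E.
    by apply: eq_integral => x _; rewrite subrK.
  have intk : leb.-integrable `[0%R, n.+1%:R]%classic
      (EFin \o (fun x : R => k.+1%:R * (x ^+ k * p x))).
    by apply: (integrableZl _ k.+1%:R (int k)); exact: measurable_itv.
  have intB : leb.-integrable `[0%R, n.+1%:R]%classic
      (EFin \o (fun x : R => x ^+ k.+2 * p x - k.+1%:R * (x ^+ k * p x))).
    by apply: (integrableB _ (int k.+2) intk); exact: measurable_itv.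
  rewrite integralD_EFin//= ftc addeC; congr (_ + _)%E.
  by under eq_integral do rewrite EFinM; rewrite integralZl//; exact: int.
rewrite -cvg_shiftS; under eq_fun do rewrite E.
rewrite -(adde0 (_ * half k)%E); apply: cvgeD.
- by rewrite fin_num_adde_defl.
- apply: cvgeZl => //.
  by have := @half_cvg k; rewrite -cvg_shiftS.
- apply/fine_cvgP; split; first exact: nearW.
  rewrite -oppr0; apply: cvgN.
  by have := @mono_cvg0 k; rewrite -[X in X -> _]cvg_shiftS.
Qed.

Let full k : (\int[leb]_x (x ^+ (2 * k) * p x)%:E = 2%:E * half (2 * k))%E.
Proof.
rewrite ge0_symfun_integralT.
- by rewrite /half set_itvcy.
- by move=> x; rewrite mulr_ge0// exprM exprn_ge0// sqr_ge0.
- exact: mono_cont.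
- by move=> x /=; rewrite p_even !exprM sqrrN.
Qed.

Let half0 : half 0 = (2^-1)%:E.
Proof.
have := full 0; rewrite muln0; under eq_integral do rewrite expr0 mul1r.
rewrite integral_normal_pdf.
case: (half 0) => [r|//|//]; last by rewrite mulrNy gtr0_sg// mul1e.
  by rewrite -EFinM => -[r2]; congr EFin; lra.
by rewrite mulry gtr0_sg// mul1e.
Qed.

Lemma integral_normal_moments : [/\
  (\int[leb]_x (x ^+ 2 * p x)%:E = 1)%E, (\int[leb]_x (x ^+ 4 * p x)%:E = 3%:E)%E
  & (\int[leb]_x (x ^+ 6 * p x)%:E = 15%:E)%E].
Proof.
have h2 : half 2 = (2^-1)%:E by rewrite half_rec half0// -EFinM mul1r.
have h4 : half 4 = (3 * 2^-1)%:E by rewrite half_rec h2.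
have h6 : half 6 = (5 * (3 * 2^-1))%:E by rewrite half_rec h4.
split.
- by rewrite (full 1) h2 -EFinM mulfV ?pnatr_eq0.
- by rewrite (full 2) h4 -EFinM; congr EFin; field.
- by rewrite (full 3) h6 -EFinM; congr EFin; field.
Qed.

(** Since [- p] is a primitive of [x * p x], both parts of the identity have the same finite
    integral [p 0]; this is what makes a Gaussian coordinate centred. *)
Lemma integral_normal_odd_parts :
  (\int[leb]_x (Num.max x 0 * p x)%:E = (p 0)%:E)%E /\
  (\int[leb]_x (Num.max (- x) 0 * p x)%:E = (p 0)%:E)%E.
Proof.
have h1 : half 1 = (p 0)%:E.
  have dN (x : R) : is_derive x 1 (fun y => - p y) (x ^+ 1 * p x).
    have h := is_deriveN (dp x).
    by apply: (@is_derive_eq _ _ _ _ _ _ _ _ h); rewrite expr1 mulNr opprK.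
  have cN : continuous (fun y : R => - p y) by move=> x; apply: cvgN; exact: p_cont.
  rewrite /half (@ge0_continuous_FTC2y _ _ (fun y => - p y) _ 0).
  - by rewrite sub0e -EFinN opprK.
  - by move=> x x0; exact: mono_ge0.
  - by apply: continuous_subspaceT; exact: mono_cont.
  - have pcvg : p x @[x --> +oo] --> (0 : R).
      rewrite (_ : p = fun x => normal_peak 1 * expR (- (x ^+ 2 / 2))); last first.
        by apply/funext => y; exact: p_def.
      rewrite -(mulr0 (normal_peak 1)); apply: cvgM; first exact: cvg_cst.
      apply: (@cvg_comp _ _ _ (fun x : R => x ^+ 2 / 2) (fun x => expR (- x)));
        last exact: cvgr_expR.
      apply/cvgryPge => A; near=> x.
      have x2 : 2 <= x by near: x; apply: nbhs_pinfty_ge; exact: num_real.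
      have xA : A <= x by near: x; apply: nbhs_pinfty_ge; exact: num_real.
      by nra.
    by rewrite -oppr0; apply: cvgN.
  - by move=> x _; have [] := dN x.
  - exact/cvg_at_right_filter/cN.
  - by move=> x _; rewrite derive1E; have [_ ->] := dN x.
have maxE (D : set R) (g : R -> R) :
    (forall x, g x = patch (fun=> 0) D (fun x => g x) x) -> measurable D ->
    (\int[leb]_x (g x * p x)%:E = \int[leb]_(x in D) (g x * p x)%:E)%E.
  move=> gD mD; rewrite [RHS]integral_mkcond; apply: eq_integral => x _.
  by rewrite patchE; have := gD x; rewrite patchE; case: ifP => // _ ->; rewrite mul0r.
split.
- rewrite (maxE `[0, +oo[%classic)//; last first.
    move=> x; rewrite patchE; case: ifPn => //; rewrite notin_setE/= in_itv/= andbT.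
    by move=> /negP; rewrite -ltNge => x0; rewrite max_r// ltW.
  rewrite -h1; apply: eq_integral => x; rewrite inE/= in_itv/= andbT => x0.
  by rewrite max_l// expr1.
- rewrite (maxE `]-oo, 0]%classic)//; last first.
    move=> x; rewrite patchE; case: ifPn => //; rewrite notin_setE/= in_itv/=.
    by move=> /negP; rewrite -ltNge => x0; rewrite max_r// oppr_le0 ltW.
  rewrite -[X in `]-oo, X]]oppr0 ge0_integration_by_substitutionNy.
  + rewrite -h1; apply: eq_integral => x; rewrite inE/= in_itv/= andbT => x0.
    by rewrite opprK p_even max_l// expr1.
  + apply: continuous_subspaceT => x; apply: cvgM; last exact: p_cont.
    by apply: continuous_max; [apply: cvgN; exact: cvg_id|exact: cvg_cst].
  + by move=> x _; rewrite mulr_ge0// le_max lexx orbT.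
Unshelve. all: by end_near. Qed.

(** Change of variables with the Radon-Nikodym derivative, which equals the density almost
    everywhere because both integrate to [normal_prob] on every measurable set. *)
Lemma ge0_integral_normal_prob (h : R -> R) :
  measurable_fun setT h -> (forall x, 0 <= h x) ->
  (\int[normal_prob 0 1]_x (h x)%:E = \int[leb]_x (h x * p x)%:E)%E.
Proof.
move=> mh h0; have dom := @normal_prob_dominates R 0 1.
have h0' (x : R) : (0 <= (h x)%:E)%E by rewrite lee_fin.
have mh' : measurable_fun setT (EFin \o h) by exact/measurable_EFinP.
rewrite -(Radon_Nikodym_SigmaFinite.change_of_variables dom h0' measurableT mh').
have mp : measurable_fun setT (fun x => (p x)%:E).
  by apply/measurable_EFinP; exact: measurable_normal_pdf.
have mRN := measurable_int _ (Radon_Nikodym_SigmaFinite.f_integrable dom).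
apply: ae_eq_integral => //.
- by apply: emeasurable_funM => //; exact/measurable_EFinP.
- by apply/measurable_EFinP; apply: measurable_funM => //; exact: measurable_normal_pdf.
- have : ae_eq leb setT (Radon_Nikodym_SigmaFinite.f (normal_prob 0 1) leb) (fun x => (p x)%:E).
    apply: integral_ae_eq => //.
      exact: Radon_Nikodym_SigmaFinite.f_integrable.
    by move=> E _ mE; rewrite -Radon_Nikodym_SigmaFinite.f_integral.
  by apply: filterS => x /= /(_ I) ->.
Qed.

End GaussianMoments.

Lemma ge0_integral_law d (Omega : measurableType d) (R : realType)
    (P : probability Omega R) d' (T : measurableType d') (X : Omega -> T)
    (Q : probability T R) (mX : measurable_fun setT X) :
  (forall A, measurable A -> P (X @^-1` A) = Q A) ->
  forall f : T -> \bar R, measurable_fun setT f -> (forall x, (0 <= f x)%E) ->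
  (\int[P]_w f (X w) = \int[Q]_x f x)%E.
Proof.
move=> XQ f mf f0.
pose X' : {mfun Omega >-> T} := HB.pack X (isMeasurableFun.Build _ _ _ _ X mX).
transitivity (\int[distribution P X']_x f x)%E.
  by rewrite ge0_integral_distribution.
by apply: eq_measure_integral => A mA _; exact: XQ.
Qed.

Lemma measurable_generated (Omega : pointedType) (J : Type) (K : set J)
    (E : J -> set_system Omega) (j : J) d (T : measurableType d) (X : Omega -> T) :
  K j -> preimage_set_system setT X measurable `<=` E j ->
  measurable_fun [set: g_sigma_algebraType (\bigcup_(j in K) E j)] X.
Proof.
move=> Kj XE _ B mB; rewrite setTI; apply: sub_sigma_algebra.
by exists j => //; apply: XE; exists B => //; rewrite setTI.
Qed.

Section GroupedFunctions.
Variables (d : measure_display) (Omega : measurableType d) (R : realType).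
Variable P : probability Omega R.
Variables (J : choiceType) (D : set J) (E : J -> set_system Omega).
Hypotheses (indE : mutually_independent P D E).
Hypotheses (mE : forall j, D j -> E j `<=` measurable).
Hypotheses (EI : forall j, setI_closed (E j)) (ET : forall j, E j setT).

Lemma grouped_measurable (K : set J) d' (T : measurableType d') (X : Omega -> T) :
  K `<=` D ->
  measurable_fun [set: g_sigma_algebraType (\bigcup_(j in K) E j)] X ->
  measurable_fun setT X.
Proof.
move=> KD mX _ B mB; have := mX measurableT B mB; apply: smallest_sub.
  exact: sigma_algebra_measurable.
by move=> A [j /KD/mE]; exact.
Qed.

Variables (K1 K2 : set J).
Hypotheses (K1D : K1 `<=` D) (K2D : K2 `<=` D) (K12 : K1 `&` K2 = set0).

Lemma grouped_indep d1 (T1 : measurableType d1) d2 (T2 : measurableType d2)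
    (X : Omega -> T1) (Y : Omega -> T2) :
  measurable_fun [set: g_sigma_algebraType (\bigcup_(j in K1) E j)] X ->
  measurable_fun [set: g_sigma_algebraType (\bigcup_(j in K2) E j)] Y ->
  indep_systems P (preimage_set_system setT X measurable)
    (preimage_set_system setT Y measurable).
Proof.
move=> mX mY; apply: indep_systemsS (grouping indE mE EI ET K1D K2D K12).
- by move=> _ [B mB <-]; exact: mX.
- by move=> _ [B mB <-]; exact: mY.
Qed.

(** Both quantities are the identity of [Omega], read through the sigma-algebra of [K1] and through
    that of [K2]. *)
Lemma grouped_decoupling (h : Omega -> Omega -> \bar R) :
  measurable_fun [set: g_sigma_algebraType (\bigcup_(j in K1) E j) *
    g_sigma_algebraType (\bigcup_(j in K2) E j)] (fun z => h z.1 z.2) ->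
  (forall w w', (0 <= h w w')%E) ->
  (\int[P]_w h w w = \int[P]_w \int[P]_w' h w w')%E.
Proof.
move=> mh h0.
have mid K : K `<=` D -> measurable_fun setT
    (id : Omega -> g_sigma_algebraType (\bigcup_(j in K) E j)).
  by move=> KD; apply: (@grouped_measurable K) => //; exact: measurable_id.
apply: (@decoupling _ _ _ P _ _ (g_sigma_algebraType (\bigcup_(j in K1) E j))
  (g_sigma_algebraType (\bigcup_(j in K2) E j)) id id (mid _ K1D) (mid _ K2D) _
  (fun z => h z.1 z.2)) => //.
by apply: grouped_indep; exact: measurable_id.
Qed.

End GroupedFunctions.

Lemma preimage_system_measurable d (Omega : measurableType d) d'
    (T : measurableType d') (X : Omega -> T) :
  measurable_fun setT X -> preimage_set_system setT X measurable `<=` measurable.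
Proof. by move=> mX _ [B mB <-]; exact: mX. Qed.

Lemma preimage_systemI (Omega : Type) d (T : measurableType d) (X : Omega -> T) :
  setI_closed (preimage_set_system setT X measurable).
Proof.
move=> _ _ [A mA <-] [B mB <-]; exists (A `&` B); first exact: measurableI.
by rewrite !setTI.
Qed.

Lemma preimage_systemT (Omega : Type) d (T : measurableType d) (X : Omega -> T) :
  preimage_set_system setT X measurable setT.
Proof. by exists setT => //; rewrite setTI. Qed.

(** * Moments of a standard Gaussian vector *)

Section GaussianVector.
Variables (d : measure_display) (Omega : measurableType d) (R : realType).
Variables (P : probability Omega R) (m : nat) (u : Omega -> 'cV[R]_m).
Hypothesis gu : std_gaussian P u.
Let n : R := m%:R.

Let E (i : 'I_m) := preimage_set_system setT (fun w => u w i 0) measurable.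

Let mu_ : measurable_fun [set: Omega] (u : Omega -> borel_cV R m).
Proof. by case: gu. Qed.

Let mui i : measurable_fun setT (fun w => u w i 0).
Proof. exact: measurable_coord_comp mu_. Qed.

Let mN : measurable_fun setT (fun w => dot (u w) (u w)).
Proof. exact: measurable_dot. Qed.

Let law (h : R -> R) i : measurable_fun setT h -> (forall x, 0 <= h x) ->
  (\int[P]_w (h (u w i 0%R))%:E = \int[normal_prob 0 1]_x (h x)%:E)%E.
Proof.
move=> mh h0; have [_ lawu _] := gu.
have mh' : measurable_fun setT (EFin \o h) by exact/measurable_EFinP.
have h0' x : (0 <= (EFin \o h) x)%E by rewrite lee_fin.
exact: (@ge0_integral_law _ _ _ P _ _ _ (normal_prob 0 1) (mui i) (lawu i) _ mh' h0').
Qed.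

Let mean_law (h : R -> R) i (c : R) : measurable_fun setT h ->
  (forall x, 0 <= h x) ->
  (\int[lebesgue_measure]_x (h x * normal_pdf 0 1 x)%:E = c%:E)%E ->
  summable_rv P (fun w => h (u w i 0)) /\ mean P (fun w => h (u w i 0)) = c.
Proof.
move=> mh h0 hc.
have hE : (\int[P]_w (h (u w i 0%R))%:E = c%:E)%E.
  by rewrite law// ge0_integral_normal_prob.
split; last by rewrite /mean /Rintegral hE.
apply/integrableP; split.
  by apply/measurable_EFinP; exact: (measurableT_comp mh (mui i)).
by under eq_integral do rewrite /= ger0_norm//; rewrite hE ltry.
Qed.

Let pow k : measurable_fun setT (fun x : R => x ^+ k).
Proof. exact: measurable_funX. Qed.

Let even_ge0 k (x : R) : 0 <= x ^+ (2 * k).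
Proof. by rewrite exprM exprn_ge0// sqr_ge0. Qed.

Let u2 i : summable_rv P (fun w => u w i 0 ^+ 2) /\
  mean P (fun w => u w i 0 ^+ 2) = 1.
Proof.
apply: (mean_law (h := fun x => x ^+ 2)) => //; first exact: (even_ge0 1).
by have [-> _ _] := integral_normal_moments R.
Qed.

Let u4 i : summable_rv P (fun w => u w i 0 ^+ 4) /\
  mean P (fun w => u w i 0 ^+ 4) = 3.
Proof.
apply: (mean_law (h := fun x => x ^+ 4)) => //; first exact: (even_ge0 2).
by have [_ -> _] := integral_normal_moments R.
Qed.

Let u6 i : summable_rv P (fun w => u w i 0 ^+ 6) /\
  mean P (fun w => u w i 0 ^+ 6) = 15.
Proof.
apply: (mean_law (h := fun x => x ^+ 6)) => //; first exact: (even_ge0 3).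
by have [_ _ ->] := integral_normal_moments R.
Qed.

Let u1 i : summable_rv P (fun w => u w i 0) /\ mean P (fun w => u w i 0) = 0.
Proof.
have [pp pn] := integral_normal_odd_parts R.
have max0 (x : R) : 0 <= Num.max x 0 by rewrite le_max lexx orbT.
have [|ip mp] := @mean_law (fun x => Num.max x 0) i _ _ max0 pp.
  exact: measurable_maxr.
have [|iq mq] := @mean_law (fun x => Num.max (- x) 0) i _ _ (fun x => max0 (- x)) pn.
  by apply: measurable_maxr => //; exact: measurable_funN.
have uE : (fun w => u w i 0) = (fun w => Num.max (u w i 0) 0 - Num.max (- u w i 0) 0).
  apply/funext => w; rewrite [Num.max (- _) 0]maxEle oppr_le0.
  by case: (leP (u w i 0) 0) => u0; case: ifPn; lra.
rewrite uE; split; first exact: summable_rvB.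
by rewrite meanB// mp mq subrr.
Qed.

Let N w := dot (u w) (u w).
Let N_ge0 w : 0 <= N w. Proof. exact: dot_ge0. Qed.

(** The square norm is at most [n] times its largest squared coordinate, so its cube is at most
    [n^3] times the sum of the sixth powers. *)
Lemma summable_gaussian_norm6 : summable_rv P (fun w => dot (u w) (u w) ^+ 3).
Proof.
apply: (@summable_rv_le _ _ _ _ _ (fun w => \sum_(i < m) n ^+ 3 * u w i 0 ^+ 6)).
- exact: measurable_funX.
- move=> w; rewrite ger0_norm ?exprn_ge0 ?dot_ge0//.
  case: (posnP m) => [m0|m_gt0].
    have noi (i : 'I_m) : False by case: i => i; rewrite m0.
    by rewrite /dot !big1 ?expr0n// => i; case: (noi i).
  pose i0 := [arg max_(i > Ordinal m_gt0) (u w i 0 ^+ 2)]%O.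
  have le_i0 i : u w i 0 ^+ 2 <= u w i0 0 ^+ 2.
    by rewrite /i0; case: arg_maxP => // j _; exact.
  have Nle : dot (u w) (u w) <= n * u w i0 0 ^+ 2.
    rewrite /dot mulr_natl -[X in _ *+ X](card_ord m) -sumr_const.
    by apply: ler_sum => i _; rewrite -expr2.
  have N3 : dot (u w) (u w) ^+ 3 <= (n * u w i0 0 ^+ 2) ^+ 3.
    by rewrite lerXn2r ?nnegrE ?dot_ge0// (le_trans _ Nle)// dot_ge0.
  rewrite (le_trans N3)// exprMn -exprM (bigD1 i0)//= lerDl.
  apply: sumr_ge0 => i _; apply: mulr_ge0; first exact/exprn_ge0/ler0n.
  exact: (even_ge0 3).
- by apply: summable_rv_sum => i; apply: summable_rvZ; case: (u6 i).
Qed.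

(** Common envelope: expressions of degree at most 6 in [u] are dominated by a multiple of
    [1 + N^3]. *)
Let sN (f : Omega -> R) (c : R) : measurable_fun setT f ->
  (forall w, `|f w| <= c * (1 + N w ^+ 3)) -> summable_rv P f.
Proof.
move=> mf fN; apply: summable_rv_le mf fN _; apply: summable_rvZ.
by apply: summable_rvD; [exact: summable_rv_cst|exact: summable_gaussian_norm6].
Qed.

Let coord_le w i : u w i 0 ^+ 2 <= N w. Proof. exact: sqr_coord_le_dot. Qed.

Let NX_le w k : (k <= 3)%N -> N w ^+ k <= 1 + N w ^+ 3.
Proof.
have N0 := N_ge0 w; have N3 : 0 <= N w ^+ 3 by rewrite exprn_ge0.
case: k => [_|[_|[_|[_|//]]]]; rewrite ?expr0 ?expr1.
- by lra.
- by have := sqr_ge0 (N w - 1); nra.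
- by have := sqr_ge0 (N w - 1); nra.
- by lra.
Qed.

Lemma summable_gaussian_norm k : (k <= 3)%N -> summable_rv P (fun w => N w ^+ k).
Proof.
move=> k3; apply: (@sN _ 1); first exact: measurable_funX.
by move=> w; rewrite mul1r ger0_norm ?exprn_ge0//; exact: NX_le.
Qed.

(** The sigma-algebra of all coordinates but the [i]-th, of which [u w i 0] is independent. *)
Let rest i := g_sigma_algebraType (\bigcup_(j in [set j | j != i]) E j).

Let rest_coord i j : j != i -> measurable_fun [set: rest i] (fun w => u w j 0).
Proof. by move=> ji; exact: (@measurable_generated _ _ _ _ j). Qed.

Let coord_indep i (f : R -> R) (g : Omega -> R) :
  measurable_fun setT f -> measurable_fun [set: rest i] g ->
  summable_rv P (fun w => f (u w i 0)) -> summable_rv P g ->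
  summable_rv P (fun w => f (u w i 0) * g w) /\
  mean P (fun w => f (u w i 0) * g w) = mean P (fun w => f (u w i 0)) * mean P g.
Proof.
move=> mf mg fi gi; have [_ _ indu] := gu.
apply: indep_summable_rvM => //.
apply: (@grouped_indep _ _ _ P _ setT E indu _ _ _ [set i] [set j | j != i]) => //.
- by move=> j _; exact: preimage_system_measurable.
- by move=> j; exact: preimage_systemI.
- by move=> j; exact: preimage_systemT.
- by apply/seteqP; split => j //= [->]; rewrite eqxx.
- apply: (measurableT_comp mf).
  exact: (@measurable_generated _ _ _ _ i).
Qed.

(** Mixed moments are computed from [N = u_i^2 + S_i], whose two terms are independent. *)
Let S i w := \sum_(j < m | j != i) u w j 0 ^+ 2.

Let NS i w : N w = u w i 0 ^+ 2 + S i w.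
Proof.
by rewrite /N /dot (bigD1 i).
Qed.

Let S_ge0 i w : 0 <= S i w.
Proof. by apply: sumr_ge0 => j _; rewrite sqr_ge0. Qed.

Let mS i : measurable_fun [set: rest i] (S i).
Proof.
(* The value [0] at index [i] is never summed; it makes every summand measurable for [rest i]. *)
rewrite (_ : S i = fun w => \sum_(j <- [seq j <- index_enum 'I_m | j != i])
    (if j != i then u w j 0 else 0) ^+ 2).
  apply: measurable_sum => j; apply: measurable_funX.
  by case: (boolP (j != i)) => [/rest_coord//|_]; exact: measurable_cst.
apply/funext => w; rewrite /S big_filter; apply: eq_bigr => j ->//.
Qed.

Let SmT i : measurable_fun setT (S i).
Proof.
rewrite (_ : S i = fun w => N w - u w i 0 ^+ 2).
  by apply: measurable_funB => //; exact: measurable_funX.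
by apply/funext => w; rewrite (NS i) addrAC subrr add0r.
Qed.

Let SX i k : (k <= 3)%N -> summable_rv P (fun w => S i w ^+ k).
Proof.
move=> k3; apply: (@summable_rv_le _ _ _ _ _ (fun w => N w ^+ k)).
- exact: measurable_funX.
- move=> w; rewrite ger0_norm ?exprn_ge0// lerXn2r ?nnegrE//.
  by rewrite (NS i) lerDr sqr_ge0.
- exact: summable_gaussian_norm.
Qed.

Let mean_N : mean P N = n.
Proof.
rewrite /N /dot mean_sum; last first.
  by move=> i; under eq_fun do rewrite -expr2; case: (u2 i).
rewrite (eq_bigr (fun=> 1)) ?sumr_const ?card_ord// => i _.
by rewrite -(u2 i).2; congr mean; apply/funext => w; rewrite expr2.
Qed.

Let mean_S i : mean P (S i) = n - 1.
Proof.
have [s2 m2] := u2 i.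
have : mean P N = mean P (fun w => u w i 0 ^+ 2 + S i w).
  by congr mean; apply/funext => w; exact: NS.
have s1 : summable_rv P (S i) by have := @SX i 1 isT; under eq_fun do rewrite expr1.
by rewrite meanD// mean_N m2 => ->; rewrite addrAC subrr add0r.
Qed.

(** [E u_i^4 + E u_i^2 * E S_i = 3 + (n - 1)]. *)
Let mean_u2N i : summable_rv P (fun w => u w i 0 ^+ 2 * N w) /\
  mean P (fun w => u w i 0 ^+ 2 * N w) = n + 2.
Proof.
have E2 : (fun w => u w i 0 ^+ 2 * N w) =
    (fun w => u w i 0 ^+ 4 + u w i 0 ^+ 2 * S i w).
  by apply/funext => w; rewrite (NS i); ring.
have s1 : summable_rv P (S i) by have := @SX i 1 isT; under eq_fun do rewrite expr1.
have [s m'] := @coord_indep i _ _ (@pow 2) (@mS i) (u2 i).1 s1.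
rewrite E2 meanD//; last by case: (u4 i).
rewrite m' (u2 i).2 (u4 i).2 mean_S; split; last by ring.
by apply: summable_rvD => //; case: (u4 i).
Qed.

Lemma mean_gaussian_norm4 : mean P (fun w => dot (u w) (u w) ^+ 2) = n * (n + 2).
Proof.
have -> : (fun w => dot (u w) (u w) ^+ 2) =
    (fun w => \sum_(i < m) u w i 0 ^+ 2 * N w).
  apply/funext => w; by rewrite -mulr_suml expr2.
rewrite mean_sum; last by move=> i; case: (mean_u2N i).
under eq_bigr => i _ do rewrite (mean_u2N i).2.
by rewrite sumr_const card_ord mulr_natl.
Qed.

(** Expanding [(u_i^2 + S_i)^2], the three terms are [E u_i^6 = 15], [2 * 3 * (n - 1)] and
    [E S_i^2], the last one bounded by [E N^2]. *)
Let mean_u2N2 i : summable_rv P (fun w => u w i 0 ^+ 2 * N w ^+ 2) /\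
  mean P (fun w => u w i 0 ^+ 2 * N w ^+ 2) <= 15 + 6 * (n - 1) + n * (n + 2).
Proof.
have E3 : (fun w => u w i 0 ^+ 2 * N w ^+ 2) = (fun w => u w i 0 ^+ 6 +
    2 * (u w i 0 ^+ 4 * S i w) + u w i 0 ^+ 2 * S i w ^+ 2).
  by apply/funext => w; rewrite (NS i); ring.
have s1 : summable_rv P (S i) by have := @SX i 1 isT; under eq_fun do rewrite expr1.
have [s4 m4] := @coord_indep i _ _ (@pow 4) (@mS i) (u4 i).1 s1.
have [s2 m2] := @coord_indep i _ _ (@pow 2) (measurable_funX 2 (@mS i)) (u2 i).1
  (@SX i 2 isT).
have s6 := (u6 i).1.
have S2 : mean P (fun w => S i w ^+ 2) <= n * (n + 2).
  rewrite -mean_gaussian_norm4; apply: le_mean; [exact: SX|exact: summable_gaussian_norm|].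
  move=> w; have Sle : S i w <= N w by rewrite (NS i) lerDr sqr_ge0.
  by apply: lerXn2r; rewrite ?nnegrE ?dot_ge0 ?S_ge0.
rewrite E3; split; first by do !apply: summable_rvD => //; exact: summable_rvZ.
rewrite !meanD ?meanZ//; last 2 first.
- exact: summable_rvZ.
- by apply: summable_rvD => //; exact: summable_rvZ.
by rewrite m4 m2 (u6 i).2 (u4 i).2 (u2 i).2 mean_S; lra.
Qed.

(** Summing over [i] gives [n * (n^2 + 8 n + 9)]; it is rounded up to a cube of [n + 4], the shape
    in which [sigma_tilde2] will dominate it. *)
Lemma mean_gaussian_norm6 :
  mean P (fun w => dot (u w) (u w) ^+ 3) <= (n + 4) ^+ 3.
Proof.
have -> : (fun w => dot (u w) (u w) ^+ 3) =
    (fun w => \sum_(i < m) u w i 0 ^+ 2 * N w ^+ 2).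
  apply/funext => w; by rewrite -mulr_suml exprS.
rewrite mean_sum; last by move=> i; case: (mean_u2N2 i).
apply: (@le_trans _ _ (\sum_(i < m) (15 + 6 * (n - 1) + n * (n + 2)))).
  by apply: ler_sum => i _; case: (mean_u2N2 i).
rewrite sumr_const card_ord -mulr_natl -/n.
by have : 0 <= n by []; nra.
Qed.

Lemma mean_gaussian_coordM i j : summable_rv P (fun w => u w i 0 * u w j 0) /\
  mean P (fun w => u w i 0 * u w j 0) = (i == j)%:R.
Proof.
have [<-|ij] := eqVneq i j.
  by under eq_fun do rewrite -expr2; case: (u2 i).
have ji : j != i by rewrite eq_sym.
have [s m'] := @coord_indep i id (fun w => u w j 0) (@measurable_id _ _ setT)
  (rest_coord ji) (u1 i).1 (u1 j).1.
by rewrite m' (u1 i).2 mul0r.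
Qed.

(** For [i != j], [u_i u_j N = u_i (u_j S_i) + u_j u_i^3]: each term is a centred coordinate times a
    factor independent of it. *)
Let mean_uuN i j : summable_rv P (fun w => u w i 0 * u w j 0 * N w) /\
  mean P (fun w => u w i 0 * u w j 0 * N w) = (i == j)%:R * (n + 2).
Proof.
have [<-|ij] := eqVneq i j.
  by rewrite mul1r; under eq_fun do rewrite -expr2; exact: mean_u2N.
have ji : j != i by rewrite eq_sym.
have E3 : (fun w => u w i 0 * u w j 0 * N w) =
    (fun w => u w i 0 * (u w j 0 * S i w) + u w j 0 * u w i 0 ^+ 3).
  by apply/funext => w; rewrite (NS i); ring.
have mu3 k : measurable_fun setT (fun w => u w k 0 ^+ 3) by exact: measurable_funX.
have s3 : summable_rv P (fun w => u w i 0 ^+ 3).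
  apply: (@sN _ 1) => // w; rewrite mul1r.
  have Nk := coord_le w i.
  have : `|u w i 0 ^+ 3| ^+ 2 <= (1 + N w ^+ 3) ^+ 2.
    rewrite real_normK ?num_real// -exprM (exprM _ 2 3).
    apply: (@le_trans _ _ (N w ^+ 3)).
      by apply: lerXn2r; rewrite ?nnegrE ?sqr_ge0 ?N_ge0.
    have : 0 <= N w ^+ 3 by rewrite exprn_ge0.
    by nra.
  by rewrite ler_pXn2r// nnegrE// addr_ge0// exprn_ge0.
have sS : summable_rv P (fun w => u w j 0 * S i w).
  apply: (@sN _ 1); first exact: measurable_funM.
  move=> w; rewrite mul1r.
  have Nk := coord_le w j; have := NX_le w (isT : (2 <= 3)%N).
  have SN : S i w <= N w by rewrite (NS i) lerDr sqr_ge0.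
  have := N_ge0 w; have := S_ge0 i w.
  rewrite normrM (ger0_norm (S_ge0 _ _)) => S0 N0 N2.
  have : `|u w j 0| ^+ 2 <= N w by rewrite real_normK ?num_real.
  have := normr_ge0 (u w j 0); move: `|_| => a a0 aN.
  have aS : a * S i w <= a * N w by rewrite ler_wpM2l.
  apply: le_trans aS _.
  have : N w <= 1 + N w ^+ 3 by have := NX_le w (isT : (1 <= 3)%N); rewrite expr1.
  have [a1|a1] := leP a 1; first by nra.
  move=> N1; have : 1 <= N w by nra.
  by have := mulr_ge0 N0 (mulr_ge0 N0 N0); rewrite exprS expr2; nra.
have [s1 m1] := @coord_indep i id (fun w => u w j 0 * S i w) (@measurable_id _ _ setT)
  (measurable_funM (rest_coord ji) (@mS i)) (u1 i).1 sS.
have [s2 m2] := @coord_indep j id (fun w => u w i 0 ^+ 3) (@measurable_id _ _ setT)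
  (measurable_funX 3 (rest_coord ij)) (u1 j).1 s3.
rewrite E3; split; first exact: summable_rvD.
by rewrite meanD// m1 m2 (u1 i).2 (u1 j).2 !mul0r addr0.
Qed.

(** Expand the square into products of coordinates; the diagonal matrix of weighted second moments
    leaves a multiple of [dot a a]. The weight [v] will be [1] or the square norm. *)
Let quad (a : 'cV[R]_m) (v : Omega -> R) (c : R) :
  (forall i j, summable_rv P (fun w => u w i 0 * u w j 0 * v w) /\
    mean P (fun w => u w i 0 * u w j 0 * v w) = (i == j)%:R * c) ->
  summable_rv P (fun w => dot a (u w) ^+ 2 * v w) /\
  mean P (fun w => dot a (u w) ^+ 2 * v w) = c * dot a a.
Proof.
move=> h.
have -> : (fun w => dot a (u w) ^+ 2 * v w) = (fun w =>
    \sum_(i < m) \sum_(j < m) (a i 0 * a j 0) * (u w i 0 * u w j 0 * v w)).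
  apply/funext => w; rewrite expr2 /dot mulr_suml mulr_suml.
  apply: eq_bigr => i _; rewrite mulr_sumr mulr_suml; apply: eq_bigr => j _.
  by ring.
have hs i j : summable_rv P (fun w => (a i 0 * a j 0) * (u w i 0 * u w j 0 * v w)).
  by apply: summable_rvZ; case: (h i j).
have hs' i : summable_rv P (fun w =>
    \sum_(j < m) (a i 0 * a j 0) * (u w i 0 * u w j 0 * v w)).
  exact: summable_rv_sum.
split; first exact: summable_rv_sum.
rewrite mean_sum// /dot mulr_sumr; apply: eq_bigr => i _.
rewrite mean_sum// (bigD1 i)//= big1 => [|j ji].
  by rewrite meanZ ?(h i i).2 ?eqxx ?mul1r ?addr0; [ring|case: (h i i)].
rewrite meanZ ?(h i j).2; last by case: (h i j).
by rewrite eq_sym (negbTE ji) mul0r mulr0.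
Qed.

Lemma mean_gaussian_dot2 (a : 'cV[R]_m) :
  summable_rv P (fun w => dot a (u w) ^+ 2) /\
  mean P (fun w => dot a (u w) ^+ 2) = dot a a.
Proof.
have [|s m'] := @quad a (fun=> 1) 1.
  by move=> i j; rewrite mulr1; under eq_fun do rewrite mulr1;
    exact: mean_gaussian_coordM.
by move: s m'; under eq_fun do rewrite mulr1; rewrite mul1r.
Qed.

Lemma mean_gaussian_dot2_norm2 (a : 'cV[R]_m) :
  summable_rv P (fun w => dot a (u w) ^+ 2 * dot (u w) (u w)) /\
  mean P (fun w => dot a (u w) ^+ 2 * dot (u w) (u w)) = (n + 2) * dot a a.
Proof. by apply: quad => i j; exact: mean_uuN. Qed.

End GaussianVector.

(** * Stochastic and zeroth-order gradients *)

Section NullSets.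
Variables (d : measure_display) (T : measurableType d) (R : realType).
Variables (mu : {measure set T -> \bar R}) (N : set T).
Hypotheses (mN : measurable N) (N0 : mu N = 0%E).

Import HBNNSimple.

(** A simple function below [f], multiplied by the indicator of the complement of [N], lies below
    [g] and keeps its integral. *)
Let ge0_le_off_null (f g : T -> \bar R) :
  (forall x, (0 <= f x)%E) -> (forall x, (0 <= g x)%E) ->
  (forall x, ~ N x -> f x = g x) -> (\int[mu]_x f x <= \int[mu]_x g x)%E.
Proof.
move=> f0 g0 fg; rewrite ge0_integralTE// [leRHS]ge0_integralTE//.
apply: ge_ereal_sup => _ [h /= hf <-].
pose h' := proj_nnsfun h (measurableC mN).
apply: ereal_sup_ubound; exists h' => /=.
  move=> x; rewrite mindicE; have [xN|xN] := boolP (x \in ~` N).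
    by rewrite mulr1 -fg//; move: xN; rewrite inE.
  by rewrite mulr0.
rewrite -!integralT_nnsfun; apply: ge0_ae_eq_integral => //.
- by apply/measurable_EFinP.
- by apply/measurable_EFinP.
- by move=> x _; rewrite lee_fin.
- by move=> x _; rewrite lee_fin.
exists N; split => // x /=; apply: contra_notP => Nx _.
by rewrite mindicE mem_set// mulr1.
Qed.

(* No measurability of [f] or [g]: the integral is a supremum over simple
   functions. *)
Lemma eq_integral_off_null (f g : T -> \bar R) :
  (forall x, ~ N x -> f x = g x) -> (\int[mu]_x f x = \int[mu]_x g x)%E.
Proof.
have ge0_eq (f1 g1 : T -> \bar R) : (forall x, (0 <= f1 x)%E) -> (forall x, (0 <= g1 x)%E) ->
    (forall x, ~ N x -> f1 x = g1 x) -> (\int[mu]_x f1 x = \int[mu]_x g1 x)%E.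
  move=> f0 g0 fg; apply/eqP; rewrite eq_le !ge0_le_off_null//.
  by move=> x /fg.
move=> fg; rewrite integralE [RHS]integralE; congr (_ - _)%E; apply: ge0_eq => //.
- by move=> x /fg fgx; rewrite unlock fgx.
- by move=> x /fg fgx; rewrite unlock fgx.
Qed.

End NullSets.

Lemma mean_of_integral d (T : measurableType d) (R : realType)
    (P : probability T R) (f : T -> R) (c : R) :
  measurable_fun setT f -> (\int[P]_x (f x)%:E = c%:E)%E ->
  summable_rv P f /\ mean P f = c.
Proof.
move=> mf fc; split; last by rewrite /mean /Rintegral fc.
have mf' : measurable_fun setT (EFin \o f) by exact/measurable_EFinP.
apply/integrableP; split => //.
by rewrite integral_fin_num_abs// fc.
Qed.

(** Transfers a known expectation from a function that may fail to be measurable to a measurable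
    version of it. *)
Lemma expectation_off_null d (T : measurableType d) (R : realType)
    (P : probability T R) (N : set T) (f g : T -> R) (c : R) :
  measurable N -> P N = 0%E -> (forall x, ~ N x -> f x = g x) ->
  measurable_fun setT g -> ('E_P[f] = c%:E)%E -> summable_rv P g /\ mean P g = c.
Proof.
move=> mN N0 fg mg; rewrite unlock => fc; apply: mean_of_integral => //.
by rewrite -fc; apply: (eq_integral_off_null mN N0) => x /fg ->.
Qed.

Section StochasticGradient.
Variables (R : realType) (m : nat).
Variables (dXi : measure_display) (Xi : measurableType dXi) (Pxi : probability Xi R).
Variables (F : 'cV[R]_m -> Xi -> R) (f : 'cV[R]_m -> R).
Hypothesis mF : measurable_fun [set: borel_cV R m * Xi] (fun z => F z.1 z.2).
Variable N : set Xi.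
Hypotheses (mN : measurable N) (N0 : Pxi N = 0%E).
Hypothesis dF : forall z, ~ N z -> forall x, differentiable (F^~ z) x.

(** A measurable version of the stochastic gradient: off [N] it is a limit of difference quotients,
    and on [N], where differentiability is unknown, it is set to [0]. *)
Definition sgrad x z : 'cV[R]_m := if z \in N then 0 else grad (F^~ z) x.

Lemma measurable_section (y : 'cV[R]_m) : measurable_fun setT (F y).
Proof.
have my : measurable_fun setT (fun z : Xi => (y : borel_cV R m, z)).
  by apply: measurable_fun_pair.
exact: (measurableT_comp mF my).
Qed.

Lemma sgradE x z : ~ N z -> sgrad x z = grad (F^~ z) x.
Proof. by move=> Nz; rewrite /sgrad memNset. Qed.

Lemma measurable_sgrad x : measurable_fun setT (sgrad x : Xi -> borel_cV R m).
Proof.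
apply: measurable_fun_cV => i.
apply: (@measurable_fun_cvg _ Xi R setT (fun n z => \1_(~` N) z *
  (n.+1%:R * (F (x + n.+1%:R^-1 *: delta_mx i 0) z - F x z)))).
  move=> n; apply: measurable_funM; first exact/measurable_indic/measurableC.
  apply: measurable_funM => //; apply: measurable_funB; exact: measurable_section.
move=> z _; have [zN|zN] := boolP (z \in N).
  rewrite /sgrad zN mxE.
  under eq_fun do rewrite indicE in_setC zN mul0r.
  exact: cvg_cst.
have Nz : ~ N z by move=> Nz; move: zN; rewrite mem_set.
under eq_fun do rewrite indicE in_setC zN mul1r.
rewrite sgradE//.
have -> : grad (F^~ z) x i 0 = dot (grad (F^~ z) x) (delta_mx i 0).
  by rewrite -derive_grad ?mxE//; exact: dF.
by apply: (@cvg_diff_quotient _ _ (F^~ z)); exact: dF.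
Qed.

Variables (X : set 'cV[R]_m) (sigma M : R).
Hypotheses (A1 : assumption1 Pxi F f X sigma) (A3 : assumption3 f X M).

Lemma mean_section x : summable_rv Pxi (F x) /\ mean Pxi (F x) = f x.
Proof.
have [Ef _ _ _] := A1; apply: mean_of_integral; first exact: measurable_section.
by have := Ef x; rewrite unlock.
Qed.

Lemma mean_sgrad x i : summable_rv Pxi (fun z => sgrad x z i 0) /\
  mean Pxi (fun z => sgrad x z i 0) = grad f x i 0.
Proof.
have [_ _ Eg _] := A1.
apply: (@expectation_off_null _ _ _ _ N (fun z => grad (F^~ z) x i 0)) => //.
- by move=> z /sgradE ->.
- exact/measurable_coord_comp/measurable_sgrad.
Qed.

Lemma mean_dot_sgrad x v : summable_rv Pxi (fun z => dot (sgrad x z) v) /\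
  mean Pxi (fun z => dot (sgrad x z) v) = dot (grad f x) v.
Proof.
have h i : summable_rv Pxi (fun z => sgrad x z i 0 * v i 0).
  by under eq_fun do rewrite mulrC; apply: summable_rvZ; case: (mean_sgrad x i).
split; first exact: summable_rv_sum.
rewrite mean_sum//; apply: eq_bigr => i _; under eq_fun do rewrite mulrC.
by have [s <-] := mean_sgrad x i; rewrite meanZ// mulrC.
Qed.

(** Bias-variance decomposition around [grad f x]: the variance is at most [sigma^2] and the square
    norm of the mean at most [M^2]. *)
Lemma mean_sgrad2 x : X x -> summable_rv Pxi (fun z => dot (sgrad x z) (sgrad x z)) /\
  mean Pxi (fun z => dot (sgrad x z) (sgrad x z)) <= M ^+ 2 + sigma ^+ 2.
Proof.
move=> Xx; have [_ _ _ Ev] := A1.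
have msg := measurable_sgrad x.
pose D z := sgrad x z - grad f x.
have mD : measurable_fun setT (fun z => dot (D z) (D z)).
  have mD : measurable_fun setT (D : Xi -> borel_cV R m).
    by apply: measurable_cVB => //; exact: measurable_cst.
  exact: measurable_dot.
have leD : (\int[Pxi]_z (dot (D z) (D z))%:E <= (sigma ^+ 2)%:E)%E.
  have := Ev x Xx; rewrite unlock; apply: le_trans.
  rewrite le_eqVlt; apply/orP; left; apply/eqP.
  by apply: (eq_integral_off_null mN N0) => z /sgradE Dz; rewrite sqr_enorm /D Dz.
have sD : summable_rv Pxi (fun z => dot (D z) (D z)).
  apply/integrableP; split; first exact/measurable_EFinP.
  under eq_integral do rewrite /= ger0_norm ?dot_ge0//.
  by rewrite (le_lt_trans leD)// ltry.
have mDle : mean Pxi (fun z => dot (D z) (D z)) <= sigma ^+ 2.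
  by rewrite -lee_fin EFin_mean.
have [sg mg] := mean_dot_sgrad x (grad f x).
have E : (fun z => dot (sgrad x z) (sgrad x z)) = (fun z => dot (D z) (D z) +
    (2 * dot (sgrad x z) (grad f x) - dot (grad f x) (grad f x))).
  apply/funext => z; rewrite /D !(dotBl, dotBr) (dotC (grad f x) (sgrad x z)).
  by ring.
have s2 : summable_rv Pxi (fun z => 2 * dot (sgrad x z) (grad f x) - dot (grad f x) (grad f x)).
  by apply: summable_rvB; [exact: summable_rvZ|exact: summable_rv_cst].
rewrite E; split; first exact: summable_rvD.
rewrite meanD// meanB ?meanZ ?mean_cst ?mg//; last 2 first.
- exact: summable_rvZ.
- exact: summable_rv_cst.
have gM : dot (grad f x) (grad f x) <= M ^+ 2.
  rewrite -sqr_enorm lerXn2r ?nnegrE ?enorm_ge0 ?A3//.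
  exact: le_trans (enorm_ge0 _) (A3 Xx).
by lra.
Qed.

(* Taking expectations in the descent inequality of [F(., xi)] avoids having to
   differentiate under the integral sign. *)
Lemma mean_descent x v (C : R) :
  (forall z, ~ N z -> forall t : R, 0 <= t ->
    dot (grad (F^~ z) (x + t *: v) - grad (F^~ z) x) v <= t * C) ->
  f (x + v) <= f x + dot (grad f x) v + C / 2.
Proof.
move=> hC.
have [s1 <-] := mean_section (x + v); have [s2 <-] := mean_section x.
have [s3 <-] := mean_dot_sgrad x v.
rewrite -(mean_cst Pxi (C / 2)) -meanD// -meanD//; last 2 first.
- exact: summable_rvD.
- exact: summable_rv_cst.
apply: ae_le_mean => //.
  by apply: summable_rvD; [exact: summable_rvD|exact: summable_rv_cst].
exists N; split => // z /=; apply: contra_notP => Nz.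
rewrite sgradE//; apply: (@descent_le _ _ (F^~ z)); first exact: dF.
exact: hC.
Qed.

End StochasticGradient.

(** Cut [f] to [0] where the bound fails: the result is dominated everywhere and almost surely equal
    to [f]. *)
Lemma ae_summable_rv_le d (T : measurableType d) (R : realType)
    (P : probability T R) (f g : T -> R) : measurable_fun setT f ->
  {ae P, forall w, `|f w| <= g w} -> summable_rv P g -> summable_rv P f.
Proof.
move=> mf fg gi.
have gi' : summable_rv P (fun w => `|g w|) by exact: integrable_norm.
have mg : measurable_fun setT g by exact: summable_rv_measurable gi.
pose h w := if `|f w| <= `|g w| then f w else 0.
have mb : measurable_fun setT (fun w => `|f w| <= `|g w|).
  by apply: measurable_fun_ler; apply: measurableT_comp.
have mh : measurable_fun setT h by apply: measurable_fun_ifT.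
have hi : summable_rv P h.
  apply: summable_rv_le gi' => // w.
  by rewrite /h; case: ifP => // _; rewrite normr0.
apply: ae_summable_rv mf hi; apply: filterS fg => w fgw.
by rewrite /h ifT// (le_trans fgw)// ler_norm.
Qed.

Lemma summable_rv_law d (Omega : measurableType d) (R : realType)
    (P : probability Omega R) d' (T : measurableType d') (X : Omega -> T)
    (Q : probability T R) (mX : measurable_fun setT X) :
  (forall A, measurable A -> P (X @^-1` A) = Q A) ->
  forall f : T -> R, summable_rv Q f ->
  summable_rv P (f \o X) /\ mean P (f \o X) = mean Q f.
Proof.
move=> XQ f fi; have mf := summable_rv_measurable fi.
have law := ge0_integral_law mX XQ.
have mf' : measurable_fun setT (EFin \o f) by exact/measurable_EFinP.
split.
  apply/integrableP; split.
    by apply/measurable_EFinP; exact: measurableT_comp.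
  have /integrableP[_] := fi.
  by rewrite -(law (fun x => `|(f x)%:E|%E))//; exact: measurableT_comp.
rewrite /mean /Rintegral; congr fine; rewrite integralE [RHS]integralE.
rewrite -(law (EFin \o f)^\+%E)//; last exact: measurable_funepos.
rewrite -(law (EFin \o f)^\-%E)//; last exact: measurable_funeneg.
by congr (_ - _)%E; apply: eq_integral => x _; rewrite unlock.
Qed.

(** * A single zeroth-order sample *)

Section ZerothOrderSample.
Variables (R : realType) (m : nat).
Variables (dXi : measure_display) (Xi : measurableType dXi) (Pxi : probability Xi R).
Variables (F : 'cV[R]_m -> Xi -> R) (f : 'cV[R]_m -> R).
Hypothesis mF : measurable_fun [set: borel_cV R m * Xi] (fun z => F z.1 z.2).
Variable N : set Xi.
Hypotheses (mN : measurable N) (N0 : Pxi N = 0%E).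
Hypothesis dF : forall z, ~ N z -> forall x, differentiable (F^~ z) x.
Variable Lf : R.
Hypothesis Lf0 : 0 < Lf.
Hypothesis LF : forall z, ~ N z -> forall x y,
  enorm (grad (F^~ z) x - grad (F^~ z) y) <= Lf * enorm (x - y).
Variables (X : set 'cV[R]_m) (sigma M : R).
Hypotheses (A1 : assumption1 Pxi F f X sigma) (A3 : assumption3 f X M).
Variables (mu : R) (x : 'cV[R]_m).
Hypotheses (mu0 : 0 < mu) (Xx : X x).

Variables (d : measure_display) (Omega : measurableType d) (P : probability Omega R).
Variables (xi : Omega -> Xi) (u : Omega -> 'cV[R]_m).
Hypothesis mxi : measurable_fun setT xi.
Hypothesis lawxi : forall B, measurable B -> P (xi @^-1` B) = Pxi B.
Hypothesis gu : std_gaussian P u.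
Hypothesis xiu : indep_systems P (preimage_set_system setT xi measurable)
  (preimage_set_system setT (u : Omega -> borel_cV R m) measurable).

Let n : R := m%:R.
Let G w := zo_grad F mu x (xi w) (u w).
Let D w := sgrad F N x (xi w).
Let S w := dot (u w) (u w).
(** Error of the finite difference against the directional derivative along [u]. It splits the
    estimator as [G = (rho + dot D u) *: u]. *)
Let rho w := (F (x + mu *: u w) (xi w) - F x (xi w)) / mu - dot (D w) (u w).

Let mu_ : measurable_fun [set: Omega] (u : Omega -> borel_cV R m).
Proof. by case: gu. Qed.

Let mD : measurable_fun [set: Omega] (D : Omega -> borel_cV R m).
Proof. by apply: measurableT_comp mxi; exact: measurable_sgrad. Qed.

Let mquot : measurable_fun setT
  (fun w => (F (x + mu *: u w) (xi w) - F x (xi w)) / mu).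
Proof.
apply: measurable_funM => //; apply: measurable_funB; last first.
  by apply: measurableT_comp mxi; exact: measurable_section.
have mp : measurable_fun setT
    (fun w => ((x + mu *: u w) : borel_cV R m, xi w)).
  apply: measurable_fun_pair => //.
  apply: (@measurable_cVD R _ _ m (fun=> x)); first exact: measurable_cst.
  by apply: (@measurable_cVZ R _ _ m (fun=> mu)).
exact: (measurableT_comp mF mp).
Qed.

Lemma measurable_zo_grad : measurable_fun [set: Omega] (G : Omega -> borel_cV R m).
Proof. exact: measurable_cVZ. Qed.

Let mrho : measurable_fun setT rho.
Proof. by apply: measurable_funB => //; exact: measurable_dot. Qed.

Let mS : measurable_fun setT S. Proof. exact: measurable_dot. Qed.

Let good : {ae P, forall w, ~ N (xi w)}.
Proof.
exists (xi @^-1` N); split.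
- by rewrite -[X in measurable X]setTI; exact: mxi.
- by rewrite lawxi.
- by move=> w /= /contrapT.
Qed.

Let rho_le w : ~ N (xi w) -> `|rho w| <= Lf * mu / 2 * S w.
Proof.
move=> Nw; have S0 : 0 <= S w by exact: dot_ge0.
(* [s] is a sign: the descent inequality for [F] and for [- F] along [mu *: u w] bounds the error
   from both sides. *)
have key (s : R) : s ^+ 2 = 1 ->
    s * (F (x + mu *: u w) (xi w) - F x (xi w) - mu * dot (D w) (u w))
      <= Lf * mu ^+ 2 / 2 * S w.
  move=> s1.
  have := @descent_le _ _ (fun y => s * F y (xi w)) x (mu *: u w) (Lf * mu ^+ 2 * S w).
  have dsF y : differentiable (fun y => s * F y (xi w)) y.
    by apply: differentiableM => //; exact: dF.
  have gsF y : grad (fun y => s * F y (xi w)) y = s *: grad (F^~ (xi w)) y.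
    apply/matrixP => i j; rewrite ord1 !mxE.
    by rewrite deriveZ//; exact/diff_derivable/dF.
  move=> /(_ dsF) h; have {}h := h _.
  have : forall t : R, 0 <= t -> dot (grad (fun y => s * F y (xi w)) (x + t *: (mu *: u w)) -
      grad (fun y => s * F y (xi w)) x) (mu *: u w) <= t * (Lf * mu ^+ 2 * S w).
    move=> t t0; rewrite !gsF -scalerBr dotZl -dotZr.
    apply: le_trans (cauchy_schwarz _ _) _.
    have := LF Nw (x + t *: (mu *: u w)) x.
    have -> : x + t *: (mu *: u w) - x = (t * mu) *: u w.
      by rewrite addrAC subrr add0r scalerA.
    have -> : enorm (s *: (mu *: u w)) = mu * enorm (u w).
      rewrite !enormZ (gtr0_norm mu0); suff -> : `|s| = 1 by rewrite mul1r.
      by apply/eqP; rewrite -sqrp_eq1 ?real_normK ?num_real ?s1.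
    rewrite enormZ ger0_norm; last by rewrite mulr_ge0// ltW.
    move=> g_le; have u0 := enorm_ge0 (u w).
    have -> : t * (Lf * mu ^+ 2 * S w) = Lf * (t * mu * enorm (u w)) * (mu * enorm (u w)).
      by rewrite /S -sqr_enorm; ring.
    by rewrite ler_wpM2r// mulr_ge0// ltW.
  move=> /h; rewrite gsF dotZl dotZr /D sgradE//; lra.
have rhoE : rho w = mu^-1 * (F (x + mu *: u w) (xi w) - F x (xi w) - mu * dot (D w) (u w)).
  by rewrite /rho; field; rewrite gt_eqF.
have k1 := key 1 (expr1n _ _).
have k2 : _ := key (-1); rewrite sqrrN expr1n in k2; have {}k2 := k2 erefl.
rewrite rhoE normrM gtr0_norm ?invr_gt0// mulrC ler_pdivrMr//.
by rewrite ler_norml; apply/andP; split; lra.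
Qed.

Let GE w : G w = (rho w + dot (D w) (u w)) *: u w.
Proof. by rewrite /G /zo_grad /rho subrK. Qed.

(** Decoupling freezes the stochastic gradient while [u] is integrated, which produces
    [(n + 2) * dot D D]; [mean_sgrad2] then bounds the outer mean. *)
Let second_D : summable_rv P (fun w => dot (D w) (u w) ^+ 2 * S w) /\
  mean P (fun w => dot (D w) (u w) ^+ 2 * S w) <= (n + 2) * (M ^+ 2 + sigma ^+ 2).
Proof.
have [sD mD2] := mean_sgrad2 mF mN N0 dF A1 A3 Xx.
pose h (z : Xi * borel_cV R m) : \bar R :=
  ((dot (sgrad F N x z.1) z.2 ^+ 2 * dot (z.2 : 'cV[R]_m) z.2)%R)%:E.
have mh : measurable_fun setT h.
  have m2 : measurable_fun [set: Xi * borel_cV R m] (fun z => z.2).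
    exact: measurable_snd.
  apply/measurable_EFinP; apply: measurable_funM; last exact: measurable_dot.
  apply: measurable_funX; apply: measurable_dot => //.
  by apply: (measurableT_comp (measurable_sgrad mF mN dF x)); exact: measurable_fst.
have h0 z : (0 <= h z)%E by rewrite lee_fin mulr_ge0 ?sqr_ge0 ?dot_ge0.
have E : (\int[P]_w (dot (D w) (u w) ^+ 2 * S w)%:E =
    ((n + 2) * mean Pxi (fun z => dot (sgrad F N x z) (sgrad F N x z)))%:E)%E.
  have -> := decoupling mxi mu_ xiu mh h0.
  have [sDx mDx] := summable_rv_law mxi lawxi sD.
  rewrite -mDx EFinM EFin_mean// -integralZl//; apply: eq_integral => w _.
  have [s2 m2] := mean_gaussian_dot2_norm2 gu (D w).
  by rewrite /h /= -EFinM -m2 EFin_mean.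
split; last first.
  rewrite /mean /Rintegral E /= ler_wpM2l//.
  by rewrite addr_ge0.
apply/integrableP; split.
  apply/measurable_EFinP; apply: measurable_funM => //.
  by apply: measurable_funX; exact: measurable_dot.
have pos w : 0 <= dot (D w) (u w) ^+ 2 * S w.
  by rewrite mulr_ge0 ?sqr_ge0// dot_ge0.
by under eq_integral do rewrite /= ger0_norm//; rewrite E ltry.
Qed.

(** From [(rho + dot D u)^2 <= 2 rho^2 + 2 (dot D u)^2], weighted by the square norm of [u]: the
    first summand comes from [second_D], the second from [rho_le] and the sixth Gaussian moment. *)
Definition zo_second_moment : R :=
  2 * ((n + 2) * (M ^+ 2 + sigma ^+ 2)) + mu ^+ 2 * Lf ^+ 2 / 2 * (n + 4) ^+ 3.

Lemma zo_grad_second_moment : summable_rv P (fun w => dot (G w) (G w)) /\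
  mean P (fun w => dot (G w) (G w)) <= zo_second_moment.
Proof.
have [sD mD2] := second_D.
have s6 := summable_gaussian_norm6 gu; have m6 := mean_gaussian_norm6 gu.
pose g w := 2 * (dot (D w) (u w) ^+ 2 * S w) + mu ^+ 2 * Lf ^+ 2 / 2 * S w ^+ 3.
have sg : summable_rv P g by apply: summable_rvD; exact: summable_rvZ.
have mg : mean P g <= zo_second_moment.
  rewrite /g meanD; [|exact: summable_rvZ|exact: summable_rvZ].
  rewrite !meanZ// lerD// ?ler_wpM2l//.
  by rewrite divr_ge0// mulr_ge0// sqr_ge0.
have Gg : {ae P, forall w, dot (G w) (G w) <= g w}.
  apply: filterS good => w Nw; rewrite GE dotZl dotZr mulrA -expr2 /g -/(S w).
  have S0 : 0 <= S w by exact: dot_ge0.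
  have r2 : rho w ^+ 2 <= (Lf * mu / 2 * S w) ^+ 2.
    rewrite -(real_normK (num_real (rho w))); apply: lerXn2r.
    - by rewrite nnegrE.
    - by rewrite nnegrE mulr_ge0// mulr_ge0// mulr_ge0// ltW.
    - exact: rho_le.
  have {}r2 : rho w ^+ 2 * S w <= (Lf * mu / 2 * S w) ^+ 2 * S w by rewrite ler_wpM2r.
  have : (rho w + dot (D w) (u w)) ^+ 2 * S w <=
      (2 * rho w ^+ 2 + 2 * dot (D w) (u w) ^+ 2) * S w.
    rewrite ler_wpM2r//; have := sqr_ge0 (rho w - dot (D w) (u w)); lra.
  lra.
have mGG : measurable_fun setT (fun w => dot (G w) (G w)).
  by apply: measurable_dot; exact: measurable_zo_grad.
have sG : summable_rv P (fun w => dot (G w) (G w)).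
  apply: ae_summable_rv_le sg => //; apply: filterS Gg => w.
  by rewrite ger0_norm ?dot_ge0.
by split => //; apply: le_trans mg; exact: ae_le_mean.
Qed.

Lemma zo_grad_square_summable i : square_summable_rv P (fun w => G w i 0).
Proof.
have mGi := measurable_coord_comp i measurable_zo_grad.
split => //; apply: summable_rv_le zo_grad_second_moment.1.
  exact: measurable_funX.
by move=> w; rewrite ger0_norm ?sqr_ge0//; exact: sqr_coord_le_dot.
Qed.

(** The linear part of the estimator is unbiased: [xi] and [u] are independent, and the identity
    covariance of [u] selects the [i]-th partial derivative. *)
Let mean_Du i : summable_rv P (fun w => dot (D w) (u w) * u w i 0) /\
  mean P (fun w => dot (D w) (u w) * u w i 0) = grad f x i 0.
Proof.
have E : (fun w => dot (D w) (u w) * u w i 0) =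
    (fun w => \sum_(j < m) D w j 0 * (u w j 0 * u w i 0)).
  by apply/funext => w; rewrite mulr_suml; apply: eq_bigr => j _; rewrite mulrA.
have h j : summable_rv P (fun w => D w j 0 * (u w j 0 * u w i 0)) /\
    mean P (fun w => D w j 0 * (u w j 0 * u w i 0)) = grad f x j 0 * (j == i)%:R.
  have [sg <-] := mean_sgrad mF mN N0 dF A1 x j.
  have [sgx <-] := summable_rv_law mxi lawxi sg.
  have [su <-] := mean_gaussian_coordM gu j i.
  apply: indep_summable_rvM => //; apply: indep_systemsS xiu.
  - apply: (@preimage_system_comp _ _ _ Xi xi _ _ (fun z => sgrad F N x z j 0)).
    exact: measurable_coord_comp (measurable_sgrad mF mN dF x).
  - apply: (@preimage_system_comp _ _ _ (borel_cV R m) u _ _ (fun v => v j 0 * v i 0)).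
    by apply: measurable_funM; exact: measurable_coord.
rewrite E; split; first by apply: summable_rv_sum => j; case: (h j).
rewrite mean_sum; last by move=> j; case: (h j).
rewrite (bigD1 i)//= (h i).2 eqxx mulr1 big1 ?addr0// => j ji.
by rewrite (h j).2 (negbTE ji) mulr0.
Qed.

Definition zo_bias : 'cV[R]_m :=
  \col_i (mean P (fun w => G w i 0) - grad f x i 0).

(* The bias is [E (rho u)]; pairing it with itself and using
   [2 rho <beta, u> <= rho^2 + <beta, u>^2] gives [|beta|^2 <= E rho^2]. *)
Lemma zo_bias_le :
  dot zo_bias zo_bias <= mu ^+ 2 * Lf ^+ 2 / 4 * (n * (n + 2)).
Proof.
pose q i w := G w i 0 - dot (D w) (u w) * u w i 0.
have sG i := square_summable_rvW (zo_grad_square_summable i).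
have sq i : summable_rv P (q i).
  by apply: summable_rvB; [exact: sG|case: (mean_Du i)].
have mq i : mean P (q i) = zo_bias i 0.
  by rewrite /q meanB ?(mean_Du i).2 ?mxE//; case: (mean_Du i).
have qE w i : q i w = rho w * u w i 0 by rewrite /q GE mxE mulrDl addrK.
have sb : summable_rv P (fun w => \sum_(i < m) zo_bias i 0 * q i w).
  by apply: summable_rv_sum => i; exact: summable_rvZ.
have sbu := mean_gaussian_dot2 gu zo_bias.
have bb : dot zo_bias zo_bias = mean P (fun w => \sum_(i < m) zo_bias i 0 * q i w).
  rewrite mean_sum; last by move=> i; exact: summable_rvZ.
  by apply: eq_bigr => i _; rewrite meanZ// mq.
have s4 := summable_gaussian_norm gu (isT : (2 <= 3)%N).
pose k := mu ^+ 2 * Lf ^+ 2 / 4.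
have : mean P (fun w => \sum_(i < m) zo_bias i 0 * q i w) <=
    mean P (fun w => 2^-1 * (k * S w ^+ 2) + 2^-1 * dot zo_bias (u w) ^+ 2).
  apply: ae_le_mean => //.
    by apply: summable_rvD; apply: summable_rvZ; [exact: summable_rvZ|case: sbu].
  apply: filterS good => w Nw.
  have -> : \sum_(i < m) zo_bias i 0 * q i w = rho w * dot zo_bias (u w).
    by rewrite /dot mulr_sumr; apply: eq_bigr => i _; rewrite qE mulrCA.
  have S0 : 0 <= S w by exact: dot_ge0.
  have r2 : rho w ^+ 2 <= (Lf * mu / 2 * S w) ^+ 2.
    rewrite -(real_normK (num_real (rho w))); apply: lerXn2r.
    - by rewrite nnegrE.
    - by rewrite nnegrE mulr_ge0// mulr_ge0// mulr_ge0// ltW.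
    - exact: rho_le.
  have := sqr_ge0 (rho w - dot zo_bias (u w)); rewrite /k; lra.
have sk : summable_rv P (fun w => k * S w ^+ 2) by exact: summable_rvZ.
have sk2 : summable_rv P (fun w => 2^-1 * (k * S w ^+ 2)) by exact: summable_rvZ.
have sd : summable_rv P (fun w => 2^-1 * dot zo_bias (u w) ^+ 2).
  by apply: summable_rvZ; case: sbu.
rewrite meanD// (meanZ _ sk) (meanZ _ s4) (meanZ _ sbu.1) sbu.2 -bb.
by rewrite mean_gaussian_norm4// -/n /k; lra.
Qed.

End ZerothOrderSample.

(** * Averages over a minibatch of biased samples *)

Section MiniBatch.
Variables (R : realType) (m B : nat).
Variables (d : measure_display) (Omega : measurableType d) (P : probability Omega R).
Variables (G : 'I_B -> Omega -> 'cV[R]_m) (v : 'cV[R]_m) (V b2 : R).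
Hypothesis B0 : (0 < B)%N.
Hypothesis G2 : forall t i, square_summable_rv P (fun w => G t w i 0).
Hypothesis indG : forall s t i, s != t ->
  indep_systems P (preimage_set_system setT (fun w => G s w i 0) measurable)
    (preimage_set_system setT (fun w => G t w i 0) measurable).
Hypothesis GV : forall t, mean P (fun w => dot (G t w) (G t w)) <= V.

Let beta t : 'cV[R]_m := \col_i (mean P (fun w => G t w i 0) - v i 0).
Hypothesis betab : forall t, dot (beta t) (beta t) <= b2.

Let delta w := B%:R^-1 *: (\sum_(t < B) G t w) - v.
Let e t w := G t w - v.

Let B1 : B%:R != 0 :> R. Proof. by rewrite pnatr_eq0 -lt0n. Qed.

Let deltaE w : delta w = B%:R^-1 *: \sum_(t < B) e t w.
Proof.
rewrite /delta /e sumrB sumr_const card_ord -[v *+ B]scaler_nat scalerBr scalerA.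
by rewrite mulVf// scale1r.
Qed.

Let e2 t i : square_summable_rv P (fun w => e t w i 0).
Proof.
under eq_fun do rewrite !mxE.
by apply: square_summable_rvB => //; exact: square_summable_rv_cst.
Qed.

Let mean_e t i : mean P (fun w => e t w i 0) = beta t i 0.
Proof.
under eq_fun do rewrite !mxE.
rewrite meanB ?mean_cst ?mxE//; [exact: square_summable_rvW|exact: summable_rv_cst].
Qed.

Let ee s t : summable_rv P (fun w => dot (e s w) (e t w)).
Proof. by apply: summable_rv_sum => i; exact: square_summable_rvM. Qed.

(** By independence a cross term is the inner product of two biases; it does not vanish, but is at
    most half the sum of their square norms. *)
Let mean_ee s t : s != t -> mean P (fun w => dot (e s w) (e t w)) <= b2.
Proof.
move=> st; have -> : mean P (fun w => dot (e s w) (e t w)) = dot (beta s) (beta t).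
  rewrite mean_sum; last by move=> i; exact: square_summable_rvM.
  apply: eq_bigr => i _; rewrite -!mean_e.
  have [|||_ ->//] := @indep_summable_rvM _ _ _ P (fun w => e s w i 0) (fun w => e t w i 0).
  - exact: square_summable_rvW.
  - exact: square_summable_rvW.
  have shift r : (fun w => e r w i 0) = (fun y => y - v i 0) \o (fun w => G r w i 0).
    by apply/funext => w; rewrite !mxE.
  have mshift : measurable_fun setT (fun y : R => y - v i 0) by exact: measurable_funB.
  rewrite !shift; apply: (indep_systemsS _ _ (@indG s t i st)).
  - exact: (preimage_system_comp (X := fun w => G s w i 0) mshift).
  - exact: (preimage_system_comp (X := fun w => G t w i 0) mshift).
by have := dot2_le (beta s) (beta t); have := betab s; have := betab t; lra.
Qed.

(** [E |e|^2 = E |G|^2 - 2 <beta, v> - |v|^2 = E |G|^2 + |beta|^2 - |beta + v|^2], and the last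
    square is dropped. *)
Let mean_e2 t : mean P (fun w => dot (e t w) (e t w)) <= V + b2.
Proof.
have sG : summable_rv P (fun w => dot (G t w) (G t w)).
  by apply: summable_rv_sum => i; exact: square_summable_rvM.
have s1 i : summable_rv P (fun w => e t w i 0 * v i 0).
  by under eq_fun do rewrite mulrC; apply: summable_rvZ; exact: square_summable_rvW.
have sv : summable_rv P (fun w => dot (e t w) v) by exact: summable_rv_sum.
have mv : mean P (fun w => dot (e t w) v) = dot (beta t) v.
  rewrite mean_sum//; apply: eq_bigr => i _.
  under eq_fun do rewrite mulrC.
  by rewrite meanZ ?mean_e 1?mulrC//; exact: square_summable_rvW.
have E : (fun w => dot (e t w) (e t w)) = (fun w => dot (G t w) (G t w) -
    (2 * dot (e t w) v + dot v v)).
  apply/funext => w; have -> : G t w = e t w + v by rewrite /e subrK.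
  by move: (e t w) => y; rewrite !(dotDl, dotDr) (dotC v y); ring.
have s2 : summable_rv P (fun w => 2 * dot (e t w) v + dot v v).
  by apply: summable_rvD; [exact: summable_rvZ|exact: summable_rv_cst].
rewrite E meanB// meanD ?meanZ ?mean_cst ?mv//; [|exact: summable_rvZ|exact: summable_rv_cst].
have := GV t; have := betab t; move: (beta t) => c cb2 GtV.
by have := dot_ge0 (c + v); rewrite !(dotDl, dotDr) (dotC v c); lra.
Qed.

(** The mean of [delta] is an average of biases, each paired with [a] through [|4 beta - a|^2 >= 0].
    The weight [1/8] is half of the [1/4] available in the descent inequality. *)
Lemma minibatch_error_dot (a : 'cV[R]_m) :
  summable_rv P (fun w => dot (delta w) a) /\
  mean P (fun w => dot (delta w) a) <= 2 * b2 + dot a a / 8.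
Proof.
have s1 t i : summable_rv P (fun w => e t w i 0 * a i 0).
  by under eq_fun do rewrite mulrC; apply: summable_rvZ; exact: square_summable_rvW.
have sa t : summable_rv P (fun w => dot (e t w) a) by exact: summable_rv_sum.
have ma t : mean P (fun w => dot (e t w) a) = dot (beta t) a.
  rewrite mean_sum//; apply: eq_bigr => i _.
  under eq_fun do rewrite mulrC.
  by rewrite meanZ ?mean_e 1?mulrC//; exact: square_summable_rvW.
have E : (fun w => dot (delta w) a) = (fun w => B%:R^-1 * \sum_(t < B) dot (e t w) a).
  by apply/funext => w; rewrite deltaE dotZl dot_suml.
rewrite E; split; first by apply: summable_rvZ; exact: summable_rv_sum.
rewrite meanZ; last exact: summable_rv_sum.
rewrite mean_sum// mulrC ler_pdivrMr ?ltr0n//.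
rewrite mulr_natr -[X in _ *+ X](card_ord B) -sumr_const; apply: ler_sum => t _.
rewrite ma.
have := dot_ge0 (4 *: beta t - a); rewrite !(dotBl, dotBr, dotZl, dotZr).
by rewrite (dotC a); have := betab t; lra.
Qed.

(** In the double sum, each row has one diagonal term, at most [V + b2], and [B - 1] cross terms, at
    most [b2]. Division by [B^2] damps [V] but not the bias. *)
Lemma minibatch_error_norm2 :
  summable_rv P (fun w => dot (delta w) (delta w)) /\
  mean P (fun w => dot (delta w) (delta w)) <= b2 + V / B%:R.
Proof.
have E : (fun w => dot (delta w) (delta w)) = (fun w => (B%:R^-1 * B%:R^-1) *
    \sum_(t < B) \sum_(s < B) dot (e s w) (e t w)).
  apply/funext => w; rewrite deltaE dotZl dotZr mulrA dot_suml.
  congr (_ * _); apply: eq_bigr => t _.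
  by rewrite dotC dot_suml.
have ss t : summable_rv P (fun w => \sum_(s < B) dot (e s w) (e t w)).
  exact: summable_rv_sum.
rewrite E; split; first by apply: summable_rvZ; exact: summable_rv_sum.
rewrite meanZ; last exact: summable_rv_sum.
rewrite mean_sum//.
have row t : mean P (fun w => \sum_(s < B) dot (e s w) (e t w)) <= V + B%:R * b2.
  rewrite mean_sum// (bigD1 t)//=.
  have : \sum_(s < B | s != t) mean P (fun w => dot (e s w) (e t w)) <=
      \sum_(s < B | s != t) b2 by apply: ler_sum => s st; exact: mean_ee.
  have : \sum_(s < B) b2 = B%:R * b2 by rewrite sumr_const card_ord mulr_natl.
  by rewrite (bigD1 t)//=; have := mean_e2 t; lra.
have : \sum_(t < B) mean P (fun w => \sum_(s < B) dot (e s w) (e t w)) <=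
    B%:R * (V + B%:R * b2).
  rewrite mulr_natl -[X in _ *+ X](card_ord B) -sumr_const.
  by apply: ler_sum => t _; exact: row.
have Bi0 : 0 <= B%:R^-1 * B%:R^-1 :> R by rewrite mulr_ge0 ?invr_ge0.
move=> /(ler_wpM2l Bi0) /le_trans; apply.
by rewrite le_eqVlt; apply/orP; left; apply/eqP; field.
Qed.

End MiniBatch.

(** * Block steps *)

Section Blocks.
Variables (R : realType) (b : nat) (nb : 'I_b -> nat).
Implicit Types (x y : 'cV[R]_(totdim nb)) (s t : 'I_b).

Lemma blk_submxcol s x : blk nb s x = submxcol x s.
Proof. by rewrite /blk /U tr_submxrow trmx1 submxcol_mul mul1mx. Qed.

Lemma blkD s x y : blk nb s (x + y) = blk nb s x + blk nb s y.
Proof. exact: mulmxDr. Qed.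

Lemma blkB s x y : blk nb s (x - y) = blk nb s x - blk nb s y.
Proof. exact: mulmxBr. Qed.

Lemma blkZ s (a : R) x : blk nb s (a *: x) = a *: blk nb s x.
Proof. by rewrite /blk -scalemxAr. Qed.

Lemma blk_inj x y : (forall s, blk nb s x = blk nb s y) -> x = y.
Proof. by move=> xy; apply/mxcolP => s; rewrite -!blk_submxcol. Qed.

Let submxcol_row (A : 'M[R]_(totdim nb)) s t :
  submxcol (submxrow A s) t = submxblock A t s.
Proof. by apply/matrixP => i j; rewrite !mxE. Qed.

Lemma blk_U_eq s (h : 'cV[R]_(nb s)) : blk nb s (U nb s *m h) = h.
Proof.
rewrite blk_submxcol /U -submxcol_mul -mxdiagZ.
by rewrite submxcol_row submxblock_diag mul1mx.
Qed.

Lemma blk_U_neq s t (h : 'cV[R]_(nb s)) : t != s -> blk nb t (U nb s *m h) = 0.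
Proof.
move=> ts; rewrite blk_submxcol /U -submxcol_mul -mxdiagZ.
by rewrite submxcol_row mxblockK (negbTE ts) mul0mx.
Qed.

Lemma dot_blk x y : dot x y = \sum_s dot (blk nb s x) (blk nb s y).
Proof.
have dotE m (v w : 'cV[R]_m) : dot v w = (v^T *m w) 0 0.
  by rewrite mxE; apply: eq_bigr => i _; rewrite mxE.
rewrite [RHS](eq_bigr (fun s => ((submxcol x s)^T *m submxcol y s) 0 0)); last first.
  by move=> s _; rewrite !blk_submxcol dotE.
rewrite dotE -{1}(submxcolK x) -{1}(submxcolK y) tr_mxcol mul_mxrow_mxcol.
by rewrite summxE.
Qed.

Lemma dot_U s x (h : 'cV[R]_(nb s)) : dot x (U nb s *m h) = dot (blk nb s x) h.
Proof.
rewrite dot_blk (bigD1 s)//= blk_U_eq big1 ?addr0// => t ts.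
by rewrite blk_U_neq// dot0r.
Qed.

Lemma block_sum_update (chi : forall s, 'cV[R]_(nb s) -> R) s x
    (h : 'cV[R]_(nb s)) :
  block_sum chi (x + U nb s *m h) =
  block_sum chi x - chi s (blk nb s x) + chi s (blk nb s x + h).
Proof.
rewrite /block_sum (bigD1 s)//= [in RHS](bigD1 s)//= blkD blk_U_eq.
under eq_bigr => t ts do rewrite blkD blk_U_neq// addr0.
by ring.
Qed.

End Blocks.

Section BlockStep.
Variables (R : realType) (b : nat) (nb : 'I_b -> nat).
Variables (Xs : forall s : 'I_b, set 'cV[R]_(nb s)).
Variables (phi chi : forall s : 'I_b, 'cV[R]_(nb s) -> R).
Variables (f : 'cV[R]_(totdim nb) -> R) (alpha : R) (L : 'I_b -> R).
Arguments Xs : clear implicits.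
Arguments phi : clear implicits.
Arguments chi : clear implicits.
Let X := block_product Xs.
Let Phi y := f y + block_sum chi y.
Hypothesis ccX : forall s, closed_convex_set (Xs s).
Hypothesis ccchi : forall s, closed_convex_fun (chi s).
Hypothesis phiP : forall s,
  (forall y, differentiable (phi s) y) /\ strongly_convex1 (phi s).
Hypothesis alpha0 : 0 < alpha.
Hypothesis alphaL : forall s, L s * alpha <= 1.
Hypothesis descent : forall x s (h : 'cV[R]_(nb s)), X x ->
  f (x + U nb s *m h) <= f x + dot (grad f x) (U nb s *m h) + L s * dot h h / 2.

Let P x g s := prox (Xs s) (phi s) (chi s) (blk nb s x) (blk nb s g) alpha.
Let gg x g := gen_grad Xs phi chi x g alpha.

(** [g] is a full vector of which only block [s] is read, so that one direction serves all blocks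
    when the step is averaged over [s]. *)
Definition block_step x g s := x + U nb s *m (P x g s - blk nb s x).

Let Xs0 x : X x -> forall s, Xs s !=set0.
Proof. by move=> Xx s; exists (blk nb s x). Qed.

Lemma blk_block_step x g s t : blk nb t (block_step x g s) =
  if t == s then P x g t else blk nb t x.
Proof.
rewrite /block_step blkD; case: eqVneq => [->|ts].
  by rewrite blk_U_eq addrC subrK.
by rewrite blk_U_neq// addr0.
Qed.

Lemma block_step_in x g s : X x -> X (block_step x g s).
Proof.
move=> Xx t; rewrite blk_block_step; case: eqVneq => [->|_]; last exact: Xx.
have [dphi sphi] := phiP s.
by apply: prox_in => //; exact: Xs0 Xx s.
Qed.

Lemma blk_gen_grad x g s : blk nb s (gg x g) = alpha^-1 *: (blk nb s x - P x g s).
Proof. by rewrite blk_submxcol mxcolK. Qed.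

Lemma block_step_descent x g s : X x ->
  Phi (block_step x g s) <= Phi x - alpha *
    (dot (blk nb s (gg x g)) (blk nb s (gg x g)) / 2
     - dot (blk nb s (g - grad f x)) (blk nb s (gg x g))).
Proof.
move=> Xx; have [dphi sphi] := phiP s; have Xs0' := Xs0 Xx s.
have := prox_descent alpha0 (ccX s) Xs0' (ccchi s) dphi sphi (blk nb s g) (Xx s).
have := @descent x s (P x g s - blk nb s x) Xx.
rewrite /Phi /block_step block_sum_update dot_U -/(P x g s).
rewrite (_ : blk nb s x + (P x g s - blk nb s x) = P x g s); last first.
  by rewrite addrC subrK.
set d := blk nb s (gg x g).
have -> : blk nb s x - P x g s = alpha *: d.
  by rewrite /d blk_gen_grad scalerA divff ?gt_eqF// scale1r.
have -> : P x g s - blk nb s x = - (alpha *: d).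
  rewrite -opprB; congr (- _).
  by rewrite /d blk_gen_grad scalerA divff ?gt_eqF// scale1r.
rewrite blkB dotBl !(dotNl, dotNr, dotZl, dotZr) !mulrN !opprK mulKf ?gt_eqF//.
have d0 : 0 <= dot d d by exact: dot_ge0.
(* [L s * alpha <= 1] lets the smoothness term consume half of the decrease supplied by
   [prox_descent]. *)
have : L s * (alpha * (alpha * dot d d)) / 2 <= alpha * dot d d / 2.
  rewrite mulrA ler_pM2r// ler_piMl// mulr_ge0// ltW//.
lra.
Qed.

Lemma sum_block_step_descent x g : X x ->
  \sum_s Phi (block_step x g s) <= b%:R * Phi x - alpha *
    (dot (gg x (grad f x)) (gg x (grad f x)) / 4
     - dot (g - grad f x) (gg x (grad f x))
     - 3 / 2 * dot (g - grad f x) (g - grad f x)).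
Proof.
move=> Xx; set h := gg x (grad f x); set delta := g - grad f x.
pose e := gg x g - h.
have ee : dot e e <= dot e delta.
  rewrite dot_blk [leRHS]dot_blk; apply: ler_sum => s _.
  have [dphi sphi] := phiP s.
  rewrite /delta blkB.
  apply: (gen_grad_block_monotone alpha0 (ccX s) (Xs0 Xx s) (ccchi s) dphi sphi
    (x := blk nb s x)).
  by rewrite /e /h blkB !blk_submxcol !mxcolK !blk_submxcol.
have step : \sum_s Phi (block_step x g s) <= b%:R * Phi x - alpha *
    (dot (gg x g) (gg x g) / 2 - dot delta (gg x g)).
  rewrite (dot_blk (gg x g)) (dot_blk delta) mulr_suml -sumrB mulr_sumr.
  rewrite mulr_natl -[X in _ *+ X](card_ord b) -sumr_const -sumrB.
  by apply: ler_sum => s _; exact: block_step_descent.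
apply: le_trans step _; rewrite lerD2l lerN2 ler_pM2l//.
have -> : gg x g = h + e by rewrite /e addrC subrK.
clearbody e h delta.
(* The first square bounds the cross term [<h, e>] below by [- |h|^2 / 4 - |e|^2]; the second one
   and [ee] give [|e|^2 <= <e, delta> <= |delta|^2]. Hence the factors [1/4] and [3/2]. *)
have := dot_ge0 (2^-1 *: h + e); have := dot_ge0 (e - delta); move: ee.
rewrite !(dotDl, dotDr, dotNl, dotNr, dotZl, dotZr) (dotC e h) (dotC delta e).
lra.
Qed.

End BlockStep.

(** Rewrites a choice by a random index as a sum weighted by indicators, the form suited to
    measurability and independence. *)
Lemma sum_selected (R : pzRingType) (V : lmodType R) (b : nat) (i : 'I_b)
    (h : 'I_b -> V) : \sum_s (i == s)%:R *: h s = h i.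
Proof.
rewrite (bigD1 i)//= eqxx scale1r big1 ?addr0// => s.
by rewrite eq_sym => /negbTE ->; rewrite scale0r.
Qed.

(** * Measurability of one step of the method *)

Section MeasurableMethod.
Variables (R : realType) (b : nat) (nb : 'I_b -> nat).
Variables (Xs : forall s : 'I_b, set 'cV[R]_(nb s)).
Variables (phi chi : forall s : 'I_b, 'cV[R]_(nb s) -> R).
Variables (f : 'cV[R]_(totdim nb) -> R) (alpha : R).
Arguments Xs : clear implicits.
Arguments phi : clear implicits.
Arguments chi : clear implicits.
Hypothesis ccX : forall s, closed_convex_set (Xs s).
Hypothesis Xs0 : forall s, Xs s !=set0.
Hypothesis ccchi : forall s, closed_convex_fun (chi s).
Hypothesis phiP : forall s,
  (forall y, differentiable (phi s) y) /\ strongly_convex1 (phi s).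
Hypothesis df : forall y, differentiable f y.
Hypothesis alpha0 : 0 < alpha.
Let n := totdim nb.

Lemma measurable_blk_prox d (T : measurableType d) (x g : T -> 'cV[R]_n) s :
  measurable_fun setT (x : T -> borel_cV R n) ->
  measurable_fun setT (g : T -> borel_cV R n) ->
  measurable_fun setT ((fun t => prox (Xs s) (phi s) (chi s)
    (blk nb s (x t)) (blk nb s (g t)) alpha) : T -> borel_cV R (nb s)).
Proof.
move=> mx mg; have [dphi sphi] := phiP s.
by apply: (measurable_prox alpha0 (ccX s) (Xs0 s) (ccchi s) dphi sphi);
  exact: measurable_mulmx.
Qed.

Lemma measurable_block_step d (T : measurableType d) (x g : T -> 'cV[R]_n) s :
  measurable_fun setT (x : T -> borel_cV R n) ->
  measurable_fun setT (g : T -> borel_cV R n) ->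
  measurable_fun setT
    ((fun t => block_step Xs phi chi alpha (x t) (g t) s) : T -> borel_cV R n).
Proof.
move=> mx mg; apply: (@measurable_cVD R _ T n) => //.
apply: (@measurable_mulmx R _ T); apply: (@measurable_cVB R _ T).
  exact: measurable_blk_prox.
exact: measurable_mulmx.
Qed.

Lemma measurable_objective : measurable_fun [set: borel_cV R n]
  (fun y : borel_cV R n => f y + block_sum chi y).
Proof.
apply: measurable_funD.
  apply: measurable_fun_continuous_cV => y; exact: differentiable_continuous.
apply: measurable_sum => s.
have mchi : measurable_fun [set: borel_cV R (nb s)] (chi s : borel_cV R (nb s) -> R).
  apply: measurable_fun_closed_sublevel => c.
  rewrite (_ : [set y | _] = (fun y => (y, c)) @^-1`
      [set z : 'cV[R]_(nb s) * R | chi s z.1 <= z.2]) //.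
  apply: preimage_closed; last exact: (ccchi s).1.
  move=> y _; exact: (cvg_pair (@cvg_id _ (nbhs y)) (@cvg_cst R c _ (nbhs y) _)).
apply: (measurableT_comp mchi).
by apply: (@measurable_mulmx R _ (borel_cV R n)); exact: measurable_id.
Qed.

Lemma measurable_gen_grad_norm2 : measurable_fun [set: borel_cV R n]
  (fun y : borel_cV R n => dot (gen_grad Xs phi chi y (grad f y) alpha)
                               (gen_grad Xs phi chi y (grad f y) alpha)).
Proof.
under eq_fun do rewrite dot_blk.
apply: measurable_sum => s.
suff h : measurable_fun [set: borel_cV R n] ((fun y => blk nb s
    (gen_grad Xs phi chi y (grad f y) alpha)) : borel_cV R n -> borel_cV R (nb s)).
  exact: measurable_dot.
have mid : measurable_fun [set: borel_cV R n] (id : borel_cV R n -> borel_cV R n).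
  exact: measurable_id.
under eq_fun do rewrite blk_gen_grad.
apply: (@measurable_cVZ R _ (borel_cV R n) _ (fun=> alpha^-1)) => //.
apply: (@measurable_cVB R _ (borel_cV R n)); first exact: measurable_mulmx.
by apply: measurable_blk_prox => //; exact: measurable_grad.
Qed.

Variables (dXi : measure_display) (Xi : measurableType dXi).
Variables (F : 'cV[R]_n -> Xi -> R) (mu : R) (B : nat).
Hypothesis mF : measurable_fun [set: borel_cV R n * Xi] (fun z => F z.1 z.2).

(** The minibatch direction before projection on a block; samples are numbered from [1], whence
    [t.+1]. *)
Definition batch_grad (x : 'cV[R]_n) (z : nat -> Xi) (u : nat -> 'cV[R]_n) :=
  B%:R^-1 *: \sum_(t < B) zo_grad F mu x (z t.+1) (u t.+1).

Lemma blk_batch_grad x z u s :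
  blk nb s (batch_grad x z u) = zo_block_grad nb F mu B x z u s.
Proof.
rewrite /batch_grad blkZ /zo_block_grad; congr (_ *: _).
by rewrite /blk mulmx_sumr big_add1 /= big_mkord.
Qed.

Lemma measurable_batch_grad d (T : measurableType d) (x : T -> 'cV[R]_n)
    (z : nat -> T -> Xi) (u : nat -> T -> 'cV[R]_n) :
  measurable_fun setT (x : T -> borel_cV R n) ->
  (forall t, (1 <= t <= B)%N -> measurable_fun setT (z t)) ->
  (forall t, (1 <= t <= B)%N -> measurable_fun setT (u t : T -> borel_cV R n)) ->
  measurable_fun setT
    ((fun w => batch_grad (x w) (z^~ w) (u^~ w)) : T -> borel_cV R n).
Proof.
move=> mx mz mu_; apply: (@measurable_cVZ R _ T n (fun=> B%:R^-1)) => //.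
apply: (@measurable_cV_sum R _ T n) => t.
have tB : (1 <= t.+1 <= B)%N by rewrite ltn_ord.
have mzt := mz _ tB; have mut := mu_ _ tB.
apply: (@measurable_cVZ R _ T n) => //.
apply: measurable_funM => //; apply: measurable_funB.
  have mp : measurable_fun setT
      (fun w => ((x w + mu *: u t.+1 w) : borel_cV R n, z t.+1 w)).
    apply: measurable_fun_pair => //; apply: (@measurable_cVD R _ T n) => //.
    by apply: (@measurable_cVZ R _ T n (fun=> mu)).
  exact: (measurableT_comp mF mp).
have mp : measurable_fun setT (fun w => (x w : borel_cV R n, z t.+1 w)).
  exact: measurable_fun_pair.
exact: (measurableT_comp mF mp).
Qed.

Lemma measurable_step d (T : measurableType d) (x : T -> 'cV[R]_n)
    (z : nat -> T -> Xi) (u : nat -> T -> 'cV[R]_n) (i : T -> 'I_b) :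
  measurable_fun setT (x : T -> borel_cV R n) ->
  (forall t, (1 <= t <= B)%N -> measurable_fun setT (z t)) ->
  (forall t, (1 <= t <= B)%N -> measurable_fun setT (u t : T -> borel_cV R n)) ->
  (forall s, measurable_fun setT (fun w => (i w == s)%:R : R)) ->
  measurable_fun setT ((fun w => block_step Xs phi chi alpha (x w)
    (batch_grad (x w) (z^~ w) (u^~ w)) (i w)) : T -> borel_cV R n).
Proof.
move=> mx mz mu_ mi.
rewrite (_ : (fun w => _) = fun w => \sum_s (i w == s)%:R *:
    block_step Xs phi chi alpha (x w) (batch_grad (x w) (z^~ w) (u^~ w)) s).
  apply: (@measurable_cV_sum R _ T n) => s.
  apply: (@measurable_cVZ R _ T n) => //; apply: measurable_block_step => //.
  exact: measurable_batch_grad.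
apply/funext => w; exact/esym/(sum_selected (i w)
  (fun s => block_step Xs phi chi alpha (x w) (batch_grad (x w) (z^~ w) (u^~ w)) s)).
Qed.

End MeasurableMethod.

(** * Expected progress of one step from a fixed point *)

Section ExpectedStep.
Variables (R : realType) (b : nat) (nb : 'I_b -> nat).
Variables (Xs : forall s : 'I_b, set 'cV[R]_(nb s)).
Variables (phi chi : forall s : 'I_b, 'cV[R]_(nb s) -> R).
Arguments Xs : clear implicits.
Arguments phi : clear implicits.
Arguments chi : clear implicits.
Variables (dXi : measure_display) (Xi : measurableType dXi) (Pxi : probability Xi R).
Let n := totdim nb.
Variables (F : 'cV[R]_n -> Xi -> R) (f : 'cV[R]_n -> R).
Variables (sigma Lf M alpha mu Phi_star : R) (L : 'I_b -> R) (N : set Xi) (B : nat).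
Let X := block_product Xs.
Let Phi y := f y + block_sum chi y.

Hypothesis ccX : forall s, closed_convex_set (Xs s).
Hypothesis ccchi : forall s, closed_convex_fun (chi s).
Hypothesis phiP : forall s,
  (forall y, differentiable (phi s) y) /\ strongly_convex1 (phi s).
Hypothesis mF : measurable_fun [set: borel_cV R n * Xi] (fun z => F z.1 z.2).
Hypotheses (mN : measurable N) (N0 : Pxi N = 0%E).
Hypothesis dF : forall z, ~ N z -> forall x, differentiable (F^~ z) x.
Hypothesis Lf0 : 0 < Lf.
Hypothesis LF : forall z, ~ N z -> forall x y,
  enorm (grad (F^~ z) x - grad (F^~ z) y) <= Lf * enorm (x - y).
Hypothesis LsF : forall z, ~ N z -> forall (s : 'I_b) x (h : 'cV[R]_(nb s)),
  enorm (blk nb s (grad (F^~ z) (x + U nb s *m h)) - blk nb s (grad (F^~ z) x))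
    <= L s * enorm h.
Hypotheses (A1 : assumption1 Pxi F f X sigma) (A3 : assumption3 f X M).
Hypotheses (mu0 : 0 < mu) (alpha0 : 0 < alpha) (B0 : (0 < B)%N) (b0 : (0 < b)%N).
Hypothesis alphaL : forall s, L s * alpha <= 1.
Hypothesis Phi_min : forall y, X y -> Phi_star <= Phi y.

Lemma block_descent x s (h : 'cV[R]_(nb s)) : X x ->
  f (x + U nb s *m h) <= f x + dot (grad f x) (U nb s *m h) + L s * dot h h / 2.
Proof.
move=> Xx; apply: (mean_descent mF mN N0 dF A1) => z Nz t t0.
rewrite dot_U blkB (le_trans (cauchy_schwarz _ _))//.
have := LsF Nz x (t *: h).
rewrite -scalemxAr => le; apply: le_trans (ler_wpM2r (enorm_ge0 h) le) _.
rewrite enormZ ger0_norm//.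
by rewrite -sqr_enorm le_eqVlt; apply/orP; left; apply/eqP; ring.
Qed.

Let df y : differentiable f y. Proof. by case: A1. Qed.

Variables (d : measure_display) (Omega : measurableType d) (P : probability Omega R).
Variables (xi : nat -> Omega -> Xi) (u : nat -> Omega -> 'cV[R]_n) (i : Omega -> 'I_b).
Hypothesis mxi : forall t, (1 <= t <= B)%N -> measurable_fun setT (xi t).
Hypothesis lawxi : forall t, (1 <= t <= B)%N ->
  forall A, measurable A -> P (xi t @^-1` A) = Pxi A.
Hypothesis gu : forall t, (1 <= t <= B)%N -> std_gaussian P (u t).
Hypothesis xiu : forall t, (1 <= t <= B)%N ->
  indep_systems P (preimage_set_system setT (xi t) measurable)
    (preimage_set_system setT (u t : Omega -> borel_cV R n) measurable).
Let pair t w := (xi t w, u t w : borel_cV R n).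
Hypothesis pairs_indep : forall s t, (1 <= s <= B)%N -> (1 <= t <= B)%N -> s != t ->
  indep_systems P (preimage_set_system setT (pair s) measurable)
    (preimage_set_system setT (pair t) measurable).
Hypothesis mi : forall s, measurable_fun setT (fun w => (i w == s)%:R : R).
Hypothesis lawi : forall s, mean P (fun w => (i w == s)%:R) = 1 / b%:R.
Let g x w := batch_grad F mu B x (xi^~ w) (u^~ w).
Hypothesis ig : forall x s,
  indep_systems P (preimage_set_system setT (fun w => (i w == s)%:R : R) measurable)
    (preimage_set_system setT (g x : Omega -> borel_cV R n) measurable).

Let V := zo_second_moment n Lf sigma M mu.
Let b2 := mu ^+ 2 * Lf ^+ 2 / 4 * (n%:R * (n%:R + 2)).
Let gg x := gen_grad Xs phi chi x (grad f x) alpha.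

(** The block index is independent of the direction, so the mean is [1/b] times the sum over the
    blocks, to which [sum_block_step_descent] applies with the minibatch errors. *)
Lemma expected_step x : X x ->
  let Psi := fun w => Phi (block_step Xs phi chi alpha x (g x w) (i w)) - Phi_star in
  summable_rv P Psi /\
  mean P Psi <= Phi x - Phi_star -
    alpha / b%:R * (dot (gg x) (gg x) / 8 - (7 / 2 * b2 + 3 / 2 * (V / B%:R))).
Proof.
move=> Xx Psi.
have tB (t : 'I_B) : (1 <= t.+1 <= B)%N by rewrite ltn_ord.
pose G (t : 'I_B) w := zo_grad F mu x (xi t.+1 w) (u t.+1 w).
have G2 t j : square_summable_rv P (fun w => G t w j 0).
  exact: (zo_grad_square_summable mF mN N0 dF Lf0 LF A1 A3 mu0 Xx
    (mxi (tB t)) (lawxi (tB t)) (gu (tB t)) (xiu (tB t))).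
have GV t : mean P (fun w => dot (G t w) (G t w)) <= V.
  exact: (zo_grad_second_moment mF mN N0 dF Lf0 LF A1 A3 mu0 Xx
    (mxi (tB t)) (lawxi (tB t)) (gu (tB t)) (xiu (tB t))).2.
have Gb t : dot (\col_j (mean P (fun w => G t w j 0) - grad f x j 0))
    (\col_j (mean P (fun w => G t w j 0) - grad f x j 0)) <= b2.
  exact: (zo_bias_le mF mN N0 dF Lf0 LF A1 A3 mu0 Xx
    (mxi (tB t)) (lawxi (tB t)) (gu (tB t)) (xiu (tB t))).
have indG s t j : s != t ->
    indep_systems P (preimage_set_system setT (fun w => G s w j 0) measurable)
      (preimage_set_system setT (fun w => G t w j 0) measurable).
  move=> st; pose q (z : Xi * borel_cV R n) : R := zo_grad F mu x z.1 z.2 j 0.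
  have mq : measurable_fun setT q.
    have m2 : measurable_fun [set: Xi * borel_cV R n] (fun z => z.2) by exact: measurable_snd.
    have m1 : measurable_fun [set: Xi * borel_cV R n] (fun z => z.1) by exact: measurable_fst.
    apply: measurable_coord_comp; apply: (@measurable_cVZ R _ (Xi * borel_cV R n)%type n) => //.
    apply: measurable_funM => //; apply: measurable_funB.
      have mp : measurable_fun setT (fun z : Xi * borel_cV R n =>
          ((x + mu *: z.2) : borel_cV R n, z.1)).
        apply: measurable_fun_pair => //.
        apply: (@measurable_cVD R _ (Xi * borel_cV R n)%type n (fun=> x)).
          exact: measurable_cst.
        by apply: (@measurable_cVZ R _ (Xi * borel_cV R n)%type n (fun=> mu)).
      exact: (measurableT_comp mF mp).
    have mp : measurable_fun setT (fun z : Xi * borel_cV R n => (x : borel_cV R n, z.1)).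
      by apply: measurable_fun_pair => //; exact: measurable_cst.
    exact: (measurableT_comp mF mp).
  have st' : s.+1 != t.+1 by rewrite eqSS.
  apply: (indep_systemsS _ _ (pairs_indep (tB s) (tB t) st')).
  - exact: (preimage_system_comp (X := pair s.+1) mq).
  - exact: (preimage_system_comp (X := pair t.+1) mq).
have [sd md] := minibatch_error_dot B0 G2 Gb (gg x).
have [sn mn] := minibatch_error_norm2 B0 G2 indG GV Gb.
set delta := (fun w => B%:R^-1 *: (\sum_(t < B) G t w) - grad f x) in sd md sn mn.
have Xs0 s : Xs s !=set0 by exists (blk nb s x).
pose Q s w := Phi (block_step Xs phi chi alpha x (g x w) s) - Phi_star.
have mg : measurable_fun setT (g x : Omega -> borel_cV R n).
  by apply: measurable_batch_grad => // t tB'; case: (gu tB').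
pose psi s (y : borel_cV R n) : R := Phi (block_step Xs phi chi alpha x y s) - Phi_star.
have mpsi s : measurable_fun setT (psi s).
  apply: measurable_funB => //.
  apply: (measurableT_comp (measurable_objective ccchi df)).
  apply: (@measurable_block_step _ _ _ _ _ _ _ ccX Xs0 ccchi phiP alpha0 _
    (borel_cV R n) (fun=> x) id s); [exact: measurable_cst|exact: measurable_id].
have mQ s : measurable_fun setT (Q s) by exact: (measurableT_comp (mpsi s) mg).
have Q0 s w : 0 <= Q s w.
  by rewrite subr_ge0; apply: Phi_min; exact: block_step_in.
pose r w := b%:R * (Phi x - Phi_star) - alpha *
  (dot (gg x) (gg x) / 4 - dot (delta w) (gg x) - 3 / 2 * dot (delta w) (delta w)).
have Qr w : \sum_s Q s w <= r w.
  rewrite /Q sumrB sumr_const card_ord.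
  have := sum_block_step_descent ccX ccchi phiP alpha0 alphaL block_descent (g x w) Xx.
  rewrite (_ : g x w - grad f x = delta w)// -/Phi -/(gg x) /r.
  rewrite -[Phi_star *+ b]mulr_natl /Phi; lra.
have s3 : summable_rv P (fun w => dot (gg x) (gg x) / 4 - dot (delta w) (gg x)).
  by apply: summable_rvB => //; exact: summable_rv_cst.
have s4 : summable_rv P (fun w => 3 / 2 * dot (delta w) (delta w)) by exact: summable_rvZ.
have s5 : summable_rv P (fun w => alpha *
    (dot (gg x) (gg x) / 4 - dot (delta w) (gg x) - 3 / 2 * dot (delta w) (delta w))).
  by apply: summable_rvZ; exact: summable_rvB.
have sr : summable_rv P r by apply: summable_rvB => //; exact: summable_rv_cst.
(* [1/8 = 1/4 - 1/8] and [7/2 = 2 + 3/2]: the pairing with [delta] contributes [2 * b2] and [1/8],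
   its square norm [3/2 * (b2 + V / B)]. *)
have mr : mean P r <= b%:R * (Phi x - Phi_star) - alpha *
    (dot (gg x) (gg x) / 8 - (7 / 2 * b2 + 3 / 2 * (V / B%:R))).
  rewrite /r meanB// ?mean_cst; last exact: summable_rv_cst.
  rewrite meanZ; last exact: summable_rvB.
  rewrite meanB// meanB// ?mean_cst ?meanZ//; last exact: summable_rv_cst.
  rewrite lerD2l lerN2 ler_pM2l//.
  by move: md mn; rewrite -/(delta _); lra.
(* The [Q s] are nonnegative, so the summable bound on their sum dominates each of them. *)
have sQ s : summable_rv P (Q s).
  apply: summable_rv_le sr => // w; rewrite ger0_norm//.
  by apply: le_trans (Qr w); rewrite (bigD1 s)//= lerDl sumr_ge0.
have PsiE : Psi = fun w => \sum_s (i w == s)%:R * Q s w.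
  by apply/funext => w; rewrite -[Psi w]/(Q (i w) w) -(sum_selected (V := R^o) (i w) (Q^~ w)).
have si s : summable_rv P (fun w => (i w == s)%:R).
  apply: (@summable_rv_le _ _ _ _ _ (fun=> 1)) => //; last exact: summable_rv_cst.
  by move=> w; case: eqP => _; rewrite ?normr1// normr0.
have iQ s : summable_rv P (fun w => (i w == s)%:R * Q s w) /\
    mean P (fun w => (i w == s)%:R * Q s w) = 1 / b%:R * mean P (Q s).
  rewrite -(lawi s); apply: indep_summable_rvM => //.
  apply: (indep_systemsS _ _ (ig (x := x) (s := s))) => //.
  exact: (preimage_system_comp (X := g x : Omega -> borel_cV R n) (mpsi s)).
rewrite PsiE; split; first by apply: summable_rv_sum => s; case: (iQ s).
rewrite mean_sum; last by move=> s; case: (iQ s).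
rewrite [leLHS](_ : _ = 1 / b%:R * mean P (fun w => \sum_s Q s w)); last first.
  by rewrite mean_sum// mulr_sumr; apply: eq_bigr => s _; rewrite (iQ s).2.
have : mean P (fun w => \sum_s Q s w) <= mean P r.
  by apply: le_mean => //; exact: summable_rv_sum.
move=> /le_trans/(_ mr) h.
have bp : 0 < b%:R :> R by rewrite ltr0n.
have bn : b%:R != 0 :> R by rewrite gt_eqF.
rewrite -(ler_pM2l bp) mulrA div1r mulfV// mul1r; apply: le_trans h _.
move: (dot (gg x) (gg x) / 8 - _) => c.
by rewrite le_eqVlt; apply/orP; left; apply/eqP; field.
Qed.

End ExpectedStep.

(** Enlarging the integrand enlarges the set of simple functions below it. Meant for inner integrals
    seen as functions of the outer outcome. *)
Lemma ge0_le_integral_monotone d (T : measurableType d) (R : realType)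
    (mu : {measure set T -> \bar R}) (f g : T -> \bar R) :
  (forall x, (0 <= f x)%E) -> (forall x, (f x <= g x)%E) ->
  (\int[mu]_x f x <= \int[mu]_x g x)%E.
Proof.
move=> f0 fg; have g0 x : (0 <= g x)%E by exact: le_trans (f0 x) (fg x).
rewrite ge0_integralTE// [leRHS]ge0_integralTE//.
by apply: ereal_sup_le => _ [h hf <-]; exists h => // x; exact: le_trans (hf x) (fg x).
Qed.

Lemma mean_indicator d (Omega : measurableType d) (R : realType)
    (P : probability Omega R) (T : eqType) (X : Omega -> T) (s : T) (q : R) :
  measurable (X @^-1` [set s]) -> P (X @^-1` [set s]) = q%:E ->
  summable_rv P (fun w => (X w == s)%:R) /\ mean P (fun w => (X w == s)%:R) = q.
Proof.
move=> mXs PXs.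
have -> : (fun w => (X w == s)%:R) = \1_(X @^-1` [set s]) :> (Omega -> R).
  apply/funext => w; rewrite indicE; congr ((nat_of_bool _)%:R).
  by apply/eqP/idP => [Xw|]; rewrite inE.
split; last by rewrite /mean /Rintegral integral_indic// setIT [X in fine X]PXs.
exact: integrable_indic.
Qed.

(** * Sigma-algebras and independence of the draws *)

Section Sampling.
Variables (R : realType) (m b : nat) (dXi : measure_display).
Variables (Xi : measurableType dXi) (Pxi : probability Xi R).
Variables (d : measure_display) (Omega : measurableType d) (P : probability Omega R).
Variables (T : nat) (batch : nat -> nat) (p : 'I_b -> R) (PR : nat -> R).
Variables (ik : nat -> Omega -> 'I_b) (xi : nat -> nat -> Omega -> Xi).
Variables (u : nat -> nat -> Omega -> 'cV[R]_m) (stop : Omega -> nat).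
Hypothesis samp : zsbmd_sampling P Pxi T batch p PR ik xi u stop.

Let D := draws_made T batch.
Let E := draw_events ik xi u stop.

Definition generated_by (K : set draw) := g_sigma_algebraType (\bigcup_(j in K) E j).

Lemma draw_eventsI j : setI_closed (E j).
Proof.
case: j => [k|k t|k t|]; try exact: preimage_systemI.
move=> _ _ [A _ <-] [A' _ <-]; exists (A `&` A') => //.
by rewrite !setTI.
Qed.

Lemma draw_eventsT j : E j setT.
Proof.
case: j => [k|k t|k t|]; try exact: preimage_systemT.
by exists setT => //; rewrite setTI.
Qed.

Lemma measurable_draw_events j : D j -> E j `<=` measurable.
Proof.
have [mik mxi mu_ [mst _ _] _] := samp.
case: j => [k|k t|k t|] /=.
- move=> kT _ [A _ <-]; rewrite setTI.
  rewrite (_ : _ @^-1` A = \bigcup_(s in A) (ik k @^-1` [set s])).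
    apply: fin_bigcup_measurable => [|s _]; first exact: finite_finset.
    by case: (mik k s kT).
  apply/seteqP; split => [w Aw|w [s As /= wE]]; first by exists (ik k w).
  by rewrite wE.
- by move=> [kT tB]; apply: preimage_system_measurable; case: (mxi k t kT tB).
- by move=> [kT tB]; apply: preimage_system_measurable; case: (mu_ k t kT tB).
- by move=> _; exact: preimage_system_measurable.
Qed.

Lemma generated_oracle K k t : K (Oracle k t) ->
  measurable_fun [set: generated_by K] (xi k t).
Proof. by move=> Kj; exact: (@measurable_generated _ _ _ _ (Oracle k t)). Qed.

Lemma generated_direction K k t : K (Direction k t) ->
  measurable_fun [set: generated_by K] (u k t : _ -> borel_cV R m).
Proof. by move=> Kj; exact: (@measurable_generated _ _ _ _ (Direction k t)). Qed.

Lemma generated_stop K : K Stop -> measurable_fun [set: generated_by K] stop.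
Proof. by move=> Kj; exact: (@measurable_generated _ _ _ _ Stop). Qed.

Lemma generated_block K k s : K (Block k) ->
  measurable_fun [set: generated_by K] (fun w => (ik k w == s)%:R : R).
Proof.
move=> Kj _ A mA; rewrite setTI; apply: sub_sigma_algebra; exists (Block k) => //.
by exists [set i | A (i == s)%:R] => //; rewrite setTI.
Qed.

Lemma generated_mono (K K' : set draw) d' (S : measurableType d') (X : Omega -> S) :
  K `<=` K' -> measurable_fun [set: generated_by K] X ->
  measurable_fun [set: generated_by K'] X.
Proof.
move=> KK' mX _ A mA; have := mX measurableT A mA; apply: sub_sigma_algebra2.
by move=> C [j /KK' K'j EC]; exists j.
Qed.

Lemma generated_indep (K K' : set draw) d1 (T1 : measurableType d1) d2
    (T2 : measurableType d2) (X : Omega -> T1) (Y : Omega -> T2) :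
  K `<=` D -> K' `<=` D -> K `&` K' = set0 ->
  measurable_fun [set: generated_by K] X ->
  measurable_fun [set: generated_by K'] Y ->
  indep_systems P (preimage_set_system setT X measurable)
    (preimage_set_system setT Y measurable).
Proof.
have [_ _ _ _ indD] := samp => KD K'D KK' mX mY.
exact: (@grouped_indep _ _ _ _ _ _ _ indD measurable_draw_events draw_eventsI
  draw_eventsT _ _ KD K'D KK' _ _ _ _ _ _ mX mY).
Qed.

Lemma generated_decoupling (K K' : set draw) (h : Omega -> Omega -> \bar R) :
  K `<=` D -> K' `<=` D -> K `&` K' = set0 ->
  measurable_fun [set: generated_by K * generated_by K'] (fun z => h z.1 z.2) ->
  (forall w w', (0 <= h w w')%E) ->
  (\int[P]_w h w w = \int[P]_w \int[P]_w' h w w')%E.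
Proof.
have [_ _ _ _ indD] := samp => KD K'D KK'.
exact: (grouped_decoupling indD measurable_draw_events draw_eventsI
  draw_eventsT KD K'D KK').
Qed.

(** The label [Stop] is in no [history], so the output index is independent of all iterates. *)
Definition history k : set draw := [set j | D j /\ match j with
  | Block i | Oracle i _ | Direction i _ => (i < k)%N | Stop => False end].

Definition current k : set draw := [set j | D j /\ match j with
  | Block i | Oracle i _ | Direction i _ => i = k | Stop => False end].

Lemma history_current k : history k `&` current k = set0.
Proof.
rewrite -subset0 => j [[_ hj] [_ cj]]; case: j hj cj => [i|i t|i t|] //=;
  by move=> /[swap] ->; rewrite ltnn.
Qed.

Lemma historyS k : history k `<=` history k.+1.
Proof.
by move=> j [Dj hj]; split => //; case: j hj {Dj} => [i|i t|i t|] //=; exact: ltnW.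
Qed.

Lemma current_history k : current k `<=` history k.+1.
Proof. by move=> j [Dj cj]; split => //; case: j cj {Dj} => [i|i t|i t|] //= ->. Qed.

End Sampling.

(** * The method *)

Section Method.
Variables (R : realType) (b : nat) (nb : 'I_b -> nat).
Variables (Xs : forall s : 'I_b, set 'cV[R]_(nb s)).
Variables (phi chi : forall s : 'I_b, 'cV[R]_(nb s) -> R).
Arguments Xs : clear implicits.
Arguments phi : clear implicits.
Arguments chi : clear implicits.
Variables (dXi : measure_display) (Xi : measurableType dXi) (Pxi : probability Xi R).
Let n := totdim nb.
Variables (F : 'cV[R]_n -> Xi -> R) (f : 'cV[R]_n -> R).
Variables (sigma Lf M alpha mu Phi_star : R) (L : 'I_b -> R) (N : set Xi) (B : nat).
Let X := block_product Xs.
Let Phi y := f y + block_sum chi y.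

Hypothesis ccX : forall s, closed_convex_set (Xs s).
Hypothesis ccchi : forall s, closed_convex_fun (chi s).
Hypothesis phiP : forall s,
  (forall y, differentiable (phi s) y) /\ strongly_convex1 (phi s).
Hypothesis mF : measurable_fun [set: borel_cV R n * Xi] (fun z => F z.1 z.2).
Hypotheses (mN : measurable N) (N0 : Pxi N = 0%E).
Hypothesis dF : forall z, ~ N z -> forall x, differentiable (F^~ z) x.
Hypothesis Lf0 : 0 < Lf.
Hypothesis LF : forall z, ~ N z -> forall x y,
  enorm (grad (F^~ z) x - grad (F^~ z) y) <= Lf * enorm (x - y).
Hypothesis LsF : forall z, ~ N z -> forall (s : 'I_b) x (h : 'cV[R]_(nb s)),
  enorm (blk nb s (grad (F^~ z) (x + U nb s *m h)) - blk nb s (grad (F^~ z) x))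
    <= L s * enorm h.
Hypotheses (A1 : assumption1 Pxi F f X sigma) (A3 : assumption3 f X M).
Hypotheses (mu0 : 0 < mu) (alpha0 : 0 < alpha) (B0 : (0 < B)%N) (b0 : (0 < b)%N).
Hypothesis alphaL : forall s, L s * alpha <= 1.
Hypothesis Phi_min : forall y, X y -> Phi_star <= Phi y.

Let df y : differentiable f y. Proof. by case: A1. Qed.

Variables (d : measure_display) (Omega : measurableType d) (P : probability Omega R).
Variables (T : nat) (p : 'I_b -> R) (PR : nat -> R).
Variables (ik : nat -> Omega -> 'I_b) (xi : nat -> nat -> Omega -> Xi).
Variables (u : nat -> nat -> Omega -> 'cV[R]_n) (stop : Omega -> nat).
Let batch (k : nat) := B.
Hypothesis samp : zsbmd_sampling P Pxi T batch p PR ik xi u stop.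
Hypothesis pE : forall s, p s = 1 / b%:R.

Let step k y w := block_step Xs phi chi alpha y
  (batch_grad F mu B y ((xi k)^~ w) ((u k)^~ w)) (ik k w).

Variables (x1 : 'cV[R]_n) (x : nat -> Omega -> 'cV[R]_n).
Hypotheses (Xx1 : X x1) (x_1 : forall w, x 1 w = x1).
Hypothesis x_S : forall k w, (1 <= k <= T)%N -> x k.+1 w = step k (x k w) w.

Let Gen K := generated_by ik xi u stop K.
Let hist := history T batch.
Let cur := current T batch.

Let Xs0 s : Xs s !=set0. Proof. by exists (blk nb s x1). Qed.

(** The shift to [k.+1] covers [x 1] to [x T.+1]; the recursion says nothing about [x 0]. *)
Lemma iterate_in k w : (k < T.+1)%N -> X (x k.+1 w).
Proof.
elim: k => [_|k IH kT]; first by rewrite x_1.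
by rewrite x_S//; apply: block_step_in => //; apply: IH; exact: ltnW.
Qed.

Lemma measurable_iterate k : (k < T.+1)%N ->
  measurable_fun [set: Gen (hist k.+1)] (x k.+1 : Omega -> borel_cV R n).
Proof.
elim: k => [_|k IH kT].
  by rewrite (_ : x 1 = fun=> x1); [exact: measurable_cst|exact/funext].
rewrite (_ : x k.+2 = fun w => step k.+1 (x k.+1 w) w); last first.
  by apply/funext => w; rewrite x_S.
apply: (@measurable_step R b nb Xs phi chi alpha ccX Xs0 ccchi phiP alpha0 _ _ F mu B
  mF _ (Gen (hist k.+2))).
- by apply: generated_mono (IH (ltnW kT)); exact: historyS.
- by move=> t tB; apply: generated_oracle; apply: current_history; split.
- by move=> t tB; apply: generated_direction; apply: current_history; split.
- by move=> s; apply: generated_block; apply: current_history; split.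
Qed.

Let V := zo_second_moment n Lf sigma M mu.
Let b2 := mu ^+ 2 * Lf ^+ 2 / 4 * (n%:R * (n%:R + 2)).
Let H y := dot (gen_grad Xs phi chi y (grad f y) alpha)
               (gen_grad Xs phi chi y (grad f y) alpha).
Let Psi y := Phi y - Phi_star.
Let c := alpha / (8 * b%:R).
Let C := alpha / b%:R * (7 / 2 * b2 + 3 / 2 * (V / B%:R)).

Let generated (K : set draw) d' (S : measurableType d') (Y : Omega -> S) :
  K `<=` draws_made T batch -> measurable_fun [set: Gen K] Y ->
  measurable_fun setT Y.
Proof. exact: (grouped_measurable (measurable_draw_events samp)). Qed.

Lemma expected_iteration k y : (1 <= k <= T)%N -> X y ->
  summable_rv P (fun w => Psi (step k y w)) /\
  mean P (fun w => Psi (step k y w)) <= Psi y + C - c * H y.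
Proof.
move=> kT Xy; have [mik mxi gu _ _] := samp.
have lawi s : mean P (fun w => (ik k w == s)%:R) = 1 / b%:R.
  by have [m1 m2] := mik k s kT; rewrite (mean_indicator m1 m2).2.
have mi s : measurable_fun setT (fun w => (ik k w == s)%:R : R).
  have [m1 m2] := mik k s kT; exact: summable_rv_measurable (mean_indicator m1 m2).1.
have xiu t : (1 <= t <= B)%N -> indep_systems P
    (preimage_set_system setT (xi k t) measurable)
    (preimage_set_system setT (u k t : Omega -> borel_cV R n) measurable).
  move=> tB; apply: (@generated_indep _ _ _ _ _ _ _ _ _ _ _ _ _ _ _ _ _ samp
    [set Oracle k t] [set Direction k t]).
  - by move=> _ ->.
  - by move=> _ ->.
  - by rewrite -subset0 => _ [->].
  - exact: generated_oracle.
  - exact: generated_direction.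
have pairs s t : (1 <= s <= B)%N -> (1 <= t <= B)%N -> s != t -> indep_systems P
    (preimage_set_system setT (fun w => (xi k s w, u k s w : borel_cV R n)) measurable)
    (preimage_set_system setT (fun w => (xi k t w, u k t w : borel_cV R n)) measurable).
  move=> sB tB st; apply: (@generated_indep _ _ _ _ _ _ _ _ _ _ _ _ _ _ _ _ _ samp
    [set Oracle k s; Direction k s] [set Oracle k t; Direction k t]).
  - by move=> _ [->|->].
  - by move=> _ [->|->].
  - by rewrite -subset0 => _ [[->|->] [[]|[]]] //= /eqP; rewrite (negbTE st).
  - by apply: measurable_fun_pair; [apply: generated_oracle; left|
      apply: generated_direction; right].
  - by apply: measurable_fun_pair; [apply: generated_oracle; left|
      apply: generated_direction; right].
have ig z s : indep_systems P
    (preimage_set_system setT (fun w => (ik k w == s)%:R : R) measurable)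
    (preimage_set_system setT ((fun w => batch_grad F mu B z ((xi k)^~ w) ((u k)^~ w)) :
      Omega -> borel_cV R n) measurable).
  apply: (@generated_indep _ _ _ _ _ _ _ _ _ _ _ _ _ _ _ _ _ samp
    (* The direction only involves oracle and direction draws, hence is measurable for all draws
       other than the block index. *)
    [set Block k] [set j | draws_made T batch j /\ j != Block k]).
  - by move=> _ ->.
  - by move=> j [].
  - by rewrite -subset0 => _ [-> []]; rewrite /= eqxx.
  - exact: generated_block.
  - apply: (@measurable_batch_grad _ _ _ _ _ F mu B mF _ (Gen _) (fun=> z)) => //.
    + by move=> t tB; apply: generated_oracle; split.
    + by move=> t tB; apply: generated_direction; split.
have [s1 s2] := expected_step ccX ccchi phiP mF mN N0 dF Lf0 LF LsF A1 A3 mu0 alpha0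
  B0 b0 alphaL Phi_min (fun t tB => (mxi k t kT tB).1) (fun t tB => (mxi k t kT tB).2)
  (fun t tB => gu k t kT tB) xiu pairs mi lawi ig Xy.
split => //; apply: le_trans s2 _; rewrite /Psi /C /c /H /b2 /V /Phi.
have bn : b%:R != 0 :> R by rewrite pnatr_eq0 -lt0n.
have Bn : B%:R != 0 :> R by rewrite pnatr_eq0 -lt0n.
by rewrite le_eqVlt; apply/orP; left; apply/eqP; field; rewrite bn Bn.
Qed.

Let histD k : hist k `<=` draws_made T batch. Proof. by move=> j []. Qed.

Let curD k : cur k `<=` draws_made T batch. Proof. by move=> j []. Qed.

Let mPsi : measurable_fun [set: borel_cV R n] (Psi : borel_cV R n -> R).
Proof. by apply: measurable_funB => //; exact: measurable_objective. Qed.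

Let mx k : (k < T.+1)%N -> measurable_fun setT (x k.+1 : Omega -> borel_cV R n).
Proof. by move=> kT; exact: (generated (@histD k.+1) (measurable_iterate kT)). Qed.

Let mH : measurable_fun [set: borel_cV R n] (H : borel_cV R n -> R).
Proof. exact: measurable_gen_grad_norm2. Qed.

Let Psi0 y : X y -> 0 <= Psi y.
Proof. by move=> Xy; rewrite subr_ge0; exact: Phi_min. Qed.

Lemma expected_progress k : (k < T)%N ->
  summable_rv P (fun w => Psi (x k.+1 w)) ->
  [/\ summable_rv P (fun w => Psi (x k.+2 w)),
      summable_rv P (fun w => H (x k.+1 w))
    & mean P (fun w => Psi (x k.+2 w)) + c * mean P (fun w => H (x k.+1 w))
        <= mean P (fun w => Psi (x k.+1 w)) + C].
Proof.
move=> kT sPsi; have kT' : (1 <= k.+1 <= T)%N by [].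
have Xk w : X (x k.+1 w) by apply: iterate_in; exact: ltnW.
have Xk1 w : X (x k.+2 w) by exact: iterate_in.
have c0 : 0 < c by rewrite divr_gt0// mulr_gt0// ltr0n.
(* [decoupling] evaluates the step at unrelated outcomes and asks for
   nonnegativity everywhere, which [Psi] has only on [X]. *)
pose PsiP y := Num.max (Psi y) 0.
have PsiPE y : X y -> PsiP y = Psi y by move=> Xy; apply/max_idPl; exact: Psi0.
pose h w w' := (PsiP (step k.+1 (x k.+1 w) w'))%:E.
have h0 w w' : (0 <= h w w')%E by rewrite lee_fin le_max lexx orbT.
have mh : measurable_fun [set: Gen (hist k.+1) * Gen (cur k.+1)] (fun z => h z.1 z.2).
  apply/measurable_EFinP; apply: measurable_maxr => //; apply: (measurableT_comp mPsi).
  have m1 : measurable_fun [set: Gen (hist k.+1) * Gen (cur k.+1)] fst by exact: measurable_fst.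
  have m2 : measurable_fun [set: Gen (hist k.+1) * Gen (cur k.+1)] snd by exact: measurable_snd.
  have mo t : (1 <= t <= B)%N -> measurable_fun [set: Gen (cur k.+1)] (xi k.+1 t).
    by move=> tB; apply: generated_oracle; split.
  have md t : (1 <= t <= B)%N ->
      measurable_fun [set: Gen (cur k.+1)] (u k.+1 t : Omega -> borel_cV R n).
    by move=> tB; apply: generated_direction; split.
  have mi s : measurable_fun [set: Gen (cur k.+1)] (fun w => (ik k.+1 w == s)%:R : R).
    by apply: generated_block; split.
  apply: (@measurable_step R b nb Xs phi chi alpha ccX Xs0 ccchi phiP alpha0 _ _ F mu B
    mF _ (Gen (hist k.+1) * Gen (cur k.+1))%type (fun z => x k.+1 z.1)
    (fun t z => xi k.+1 t z.2) (fun t z => u k.+1 t z.2) (fun z => ik k.+1 z.2)).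
  - exact: (measurableT_comp (measurable_iterate (ltnW kT)) m1).
  - by move=> t tB; apply: (measurableT_comp (mo t tB) m2).
  - by move=> t tB; apply: (measurableT_comp (md t tB) m2).
  - by move=> s; apply: (measurableT_comp (mi s) m2).
have := @generated_decoupling _ _ _ _ _ _ _ _ _ _ _ _ _ _ _ _ _ samp
  (hist k.+1) (cur k.+1) h (@histD _) (@curD _) (history_current T batch k.+1) mh h0.
have -> : (\int[P]_w h w w = \int[P]_w (Psi (x k.+2 w))%:E)%E.
  by apply: eq_integral => w _; rewrite /h -x_S// PsiPE.
move=> intE.
have inner w : (\int[P]_w' h w w' <= (Psi (x k.+1 w) + C - c * H (x k.+1 w))%:E)%E.
  have [s1 s2] := expected_iteration kT' (Xk w).
  rewrite (_ : (\int[P]_w' h w w' =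
      (mean P (fun w' => Psi (step k.+1 (x k.+1 w) w')))%:E)%E) ?lee_fin//.
  rewrite EFin_mean//; apply: eq_integral => w' _; rewrite /h PsiPE//.
  exact: (block_step_in ccX ccchi phiP alpha0 _ _ (Xk w)).
(* The bound on a nonnegative inner integral is itself nonnegative, so [c * H <= Psi + C] pointwise:
   this is the source of the summability of [H] along the iterates. *)
have r0 w : 0 <= Psi (x k.+1 w) + C - c * H (x k.+1 w).
  by rewrite -lee_fin; apply: le_trans (inner w); exact: integral_ge0.
have sC : summable_rv P (fun w => Psi (x k.+1 w) + C).
  by apply: summable_rvD => //; exact: summable_rv_cst.
have mHk : measurable_fun setT (fun w => H (x k.+1 w)).
  by apply: (measurableT_comp mH); apply: mx; exact: ltnW.
have scH : summable_rv P (fun w => c * H (x k.+1 w)).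
  apply: summable_rv_le sC => [|w]; first exact: measurable_funM.
  rewrite ger0_norm; first by rewrite -subr_ge0.
  by apply: mulr_ge0; [exact: ltW|exact: dot_ge0].
have sH : summable_rv P (fun w => H (x k.+1 w)).
  have -> : (fun w => H (x k.+1 w)) = (fun w => c^-1 * (c * H (x k.+1 w))).
    by apply/funext => w; rewrite mulKf// gt_eqF.
  exact: summable_rvZ.
have sr : summable_rv P (fun w => Psi (x k.+1 w) + C - c * H (x k.+1 w)).
  exact: summable_rvB.
have le_int : (\int[P]_w (Psi (x k.+2 w))%:E <=
    (mean P (fun w => Psi (x k.+1 w) + C - c * H (x k.+1 w)))%:E)%E.
  rewrite intE EFin_mean//; apply: ge0_le_integral_monotone => // w.
  exact: integral_ge0.
have sPsi1 : summable_rv P (fun w => Psi (x k.+2 w)).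
  apply/integrableP; split.
    by apply/measurable_EFinP; apply: (measurableT_comp mPsi); exact: mx.
  under eq_integral do rewrite /= ger0_norm ?Psi0//.
  exact: le_lt_trans le_int (ltry _).
split => //; move: le_int; rewrite -EFin_mean// lee_fin meanB// meanD//; last first.
  exact: summable_rv_cst.
by rewrite mean_cst meanZ//; lra.
Qed.

Lemma telescoped_progress k : (k <= T)%N ->
  [/\ summable_rv P (fun w => Psi (x k.+1 w)),
      forall j, (j < k)%N -> summable_rv P (fun w => H (x j.+1 w))
    & mean P (fun w => Psi (x k.+1 w)) + c * \sum_(j < k) mean P (fun w => H (x j.+1 w))
        <= Psi x1 + k%:R * C].
Proof.
elim: k => [_|k IH kT].
  under eq_fun do rewrite x_1; split => //; first exact: summable_rv_cst.
  by rewrite mean_cst big_ord0 mulr0 mul0r.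
have [s1 s2 s3] := IH (ltnW kT); have [s4 s5 s6] := expected_progress kT s1.
split; first exact: s4.
  by move=> j; rewrite ltnS leq_eqVlt => /predU1P[->|jk]; [exact: s5|exact: s2].
rewrite big_ord_recr /= -natr1 mulrDl mul1r mulrDr.
have arith (e0 e1 e2 e3 e4 e5 e6 : R) : e0 + e1 <= e2 + e3 -> e2 + e4 <= e5 + e6 ->
  e0 + (e4 + e1) <= e5 + (e6 + e3) by lra.
exact: arith s6 s3.
Qed.

Hypothesis T0 : (0 < T)%N.
Hypothesis PRE : forall k, (1 <= k <= T)%N -> PR k = 1 / T%:R.

(** The output index is uniform and independent of each iterate, so the left-hand side is [1/T]
    times the telescoped sum. Division by [c * T] gives [1 / c = 8 b / alpha] and
    [C / c = 28 b2 + 12 V / B]. *)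
Lemma mean_output_norm2 :
  summable_rv P (fun w => H (x (stop w) w)) /\
  mean P (fun w => H (x (stop w) w)) <=
    8 * b%:R * Psi x1 / (alpha * T%:R) + (28 * b2 + 12 * (V / B%:R)).
Proof.
have [sT sH tele] := telescoped_progress (leqnn T).
have [_ _ _ [mst stT lawst] _] := samp.
have sum_stop (h : nat -> R) w : h (stop w) = \sum_(j < T) (stop w == j.+1)%:R * h j.+1.
  have := stT w; case: (stop w) => // k /= kT.
  rewrite (bigD1 (Ordinal kT))//= eqxx mul1r big1 ?addr0// => j jk.
  rewrite eqSS (_ : (k == j) = false) ?mul0r//; apply/negbTE; apply: contraNneq jk => kj.
  by apply/eqP/val_inj.
have mst' k : measurable (stop @^-1` [set k]).
  by rewrite -[X in measurable X]setTI; exact: mst.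
have term (j : 'I_T) :
    summable_rv P (fun w => (stop w == j.+1)%:R * H (x j.+1 w)) /\
    mean P (fun w => (stop w == j.+1)%:R * H (x j.+1 w)) =
      1 / T%:R * mean P (fun w => H (x j.+1 w)).
  have jT : (1 <= j.+1 <= T)%N by rewrite /= ltn_ord.
  have [i1 i2] := @mean_indicator _ _ _ P nat stop j.+1 _
    (mst' j.+1) (lawst _ jT).
  rewrite -(PRE jT) -i2; apply: indep_summable_rvM => //; first exact: sH.
  apply: (@generated_indep _ _ _ _ _ _ _ _ _ _ _ _ _ _ _ _ _ samp
    [set Stop] (hist j.+1)).
  - by move=> _ ->.
  - exact: histD.
  - by rewrite -subset0 => _ [-> []].
  - have mq : measurable_fun [set: nat] (fun k => (k == j.+1)%:R : R) by [].
    have ms : measurable_fun [set: Gen [set Stop]] stop by exact: generated_stop.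
    exact: (measurableT_comp mq ms).
  - exact: (measurableT_comp mH (measurable_iterate (ltn_trans (ltn_ord j) (ltnSn T)))).
rewrite (_ : (fun w => H (x (stop w) w)) =
    fun w => \sum_(j < T) (stop w == j.+1)%:R * H (x j.+1 w)); last first.
  by apply/funext => w; rewrite -(sum_stop (fun k => H (x k w))).
split; first by apply: summable_rv_sum => j; case: (term j).
rewrite mean_sum; last by move=> j; case: (term j).
rewrite [leLHS](eq_bigr (fun j : 'I_T => 1 / T%:R * mean P (fun w => H (x j.+1 w)))).
  2: by move=> j _; case: (term j).
rewrite -mulr_sumr; move: tele; set S := \sum_(j < T) _ => tele.
have m0 : 0 <= mean P (fun w => Psi (x T.+1 w)).
  by apply: mean_ge0 => w; apply: Psi0; exact: iterate_in.
have [Tp bp Bp] : [/\ 0 < T%:R :> R, 0 < b%:R :> R & 0 < B%:R :> R].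
  by rewrite !ltr0n.
have le_S : c * S <= Psi x1 + T%:R * C by lra.
have cT0 : 0 < c * T%:R by rewrite mulr_gt0// divr_gt0// mulr_gt0.
rewrite -(ler_pM2l cT0).
have -> : c * T%:R * (1 / T%:R * S) = c * S by field; rewrite gt_eqF.
apply: le_trans le_S _; rewrite le_eqVlt /C /c; apply/orP; left; apply/eqP.
by field; rewrite !gt_eqF.
Qed.

End Method.

Lemma le_fmax (R : realType) (b : nat) (a : 'I_b -> R) s : a s <= fmax a.
Proof.
apply: ub_le_sup; last by exists s.
exists (\sum_t `|a t|) => _ [t _ <-].
by rewrite (bigD1 t)//= (le_trans (ler_norm _))// lerDl sumr_ge0.
Qed.

Lemma le_fmin (R : realType) (b : nat) (a : 'I_b -> R) (c : R) :
  (0 < b)%N -> (forall s, c <= a s) -> c <= fmin a.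
Proof.
move=> b0 ca; apply: lb_le_inf; first by exists (a (Ordinal b0)), (Ordinal b0).
by move=> _ [s _ <-].
Qed.

(** The batch sizes are prescribed only on steps [1] to [T], where the sampling property reads them;
    this lets a constant function stand for them. *)
Lemma sampling_eq_batch d (Omega : measurableType d) (R : realType)
    (P : probability Omega R) (m b : nat) dXi (Xi : measurableType dXi)
    (Pxi : probability Xi R) (T : nat) (batch batch' : nat -> nat) (p : 'I_b -> R)
    (PR : nat -> R) ik xi (u : nat -> nat -> Omega -> 'cV[R]_m) stop :
  (forall k, (1 <= k <= T)%N -> batch k = batch' k) ->
  zsbmd_sampling P Pxi T batch p PR ik xi u stop ->
  zsbmd_sampling P Pxi T batch' p PR ik xi u stop.
Proof.
move=> bb' [sik sxi su sst sind]; split => //.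
- by move=> k t kT; rewrite -bb'//; exact: sxi.
- by move=> k t kT; rewrite -bb'//; exact: su.
- rewrite (_ : draws_made T batch' = draws_made T batch)//.
  by apply/seteqP; split => -[k|k t|k t|] //= [kT]; rewrite ?bb'// -?bb'.
Qed.

(** All weights are equal, so only their positivity is at stake: [L s <= Lhat] makes each factor
    [1 - L s / (2 Lhat)] at least [1/2]. *)
Lemma output_weight_uniform (R : realType) (b T : nat) (alpha : nat -> R) (p L : 'I_b -> R)
    (k : nat) :
  let weight := fun k => alpha k * fmin (fun s => p s * (1 - L s / 2 * alpha k)) in
  (0 < b)%N -> 0 < fmax L ->
  (forall k, (1 <= k <= T)%N -> alpha k = 1 / fmax L) ->
  (forall s, p s = 1 / b%:R) -> (1 <= k <= T)%N ->
  weight k / \sum_(1 <= j < T.+1) weight j = 1 / T%:R.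
Proof.
move=> weight b0 L0 alphaE pE kT.
have wE j : (1 <= j <= T)%N -> weight j = weight k.
  by move=> jT; rewrite /weight !alphaE.
rewrite (eq_big_nat _ _ (F2 := fun=> weight k)); last by move=> j jT; exact: wE.
rewrite sumr_const_nat subSS subn0 -[weight k *+ T]mulr_natl.
have bp : 0 < b%:R :> R by rewrite ltr0n.
have Tp : 0 < T%:R :> R by rewrite ltr0n (leq_trans _ (andP kT).2)//; case/andP: kT.
suff w0 : 0 < weight k by field; rewrite !gt_eqF.
rewrite /weight alphaE// mulr_gt0 ?divr_gt0//.
apply: (@lt_le_trans _ _ (1 / b%:R / 2)); first by rewrite !divr_gt0.
apply: le_fmin => // s; rewrite pE ler_pM2l ?divr_gt0//.
have : L s / fmax L <= 1 by rewrite ler_pdivrMr// mul1r le_fmax.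
lra.
Qed.

Theorem corollary2
    (R : realType)
    (* the problem *)
    (b : nat) (nb : 'I_b -> nat)
    (Xs : forall s : 'I_b, set 'cV[R]_(nb s))
    (chi : forall s : 'I_b, 'cV[R]_(nb s) -> R)
    (dXi : measure_display) (Xi : measurableType dXi) (Pxi : probability Xi R)
    (F : 'cV[R]_(totdim nb) -> Xi -> R) (f : 'cV[R]_(totdim nb) -> R)
    (Phi_star : R)
    (* constants of the assumptions and prox-functions *)
    (sigma Lf M : R) (L : 'I_b -> R)
    (phi : forall s : 'I_b, 'cV[R]_(nb s) -> R)
    (* parameters of the method *)
    (x1 : 'cV[R]_(totdim nb)) (mu : R) (T : nat)
    (alpha : nat -> R) (batch : nat -> nat) (T' : nat)
    (p : 'I_b -> R) (PR : nat -> R)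
    (* randomness and iterates *)
    (d : measure_display) (Omega : measurableType d) (P : probability Omega R)
    (ik : nat -> Omega -> 'I_b) (xi : nat -> nat -> Omega -> Xi)
    (u : nat -> nat -> Omega -> 'cV[R]_(totdim nb)) (stop : Omega -> nat)
    (x : nat -> Omega -> 'cV[R]_(totdim nb)) :
  let n : R := (totdim nb)%:R in
  let X := block_product Xs in
  let Phi := fun y => f y + block_sum chi y in
  let Lhat := fmax L in
  let weight := fun k => alpha k * fmin (fun s => p s * (1 - L s / 2 * alpha k)) in
  let D_Phi := Num.sqrt ((Phi x1 - Phi_star) / Lhat) in
  let sigma_tilde2 :=
    4 * (n + 4) * (2 * M ^+ 2 + sigma ^+ 2 + mu ^+ 2 * Lf ^+ 2 * (n + 4) ^+ 2) in
  (forall s, closed_convex_set (Xs s)) ->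
  (forall s, closed_convex_fun (chi s)) ->
  measurable_fun [set: borel_cV R (totdim nb) * Xi] (fun z => F z.1 z.2) ->
  is_minimum X Phi Phi_star ->
  assumption1 Pxi F f X sigma ->
  assumption2 Pxi F Lf L ->
  assumption3 f X M ->
  (forall s, (forall y, differentiable (phi s) y) /\ strongly_convex1 (phi s)) ->
  X x1 ->
  0 < mu ->
  (forall k, (1 <= k <= T)%N -> 0 < alpha k) ->
  (forall k, (1 <= k <= T)%N -> (1 <= batch k)%N) ->
  (forall s, 0 <= p s <= 1) ->
  \sum_(s < b) p s = 1 ->
  zsbmd_sampling P Pxi T batch p PR ik xi u stop ->
  zsbmd_iterates Xs phi chi F mu T alpha batch ik xi u x1 x ->
  (forall k, (1 <= k <= T)%N -> alpha k = 1 / Lhat) ->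
  (forall s, p s = 1 / b%:R) ->
  (forall k, (1 <= k <= T)%N -> batch k = T') ->
  (forall k, (1 <= k <= T)%N ->
     PR k = weight k / \sum_(1 <= j < T.+1) weight j) ->
  ('E_P[fun w => (enorm (gen_grad Xs phi chi (x (stop w) w)
                           (grad f (x (stop w) w)) (alpha (stop w))) ^+ 2)%R]
    <= ((8 * b%:R * Lhat ^+ 2 * D_Phi ^+ 2 + 8 * mu ^+ 2 * Lf ^+ 2 * n * b%:R)
          / T%:R
        + 16 * sigma_tilde2 * b%:R / T'%:R
        + mu ^+ 2 / 2 * Lf ^+ 2 * (n + 3) ^+ 3)%R%:E)%E.
Proof.
move=> n X Phi Lhat weight D_Phi sigma_tilde2 ccX ccchi mF [[y0 Xy0 Phiy0] Phi_min]
  A1 [Lf0 L0 [N [mN N0 subN]]] A3 phiP Xx1 mu0 alpha0 batch0 p01 psum samp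
  [x_1 x_S] alphaE pE batchE PRE.
have good z : ~ N z -> [/\ forall x, differentiable (F^~ z) x,
    forall x y, enorm (grad (F^~ z) x - grad (F^~ z) y) <= Lf * enorm (x - y)
  & forall (s : 'I_b) (x : 'cV[R]_(totdim nb)) (h : 'cV[R]_(nb s)),
      enorm (blk nb s (grad (F^~ z) (x + U nb s *m h)) - blk nb s (grad (F^~ z) x))
        <= L s * enorm h].
  by move=> Nz; apply: contrapT => bad; exact/Nz/subN.
have b0 : (0 < b)%N.
  case: (posnP b) => // b_0; exfalso; have := oner_neq0 R; rewrite -psum big1 ?eqxx//.
  by case=> i ib; exfalso; rewrite b_0 in ib.
have stT : forall w, (1 <= stop w <= T)%N by case: samp => _ _ _ [].
(* Any outcome will do: its output index lies between [1] and [T]. *)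
have T0 : (0 < T)%N by have /andP[s1 s2] := stT point; exact: leq_trans s1 s2.
have T'0 : (0 < T')%N by rewrite -(batchE 1%N)//; exact: batch0.
have Lhat0 : 0 < Lhat by apply: lt_le_trans (L0 (Ordinal b0)) _; exact: le_fmax.
pose a := 1 / Lhat; have a0 : 0 < a by rewrite divr_gt0.
have aL s : L s * a <= 1 by rewrite /a mulrA mulr1 ler_pdivrMr// mul1r le_fmax.
have samp' := sampling_eq_batch (batch' := fun=> T') batchE samp.
have x_step k w : (1 <= k <= T)%N -> x k.+1 w = block_step Xs phi chi a (x k w)
    (batch_grad F mu T' (x k w) ((xi k)^~ w) ((u k)^~ w)) (ik k w).
  move=> kT; apply: blk_inj => s; rewrite blk_block_step x_S//; case: eqP => // _.
  by rewrite blk_batch_grad batchE// alphaE.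
have PR1 k : (1 <= k <= T)%N -> PR k = 1 / T%:R.
  by move=> kT; rewrite PRE//; exact: output_weight_uniform.
have [sH mH] := mean_output_norm2 ccX ccchi phiP mF mN N0
  (fun z Nz => let: And3 h _ _ := good z Nz in h) Lf0
  (fun z Nz => let: And3 _ h _ := good z Nz in h)
  (fun z Nz => let: And3 _ _ h := good z Nz in h)
  A1 A3 mu0 a0 T'0 b0 aL Phi_min samp' pE Xx1 x_1 x_step T0 PR1.
rewrite unlock (_ : (\int[P]_w _ = (mean P (fun w => dot
    (gen_grad Xs phi chi (x (stop w) w) (grad f (x (stop w) w)) a)
    (gen_grad Xs phi chi (x (stop w) w) (grad f (x (stop w) w)) a)))%:E)%E); last first.
  by rewrite EFin_mean//; apply: eq_integral => w _; rewrite sqr_enorm alphaE.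
rewrite lee_fin; apply: le_trans mH _.
have Psi0 : 0 <= (Phi x1 - Phi_star) / Lhat.
  by apply: divr_ge0; [rewrite subr_ge0; exact: Phi_min|exact: ltW].
rewrite /D_Phi sqr_sqrtr// -/n -/(Phi x1).
have [Tp bp T'p] : [/\ 0 < T%:R :> R, 1 <= b%:R :> R & 0 < T'%:R :> R].
  by rewrite !ltr0n ler1n.
have n0 : 0 <= n by rewrite /n.
have sq0 : 0 <= mu ^+ 2 * Lf ^+ 2 by rewrite mulr_ge0 ?sqr_ge0.
have -> : 8 * b%:R * (Phi x1 - Phi_star) / (a * T%:R) =
    8 * b%:R * Lhat ^+ 2 * ((Phi x1 - Phi_star) / Lhat) / T%:R.
  by rewrite /a; field; rewrite !gt_eqF.
have e1 : 0 <= 8 * mu ^+ 2 * Lf ^+ 2 * n * b%:R / T%:R.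
  by apply: divr_ge0; rewrite ?mulr_ge0 ?sqr_ge0// ltW.
have e2 : 28 * (mu ^+ 2 * Lf ^+ 2 / 4 * (n * (n + 2))) <=
    mu ^+ 2 / 2 * Lf ^+ 2 * (n + 3) ^+ 3.
  have : 14 * (n * (n + 2)) <= (n + 3) ^+ 3.
    (* The difference of the two sides, [n^3 - 5 n^2 - n + 27], exceeds this product by
       [3 n / 4 + 5 / 2]; [7/2] is close to where the cubic is smallest on [n >= 0]. *)
    have : 0 <= (n - 7 / 2) ^+ 2 * (n + 2) by rewrite mulr_ge0 ?sqr_ge0 ?addr_ge0.
    lra.
  by move/(ler_wpM2l sq0); lra.
have e3 : 12 * (zo_second_moment (totdim nb) Lf sigma M mu / T'%:R) <=
    16 * sigma_tilde2 * b%:R / T'%:R.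
  rewrite mulrA ler_pM2r ?invr_gt0// /zo_second_moment -/n.
  have v0 : 0 <= mu ^+ 2 * Lf ^+ 2 / 2 * (n + 4) ^+ 3.
    by rewrite mulr_ge0 ?exprn_ge0 ?addr_ge0// divr_ge0.
  have M0 : 0 <= M ^+ 2 := sqr_ge0 M; have s0 : 0 <= sigma ^+ 2 := sqr_ge0 sigma.
  have st0 : 0 <= sigma_tilde2.
    by rewrite /sigma_tilde2;
      do ![exact: sqr_ge0 | done | apply: addr_ge0 | apply: mulr_ge0].
  (* Term by term: [2 (n + 2)] is below both [8 (n + 4)] and [4 (n + 4)], and the cubic term is
     multiplied by [8]. *)
  have Vst : 2 * ((n + 2) * (M ^+ 2 + sigma ^+ 2)) +
      mu ^+ 2 * Lf ^+ 2 / 2 * (n + 4) ^+ 3 <= sigma_tilde2.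
    have -> : sigma_tilde2 = 8 * (n + 4) * M ^+ 2 +
        4 * (n + 4) * sigma ^+ 2 + 8 * (mu ^+ 2 * Lf ^+ 2 / 2 * (n + 4) ^+ 3).
      by rewrite /sigma_tilde2; field.
    nra.
  have : sigma_tilde2 * 1 <= sigma_tilde2 * b%:R by rewrite ler_wpM2l.
  lra.
rewrite mulrDl; lra.
Qed.
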